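(* Let $(M,g)$ be an $n$-dimensional Riemannian manifold and let $T^1_1(M)$ be its $(1,1)$-tensor bundle equipped with the rescaled Sasaki type metric ${}^Sg_f$ and the paracomplex structure $J$ defined by $J({}^HX)=-{}^HX$, $J({}^VA)={}^VA$ for all vector fields $X$ and $(1,1)$-tensor fields $A$ on $M$. The triple $(T^1_1(M),J,{}^Sg_f)$ is a para-Kähler-Norden (paraholomorphic Norden) manifold if and only if $M$ is flat.
   Context: All objects are of class $C^\infty$; Einstein summation. $f>0$ is a smooth function on $M$. $\nabla$ is the Levi-Civita connection of $g$ with coefficients $\Gamma_{ij}^h$. $T^1_1(M)$ is the bundle of $(1,1)$-tensors over $M$, a manifold of dimension $n+n^2$, with induced local coordinates $(x^j,t_j^i)$, a point being $t=t_j^i\,\partial_i\otimes dx^j$ at $x$. The vertical lift of a $(1,1)$-tensor field $A=A_j^i\,\partial_i\otimes dx^j$ is ${}^VA=A_j^i\,\partial/\partial t_j^i$; the horizontal lift of a vector field $X$ is ${}^HX=X^j\,\partial/\partial x^j+X^s(\Gamma_{sj}^mt_m^i-\Gamma_{sm}^it_j^m)\,\partial/\partial t_j^i$. The rescaled Sasaki type metric is the Riemannian metric on $T^1_1(M)$ defined by ${}^Sg_f({}^VA,{}^VB)=g_{ic}g^{jl}A_j^iB_l^c$, ${}^Sg_f({}^VA,{}^HY)=0$, ${}^Sg_f({}^HX,{}^HY)=f\,g(X,Y)$ (functions on $M$ being pulled back to $T^1_1(M)$). An almost paracomplex manifold is an almost product manifold $(N,\varphi)$, $\varphi$ a $(1,1)$-tensor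 field with $\varphi^2=\mathrm{id}$, $\varphi\ne\pm\mathrm{id}$, such that the two eigenbundles of $\varphi$ associated with the eigenvalues $+1$ and $-1$ have the same rank (so $\dim N$ is even). An almost paracomplex Norden manifold $(N,\varphi,h)$ is a manifold $N$ of even dimension with an almost paracomplex structure $\varphi$ and a Riemannian metric $h$ such that $h(\varphi X,Y)=h(X,\varphi Y)$ for all vector fields $X,Y$. It is a paracomplex Norden manifold if $\varphi$ is integrable (near every point there are coordinates in which the matrix of $\varphi$ is constant). A paraholomorphic Norden manifold, also called a para-Kähler-Norden manifold, is a paracomplex Norden manifold whose metric satisfies $\phi_\varphi h=0$, where $$(\phi_\varphi h)(X,Y,Z)=(\varphi X)(h(Y,Z))-X(h(\varphi Y,Z))+h((L_Y\varphi)X,Z)+h(Y,(L_Z\varphi)X),$$ $L$ denoting the Lie derivative. The condition $\phi_\varphi h=0$ is equivalent to $\nabla^h\varphi=0$, with $\nabla^h$ the Levi-Civita connection of $h$. ''Flat'' means that the curvature tensor of $g$ vanishes.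
   Formalization: J's eigenbundles have ranks n² and n, so for flat M with n ≥ 2 the triple fails the equal-rank clause of ''paracomplex''. The equivalence is proved with that clause dropped, and also with it kept but assumed for J; n ≥ 1 is assumed, since for n = 0 J = ±id. *)

(* Defs.v *)
From HB Require Import structures.
From mathcomp Require Import all_boot all_order all_algebra.
From mathcomp Require Import all_classical all_reals all_analysis.

Set Implicit Arguments.
Unset Strict Implicit.
Unset Printing Implicit Defensive.

Import Order.TTheory GRing.Theory Num.Theory.
Import numFieldNormedType.Exports.

Local Open Scope classical_set_scope.
Local Open Scope ring_scope.

(** * Smooth maps on open subsets of R^d *)

Definition partial (R : realType) (d : nat) (V : normedModType R) (k : 'I_d)
    (u : 'rV[R]_d -> V) : 'rV[R]_d -> V :=
  fun x => 'D_(delta_mx 0 k) u x.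

Fixpoint C_upto (R : realType) (d : nat) (V : normedModType R) (m : nat)
    (U : set 'rV[R]_d) (u : 'rV[R]_d -> V) : Prop :=
  (forall x, U x -> {for x, continuous u}) /\
  if m is m'.+1 then
    forall k : 'I_d,
      (forall x, U x -> derivable u x (delta_mx 0 k)) /\
      C_upto m' U (partial k u)
  else True.

Definition smooth (R : realType) (d : nat) (V : normedModType R)
    (U : set 'rV[R]_d) (u : 'rV[R]_d -> V) : Prop :=
  forall m, C_upto m U u.

(** * Manifolds *)

Record chart (R : realType) (T : pointedType) (d : nat) := Chart {
  dom : set T;
  coord : T -> 'rV[R]_d }.

Definition param (R : realType) (T : pointedType) (d : nat)
    (c : chart R T d) : 'rV[R]_d -> T :=
  'pinv_(fun=> point) (dom c) (coord c).

(* Row convention: the entry (k, l) of [chart_jac c1 c2 p] is dy^l/dx^k at p,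
   x being the coordinates of c1 and y those of c2. *)
Definition chart_jac (R : realType) (T : pointedType) (d : nat)
    (c1 c2 : chart R T d) (p : T) : 'M[R]_d :=
  jacobian (coord c2 \o param c1) (coord c1 p).

Definition compatible (R : realType) (T : pointedType) (d : nat)
    (c1 c2 : chart R T d) : Prop :=
  [/\ open (coord c1 @` (dom c1 `&` dom c2)),
      open (coord c2 @` (dom c1 `&` dom c2)),
      smooth (coord c1 @` (dom c1 `&` dom c2)) (coord c2 \o param c1) &
      smooth (coord c2 @` (dom c1 `&` dom c2)) (coord c1 \o param c2)].

(* A set with a family of charts. No topology is given on the set: it is the
   one defined by the charts (see [open_in]). *)
Record charted (R : realType) (d : nat) := Charted {
  points :> pointedType;
  idx : Type;
  atlas : idx -> chart R points d }.

Definition open_in (R : realType) (d : nat) (M : charted R d) (W : set M)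
    : Prop :=
  forall i : idx M, open (coord (atlas i) @` (dom (atlas i) `&` W)).

Definition admissible (R : realType) (d : nat) (M : charted R d)
    (c : chart R M d) : Prop :=
  [/\ set_inj (dom c) (coord c), open (coord c @` dom c) &
      forall i : idx M, compatible c (atlas i)].

(* Nonempty (the carrier is pointed), Hausdorff, and covered by countably many
   charts of the atlas: for locally Euclidean spaces this is second
   countability. *)
Definition manifold (R : realType) (d : nat) (M : charted R d) : Prop :=
  [/\ forall i : idx M, admissible (atlas i),
      forall p q : M, p <> q -> exists A B : set M,
        [/\ open_in A, open_in B, A p, B q & A `&` B = set0] &
      exists s : nat -> idx M, forall p : M, exists k, dom (atlas (s k)) p].

(** * Tensor fields *)

(* A tensor field on an open set W is given by its components at each point of
   W in each chart of the atlas; the components [F i p] are irrelevant when p is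
   not in both W and the domain of the chart i. *)
Definition components (R : realType) (d : nat) (M : charted R d) (V : Type) :=
  idx M -> M -> V.

Definition in_chart (R : realType) (d : nat) (M : charted R d) (V : Type)
    (F : components M V) (i : idx M) : 'rV[R]_d -> V :=
  fun x => F i (param (atlas i) x).

Definition smooth_on (R : realType) (d : nat) (M : charted R d)
    (V : normedModType R) (W : set M) (F : components M V) : Prop :=
  forall i : idx M,
    smooth (coord (atlas i) @` (dom (atlas i) `&` W)) (in_chart F i).

Definition smooth_function (R : realType) (d : nat) (M : charted R d)
    (f : M -> R) : Prop :=
  smooth_on setT (fun _ p => (f p : R^o)).

Definition vector_field (R : realType) (d : nat) (M : charted R d)
    (W : set M) (X : components M 'rV[R]_d) : Prop :=
  smooth_on W X /\
  forall i j p, W p -> dom (atlas i) p -> dom (atlas j) p ->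
    X j p = X i p *m chart_jac (atlas i) (atlas j) p.

(* The entry (j, i) of a (1,1)-tensor is A_j^i (row: covariant index, column:
   contravariant index), so that A maps the row vector X to X *m A. *)
Definition tensor11_at (R : realType) (d : nat) (M : charted R d) (p : M)
    (A : idx M -> 'M[R]_d) : Prop :=
  forall i j, dom (atlas i) p -> dom (atlas j) p ->
    A i *m chart_jac (atlas i) (atlas j) p =
    chart_jac (atlas i) (atlas j) p *m A j.

Definition tensor11_field (R : realType) (d : nat) (M : charted R d)
    (W : set M) (A : components M 'M[R]_d) : Prop :=
  smooth_on W A /\ forall p, W p -> tensor11_at p (A^~ p).

Definition app11 (R : realType) (d : nat) (M : charted R d)
    (A : components M 'M[R]_d) (X : components M 'rV[R]_d)
    : components M 'rV[R]_d :=
  fun i p => X i p *m A i p.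

Definition bilin (R : realType) (d : nat) (h : 'M[R]_d) (v w : 'rV[R]_d) : R :=
  (v *m h *m w^T) 0 0.

Definition riemannian_metric (R : realType) (d : nat) (M : charted R d)
    (g : components M 'M[R]_d) : Prop :=
  [/\ smooth_on setT g,
      forall i j p, dom (atlas i) p -> dom (atlas j) p ->
        g i p = chart_jac (atlas i) (atlas j) p *m g j p
                *m (chart_jac (atlas i) (atlas j) p)^T,
      forall i p, dom (atlas i) p -> (g i p)^T = g i p &
      forall i p, dom (atlas i) p ->
        forall v : 'rV[R]_d, v != 0 -> 0 < bilin (g i p) v v].

(** * Levi-Civita connection and curvature *)

(* [christoffel G x a b c] is Gamma_{ab}^c at x. *)
Definition christoffel (R : realType) (d : nat) (G : 'rV[R]_d -> 'M[R]_d)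
    (x : 'rV[R]_d) (a b c : 'I_d) : R :=
  2^-1 * \sum_(l < d) invmx (G x) c l *
    (partial a (fun y => (G y l b : R^o)) x
     + partial b (fun y => (G y a l : R^o)) x
     - partial l (fun y => (G y a b : R^o)) x).

(* R(d_a, d_b) d_c = R_{abc}^l d_l *)
Definition curvature (R : realType) (d : nat) (G : 'rV[R]_d -> 'M[R]_d)
    (x : 'rV[R]_d) (a b c l : 'I_d) : R :=
  partial a (fun y => (christoffel G y b c l : R^o)) x
  - partial b (fun y => (christoffel G y a c l : R^o)) x
  + \sum_(m < d) (christoffel G x a m l * christoffel G x b c m
                  - christoffel G x b m l * christoffel G x a c m).

Definition flat (R : realType) (d : nat) (M : charted R d)
    (g : components M 'M[R]_d) : Prop :=
  forall (i : idx M) (p : M), dom (atlas i) p ->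
  forall a b c l : 'I_d,
    curvature (in_chart g i) (coord (atlas i) p) a b c l = 0.

(** * The (1,1)-tensor bundle *)

(* A point is a (1,1)-tensor at a point of M, i.e. the family of its component
   matrices in the charts at that point (set to 0 in the other charts). *)
Record T11_point (R : realType) (n : nat) (M : charted R n) := T11Point {
  foot : M;
  comps : idx M -> 'M[R]_n;
  compsP : tensor11_at foot comps;
  comps_out : forall i, ~ dom (atlas i) foot -> comps i = 0 }.

Lemma tensor11_at0 (R : realType) (n : nat) (M : charted R n) (p : M) :
  tensor11_at p (fun=> 0).
Proof. by move=> i j _ _; rewrite mul0mx mulmx0. Qed.

HB.instance Definition _ (R : realType) (n : nat) (M : charted R n) :=
  gen_eqMixin (T11_point M).
HB.instance Definition _ (R : realType) (n : nat) (M : charted R n) :=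
  gen_choiceMixin (T11_point M).
HB.instance Definition _ (R : realType) (n : nat) (M : charted R n) :=
  isPointed.Build (T11_point M)
    (@T11Point R n M point (fun=> 0) (@tensor11_at0 R n M point)
       (fun _ _ => erefl)).

(* Induced coordinates (x^j, t_j^i), the latter listed by [mxvec]. *)
Definition T11_chart (R : realType) (n : nat) (M : charted R n) (i : idx M)
    : chart R (T11_point M) (n + n * n) :=
  Chart [set P : T11_point M | dom (atlas i) (foot P)]
        (fun P => row_mx (coord (atlas i) (foot P)) (mxvec (comps P i))).

Definition T11 (R : realType) (n : nat) (M : charted R n)
    : charted R (n + n * n) :=
  Charted (@T11_chart R n M).

Definition vlift (R : realType) (n : nat) (M : charted R n)
    (A : components M 'M[R]_n) : components (T11 M) 'rV[R]_(n + n * n) :=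
  fun (i : idx M) (P : T11_point M) => row_mx 0 (mxvec (A i (foot P))).

Definition hlift (R : realType) (n : nat) (M : charted R n)
    (g : components M 'M[R]_n) (X : components M 'rV[R]_n)
    : components (T11 M) 'rV[R]_(n + n * n) :=
  fun (i : idx M) (P : T11_point M) =>
    let Gam := christoffel (in_chart g i) (coord (atlas i) (foot P)) in
    let t := comps P i in
    row_mx (X i (foot P))
      (mxvec (\matrix_(j < n, k < n) \sum_(s < n) X i (foot P) 0 s *
         \sum_(m < n) (Gam s j m * t m k - Gam s m k * t j m))).

(* g_{ic} g^{jl} A_j^i B_l^c *)
Definition fibre_metric (R : realType) (n : nat) (G A B : 'M[R]_n) : R :=
  \sum_(i < n) \sum_(c < n) \sum_(j < n) \sum_(l < n)
    G i c * invmx G j l * A j i * B l c.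

(* Sections are taken over arbitrary open subsets of M. *)
Definition rescaled_sasaki (R : realType) (n : nat) (M : charted R n)
    (g : components M 'M[R]_n) (f : M -> R)
    (S : components (T11 M) 'M[R]_(n + n * n)) : Prop :=
  riemannian_metric S /\
  forall (U : set M) (A B : components M 'M[R]_n) (X Y : components M 'rV[R]_n),
    open_in U -> tensor11_field U A -> tensor11_field U B ->
    vector_field U X -> vector_field U Y ->
  forall (i : idx M) (P : T11_point M), dom (atlas i) (foot P) -> U (foot P) ->
    [/\ bilin (S i P) (vlift A i P) (vlift B i P) =
          fibre_metric (g i (foot P)) (A i (foot P)) (B i (foot P)),
        bilin (S i P) (vlift A i P) (hlift g Y i P) = 0 &
        bilin (S i P) (hlift g X i P) (hlift g Y i P) =
          f (foot P) * bilin (g i (foot P)) (X i (foot P)) (Y i (foot P))].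

Definition horizontal_vertical_structure (R : realType) (n : nat)
    (M : charted R n) (g : components M 'M[R]_n)
    (J : components (T11 M) 'M[R]_(n + n * n)) : Prop :=
  tensor11_field setT J /\
  forall (U : set M) (A : components M 'M[R]_n) (X : components M 'rV[R]_n),
    open_in U -> tensor11_field U A -> vector_field U X ->
  forall (i : idx M) (P : T11_point M), dom (atlas i) (foot P) -> U (foot P) ->
    app11 J (hlift g X) i P = - hlift g X i P /\
    app11 J (vlift A) i P = vlift A i P.

(** * Almost paracomplex Norden structures *)

Definition almost_product (R : realType) (d : nat) (N : charted R d)
    (phi : components N 'M[R]_d) : Prop :=
  [/\ tensor11_field setT phi,
      forall i p, dom (atlas i) p -> phi i p *m phi i p = 1%:M,
      ~ (forall i p, dom (atlas i) p -> phi i p = 1%:M) &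
      ~ (forall i p, dom (atlas i) p -> phi i p = - 1%:M)].

Definition eigenbundles_same_rank (R : realType) (d : nat) (N : charted R d)
    (phi : components N 'M[R]_d) : Prop :=
  forall i p, dom (atlas i) p ->
    \rank (eigenspace (phi i p) 1) = \rank (eigenspace (phi i p) (-1)).

Definition almost_paracomplex (R : realType) (d : nat) (N : charted R d)
    (phi : components N 'M[R]_d) : Prop :=
  almost_product phi /\ eigenbundles_same_rank phi.

Definition norden_metric (R : realType) (d : nat) (N : charted R d)
    (phi h : components N 'M[R]_d) : Prop :=
  riemannian_metric h /\
  forall (W : set N) (X Y : components N 'rV[R]_d),
    open_in W -> vector_field W X -> vector_field W Y ->
  forall i p, dom (atlas i) p -> W p ->
    bilin (h i p) (app11 phi X i p) (Y i p) =
    bilin (h i p) (X i p) (app11 phi Y i p).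

Definition integrable_structure (R : realType) (d : nat) (N : charted R d)
    (phi : components N 'M[R]_d) : Prop :=
  forall p : N, exists (c : chart R N d) (C : 'M[R]_d),
    [/\ admissible c, dom c p &
        forall i q, dom c q -> dom (atlas i) q ->
          phi i q *m chart_jac (atlas i) c q =
          chart_jac (atlas i) c q *m C].

Definition lie_bracket (R : realType) (d : nat)
    (X Y : 'rV[R]_d -> 'rV[R]_d) : 'rV[R]_d -> 'rV[R]_d :=
  fun x => 'D_(X x) Y x - 'D_(Y x) X x.

(* (L_Y phi) X = [Y, phi X] - phi [Y, X] *)
Definition lie_derivative11 (R : realType) (d : nat)
    (Y : 'rV[R]_d -> 'rV[R]_d) (phi : 'rV[R]_d -> 'M[R]_d)
    (X : 'rV[R]_d -> 'rV[R]_d) : 'rV[R]_d -> 'rV[R]_d :=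
  fun x => lie_bracket Y (fun y => X y *m phi y) x
           - lie_bracket Y X x *m phi x.

Definition tachibana (R : realType) (d : nat) (phi h : 'rV[R]_d -> 'M[R]_d)
    (X Y Z : 'rV[R]_d -> 'rV[R]_d) (x : 'rV[R]_d) : R :=
  'D_(X x *m phi x) (fun y => (bilin (h y) (Y y) (Z y) : R^o)) x
  - 'D_(X x) (fun y => (bilin (h y) (Y y *m phi y) (Z y) : R^o)) x
  + bilin (h x) (lie_derivative11 Y phi X x) (Z x)
  + bilin (h x) (Y x) (lie_derivative11 Z phi X x).

Definition tachibana_vanishes (R : realType) (d : nat) (N : charted R d)
    (phi h : components N 'M[R]_d) : Prop :=
  forall (W : set N) (X Y Z : components N 'rV[R]_d),
    open_in W -> vector_field W X -> vector_field W Y -> vector_field W Z ->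
  forall i p, dom (atlas i) p -> W p ->
    tachibana (in_chart phi i) (in_chart h i)
      (in_chart X i) (in_chart Y i) (in_chart Z i) (coord (atlas i) p) = 0.

Definition almost_paracomplex_norden (R : realType) (d : nat) (N : charted R d)
    (phi h : components N 'M[R]_d) : Prop :=
  [/\ manifold N, ~~ odd d, almost_paracomplex phi & norden_metric phi h].

Definition para_kahler_norden (R : realType) (d : nat) (N : charted R d)
    (phi h : components N 'M[R]_d) : Prop :=
  [/\ almost_paracomplex_norden phi h, integrable_structure phi &
      tachibana_vanishes phi h].

(* All the requirements of [para_kahler_norden] except the equality of the
   ranks of the two eigenbundles. The horizontal and vertical distributions of
   the (1,1)-tensor bundle have ranks n and n^2, which differ for n > 1. *)
Definition para_kahler_norden_any_rank (R : realType) (d : nat)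
    (N : charted R d) (phi h : components N 'M[R]_d) : Prop :=
  [/\ manifold N /\ ~~ odd d, almost_product phi, norden_metric phi h,
      integrable_structure phi & tachibana_vanishes phi h].

(* Main.v *)
From HB Require Import structures.
From mathcomp Require Import all_boot all_order all_algebra.
From mathcomp Require Import all_classical all_reals all_analysis.
From mathcomp Require Import ring lra.
Require Import Defs.

(** In an induced chart a point of the bundle is z = (x, t), with x in the chart of
    M and t a matrix. Write Gamma_a for the matrix of the connection in the constant
    direction a and [A, B] = A B - B A. The horizontal lift of a is the field
    H_a = (a, [Gamma_a, t]), the vertical lift of a constant matrix B is
    V_B = (0, B), and these fields form a frame on which J is -1 and 1 and the metric
    is f g(a, b), 0 and the fibre metric of A and B. Their Lie brackets are all
    vertical: those of two vertical fields vanish, that of V_B and H_a is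
    V_[Gamma_a, B], and that of H_a and H_b is V_[R(a, b), t], with R the curvature
    of M (frame_lie_bracket).

    Since J is symmetric for the metric h, the phi-operator is a tensor (tachibanaE),
    and it suffices to evaluate it on the frame. With signs e_X, e_Y of the fields,
    verticality of the brackets gives (tachibana_frame)

      (e_X - e_Y) X(h(Y, Z)) + (e_X - 1) (h([Y, X], Z) + h(Y, [Z, X])).

    If X is horizontal and Y, Z are vertical, this vanishes because parallel transport
    preserves the fibre metric (derive_fibre_metric); the only other terms that do
    not vanish identically are fibre products of [R(b, a), t] with a matrix B. So
    flatness implies that the phi-operator vanishes (flat_tachibana). Conversely, if
    it vanishes, then R(a, b) commutes with every matrix t, hence is scalar; being
    skew for the metric, it is zero (curvature_mx_central, tachibana_flat).

    It remains to see that J is integrable when M is flat. A flat connection has a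
    local parallel frame, a matrix P with dP = Gamma P (smooth_parallel_frame). The
    entries of P^-1 t P are constant along horizontal fields, so that x and P^-1 t P
    are coordinates in which J is the constant matrix diag(-1, 1)
    (flat_integrable). The parallel frame is built by solving a linear differential
    equation along each ray from the centre of a ball (linear_ode); flatness enters
    in showing that the endpoint of the solution is differentiable in the ray, with
    the right differential (parallel_frame).

    All other requirements hold without any assumption on the curvature: the bundle
    is a manifold of even dimension n + n^2 (T11_manifold), J is an almost product
    structure (almost_product_J), and the metric is pure for J (Sg_norden_metric). *)

Set Implicit Arguments.
Unset Strict Implicit.
Unset Printing Implicit Defensive.

Import Order.TTheory GRing.Theory Num.Theory.
Import numFieldNormedType.Exports.

Local Open Scope classical_set_scope.
Local Open Scope ring_scope.

(** * Differentiability and directional derivatives *)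

Section LinearCombination.
Variables (R : realType) (d : nat) (W : normedModType R).

Definition lcomb (c : 'I_d -> W) (h : 'rV[R]_d) : W := \sum_k h 0 k *: c k.

Fact lcomb_linear c : linear (lcomb c).
Proof.
move=> a u v; rewrite /lcomb scaler_sumr -big_split /=.
by apply: eq_bigr => k _; rewrite !mxE scalerDl scalerA.
Qed.

HB.instance Definition _ c :=
  GRing.isLinear.Build R 'rV[R]_d W *:%R (lcomb c) (@lcomb_linear c).

Lemma lcomb_continuous c : continuous (lcomb c).
Proof.
rewrite /lcomb; elim: (index_enum _) => [|k s IHs] x.
  by under eq_fun do rewrite big_nil; exact: (@cst_continuous _ W 0).
under eq_fun do rewrite big_cons.
apply: (@continuousD R W 'rV[R]_d (fun h => h 0 k *: c k)
  (fun h => \sum_(j <- s) h 0 j *: c j) x) (IHs x).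
by apply: continuousZr_tmp; exact: coord_continuous.
Qed.

Lemma lcomb_delta c k : lcomb c (delta_mx 0 k) = c k.
Proof.
rewrite /lcomb (bigD1 k) //= mxE !eqxx scale1r big1 ?addr0 // => l lk.
by rewrite mxE eqxx /= (negPf lk) scale0r.
Qed.

Lemma linear_lcomb (u : {linear 'rV[R]_d -> W}) h :
  u h = lcomb (fun k => u (delta_mx 0 k)) h.
Proof.
rewrite {1}(row_sum_delta h) linear_sum; apply: eq_bigr => k _.
by rewrite linearZ.
Qed.

End LinearCombination.

(** An epsilon-criterion that also identifies the differential: it is applied to
    functions of which only an explicit estimate is known. *)
Lemma differentiable_eps (R : realType) (V W : normedModType R) (f : V -> W)
    (df : {linear V -> W}) (x : V) :
  continuous df ->
  (forall e, 0 < e -> \forall h \near (0 : V),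
     `|f (h + x) - f x - df h| <= e * `|h|) ->
  differentiable f x /\ 'd f x = df :> (V -> W).
Proof.
move=> cdf fdf.
have E : f \o shift x = cst (f x) + df +o_ 0 id.
  apply/eqaddoP => e e0; near=> h.
  suff : `|f (h + x) - f x - df h| <= e * `|h| by rewrite opprD addrA.
  by near: h; exact: fdf.
have D := diff_unique cdf E.
by split=> //; apply/diff_locallyP; rewrite D.
Unshelve. all: by end_near. Qed.

Section Lines.
Variables (R : realType) (V W : normedModType R).
Implicit Types (f : V -> W) (x v : V).

Lemma is_derive_line f x v (s : R) :
  derivable f (x + s *: v) v ->
  is_derive s 1 (fun t : R => f (x + t *: v)) ('D_v f (x + s *: v)).
Proof.
move=> dfv; have E : (fun h : R => h^-1 *: (((fun t : R => f (x + t *: v))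
    \o shift s) (h *: 1) - f (x + s *: v))) =
  (fun h : R => h^-1 *: ((f \o shift (x + s *: v)) (h *: v) - f (x + s *: v))).
  apply/funext => h /=; congr (_ *: (f _ - _)).
  by rewrite [h *: 1]mulr1 scalerDl addrCA.
by split; rewrite /derivable /derive E.
Qed.

Lemma is_deriveZdir f x v (c : R) :
  derivable f x v -> is_derive x (c *: v) f (c *: 'D_v f x).
Proof.
move=> dfv; pose g (t : R) := f (x + t *: v).
have Eg : x = x + (0 : R) *: v by rewrite scale0r addr0.
have : is_derive (0 : R) 1 g ('D_v f x).
  by rewrite [in 'D_v _ _]Eg; apply: is_derive_line; rewrite -Eg.
case=> /derivable1_diffP dg Dg.
pose sc : R^o -> R^o := *:%R ^~ (c : R^o).
have dsc : is_diff (0 : R^o) sc sc by exact: is_diff_scalel.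
have dgc : is_diff (0 : R^o) (g \o sc) ('d g 0 \o sc).
  by apply: is_diff_comp; have -> : sc 0 = 0 by [rewrite /sc scale0r]; exact: differentiableP.
have E : (fun h : R => h^-1 *: ((f \o shift x) (h *: (c *: v)) - f x)) =
   (fun h : R => h^-1 *: (((g \o sc) \o shift 0) (h *: 1) - (g \o sc) 0)).
  apply/funext => h /=; rewrite /g /sc addr0 !scale0r addr0.
  by congr (_ *: (f _ - _)); rewrite addrC [h *: 1]mulr1 scalerA.
have d1 : differentiable (g \o sc) 0 by apply: ex_diff.
split; rewrite /derivable /derive E; first exact: diff_derivable d1.
rewrite -/(derive (g \o sc) (0 : R^o) 1) deriveE // diff_val /= /sc scale1r.
by rewrite -[X in 'd g 0 X]mulr1 -[c * 1]/(c *: (1 : R^o)) linearZ -deriveE // Dg.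
Qed.

End Lines.

(** Along the segment from x to x + v a function is a function of one real
    variable whose derivative is a directional derivative; this avoids any
    multivariate mean value theorem. *)
Lemma mvt_line (R : realType) (V : normedModType R) (u : V -> R^o) (x v : V) :
  (forall s : R, 0 <= s <= 1 -> derivable u (x + s *: v) v) ->
  exists2 s : R, 0 <= s <= 1 & u (x + v) - u x = 'D_v u (x + s *: v).
Proof.
move=> du; pose g (t : R) := u (x + t *: v).
have dg (s : R) : 0 <= s <= 1 -> is_derive s 1 g ('D_v u (x + s *: v)).
  by move=> s01; exact/is_derive_line/du.
have [|||s s01] := @MVT_segment R g (fun s => 'D_v u (x + s *: v)) 0 1.
- exact: ler01.
- by move=> s; rewrite in_itv /= => /andP[s0 s1]; apply: dg; rewrite !ltW.
- apply: derivable_within_continuous => s; rewrite in_itv /= => s01.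
  by have [] := dg s s01.
rewrite /g scale1r scale0r addr0 subr0 mulr1 => E.
by exists s => //; move: s01; rewrite in_itv.
Qed.

Lemma mx_entry_le (R : realType) m n (A : 'M[R]_(m, n)) i j : `|A i j| <= `|A|.
Proof.
rewrite [leRHS]/Num.Def.normr /= mx_normrE.
exact: (le_bigmax _ (fun ij : 'I_m * 'I_n => `|A ij.1 ij.2|) (i, j)).
Qed.

Lemma mx_norm_le (R : realType) m n (A : 'M[R]_(m, n)) (e : R) :
  0 <= e -> (forall i j, `|A i j| <= e) -> `|A| <= e.
Proof.
by move=> e0 Ae; rewrite /Num.Def.normr /= mx_normrE bigmax_le // => -[i j] _.
Qed.

Lemma nbhs_line_ball (R : realType) (V : normedModType R) (x : V) (P : set V) :
  nbhs x P -> exists2 e : R, 0 < e & forall h, `|h| < e -> P (x + h).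
Proof.
move=> /nbhs_ballP[e /= e0 eP]; exists e => // h he; apply: eP.
by rewrite -ball_normE /= opprD addNKr normrN.
Qed.

Lemma near0_norm_lt (R : realType) (V : normedModType R) (r : R) :
  0 < r -> \forall h \near (0 : V), `|h| < r.
Proof.
move=> r0; apply/nbhs_ballP; exists r => // h.
by rewrite -ball_normE /= sub0r normrN.
Qed.

(** Moving from x to x + h one coordinate at a time, each increment is a partial
    derivative at a nearby point, and continuity of the partial derivatives makes
    the total error o(h). It links the predicate C_upto, which speaks of partial
    derivatives only, to differentials. *)
Lemma C1_differentiable (R : realType) d (u : 'rV[R]_d -> R^o)
    (x : 'rV[R]_d) :
  (forall k, \forall y \near x, derivable u y (delta_mx 0 k)) ->
  (forall k, {for x, continuous (partial k u)}) ->
  differentiable u x /\ 'd u x = lcomb (fun k => partial k u x) :> (_ -> _).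
Proof.
move=> du cu; apply: differentiable_eps; first exact: lcomb_continuous.
move=> e e0.
(* the error e' is made d times, once per coordinate *)
pose e' := e / (d%:R + 1).
have e'0 : 0 < e' by rewrite divr_gt0 // ltr_wpDl.
have : \forall y \near x, forall k, derivable u y (delta_mx 0 k) /\
    `|partial k u x - partial k u y| <= e'.
  apply: (filter_forall (nbhs_filter x)) => k; near=> y; split; first by near: y; exact: du.
  by near: y; have /cvgrPdist_le := cu k; exact.
move=> /nbhs_line_ball[r r0 Hr]; apply: (filterS _ (@near0_norm_lt R 'rV[R]_d r r0)) => h hr.
(* the path from [x] to [x + h] that follows the coordinate axes in turn *)
pose p (k : nat) : 'rV[R]_d := \row_j (if (j < k)%N then h 0 j else 0).
have ple k : `|p k| <= `|h|.
  apply: mx_norm_le => // i j; rewrite mxE; case: ifP => _; first exact: mx_entry_le.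
  by rewrite normr0.
have pS (k : 'I_d) : p k.+1 = p k + h 0 k *: delta_mx 0 k.
  apply/rowP => j; rewrite !mxE eqxx /= ltnS leq_eqVlt -val_eqE /=.
  case: eqP => [jk|] /=; last by rewrite mulr0 addr0.
  by rewrite jk ltnn mulr1 add0r; congr (h _ _); exact: val_inj.
have p0 : p 0 = 0 by apply/rowP => j; rewrite !mxE.
have pd : p d = h by apply/rowP => j; rewrite !mxE ltn_ord.
have step (k : 'I_d) : `|u (x + p k.+1) - u (x + p k) - h 0 k * partial k u x|
    <= e' * `|h|.
  have inr (s : R) : 0 <= s <= 1 -> `|p k + s *: (h 0 k *: delta_mx 0 k)| < r.
    move=> /andP[s0 s1]; apply: le_lt_trans hr.
    apply: mx_norm_le => // i j; rewrite !mxE ord1 eqxx /=.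
    case: ifP => jk; last rewrite add0r; last first.
      case: eqP => _ /=; last by rewrite !mulr0 normr0.
      rewrite mulr1 normrM -[leRHS]mul1r ler_pM // ?mx_entry_le //.
      by rewrite ger0_norm.
    rewrite (_ : j == k = false) ?mulr0 ?addr0 ?mx_entry_le //.
    by apply: contraTF jk => /eqP->; rewrite ltnn.
  have [|s s01 E] := @mvt_line R 'rV[R]_d u (x + p k) (h 0 k *: delta_mx 0 k).
    move=> s s01; have [] := Hr _ (inr s s01) k; rewrite addrA => dk _.
    by have [] := is_deriveZdir (h 0 k) dk.
  rewrite pS addrA E.
  have [] := Hr _ (inr s s01) k; rewrite addrA => dk dxk.
  have [_ ->] := is_deriveZdir (h 0 k) dk.
  rewrite -[_ *: _]/(_ * _) -mulrBr normrM mulrC distrC.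
  by rewrite ler_pM // mx_entry_le.
have -> : u (h + x) - u x - lcomb (fun k => partial k u x) h =
    \sum_(k < d) (u (x + p k.+1) - u (x + p k) - h 0 k * partial k u x).
  rewrite sumrB; congr (_ - _).
  rewrite -(big_mkord xpredT (fun k => u (x + p k.+1) - u (x + p k))).
  by rewrite (telescope_sumr (fun k => u (x + p k))) // pd p0 addr0 [h + x]addrC.
apply: le_trans (ler_norm_sum _ _ _) _.
apply: (@le_trans _ _ (\sum_(k < d) e' * `|h|)); first exact: ler_sum.
rewrite sumr_const card_ord -mulr_natl mulrA ler_wpM2r //.
rewrite /e' mulrA ler_pdivrMr ?ltr_wpDl //.
by rewrite mulrC ler_pM2l // lerDl.
Unshelve. all: by end_near. Qed.

(** * Smooth maps on open sets *)

Lemma open_near (R : realType) (V : normedModType R) (U : set V) (x : V) :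
  open U -> U x -> \forall y \near x, U y.
Proof. by move=> oU Ux; apply: open_nbhs_nbhs. Qed.

Lemma near_eq_continuous (T U : topologicalType) (f g : T -> U) (x : T) :
  (\forall y \near x, f y = g y) -> {for x, continuous f} -> {for x, continuous g}.
Proof.
move=> fg cf; rewrite /prop_for /continuous_at -(nbhs_singleton fg).
by apply: cvg_trans cf; apply: near_eq_cvg; apply: filterS fg => y ->.
Qed.

Lemma continuous_le_norm (R : realType) (V W : normedModType R) (f : V -> W) x :
  (forall e, 0 < e -> \forall y \near x, `|f x - f y| <= e) <->
  {for x, continuous f}.
Proof. by split=> [fe|/cvgrPdist_le//]; exact/cvgrPdist_le. Qed.

Lemma continuous_mx (R : realType) (V : normedModType R) p q
    (F : V -> 'M[R]_(p, q)) (x : V) :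
  (forall i j, {for x, continuous (fun y => F y i j : R^o)}) ->
  {for x, continuous F}.
Proof.
move=> cF; apply/continuous_le_norm => e e0.
have : \forall y \near x, forall ij : 'I_p * 'I_q,
    `|F x ij.1 ij.2 - F y ij.1 ij.2| <= e.
  apply: (filter_forall (nbhs_filter x)) => -[i j] /=.
  by have /continuous_le_norm := cF i j; exact.
apply: filterS => y Fy; apply: mx_norm_le => [|i j]; first exact: ltW.
by have := Fy (i, j); rewrite !mxE.
Qed.

Lemma continuous_mulmx (R : realType) (V : normedModType R) p q r
    (A : V -> 'M[R]_(p, q)) (B : V -> 'M[R]_(q, r)) (x : V) :
  {for x, continuous A} -> {for x, continuous B} ->
  {for x, continuous (fun y => A y *m B y)}.
Proof.
move=> cA cB; apply: continuous_mx => i j.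
have -> : (fun y => (A y *m B y) i j : R^o) =
    \sum_k ((fun y => A y i k) * (fun y => B y k j)).
  by apply/funext => y; rewrite mxE fct_sumE.
elim/big_ind: _ => [|F G|k _]; first exact: cst_continuous.
  exact: continuousD.
apply: continuousM.
  apply: (@continuous_comp _ _ _ A (fun C : 'M[R]_(p, q) => C i k)) => //.
  exact: coord_continuous.
apply: (@continuous_comp _ _ _ B (fun C : 'M[R]_(q, r) => C k j)) => //.
exact: coord_continuous.
Qed.

Section CUpto.
Variables (R : realType) (d : nat).
Implicit Types (U : set 'rV[R]_d).

Section Codomain.
Variable V : normedModType R.
Implicit Types u v : 'rV[R]_d -> V.

Lemma C_upto_cont m U u x : C_upto m U u -> U x -> {for x, continuous u}.
Proof. by case: m => [|m] [cu _]; exact: cu. Qed.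

Lemma C_upto_eq m U u v : open U -> (forall x, U x -> u x = v x) ->
  C_upto m U u -> C_upto m U v.
Proof.
move=> oU; elim: m u v => [|m IHm] u v uv [cu du].
all: have nuv x : U x -> \forall y \near x, u y = v y
       by move=> Ux; apply: filterS (open_near oU Ux) => y; exact: uv.
all: have cv x : U x -> {for x, continuous v}
       by move=> Ux; exact: near_eq_continuous (nuv x Ux) (cu x Ux).
  by [].
split=> // k; have [dk ck] := du k; split.
  by move=> x Ux; exact: near_eq_derivable (nuv x Ux) (dk x Ux).
by apply: IHm ck => x Ux; apply: near_eq_derive; exact: nuv.
Qed.

Lemma C_upto_sub m U U' u : U' `<=` U -> C_upto m U u -> C_upto m U' u.
Proof.
move=> sU; elim: m u => [|m IHm] u [cu du].
  by split=> // x /sU; exact: cu.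
split=> [x /sU|k]; first exact: cu.
by have [dk ck] := du k; split=> [x /sU|]; [exact: dk|exact: IHm].
Qed.

Lemma C_uptoW m U u : C_upto m.+1 U u -> C_upto m U u.
Proof.
elim: m u => [|m IHm] u [cu du]; first by split.
by split=> // k; have [dk ck] := du k; split=> //; exact: IHm.
Qed.

Lemma smooth_eq U u v : open U -> (forall x, U x -> u x = v x) ->
  smooth U u -> smooth U v.
Proof. by move=> oU uv su m; apply: C_upto_eq (su m). Qed.

Lemma smooth_sub U U' u : U' `<=` U -> smooth U u -> smooth U' u.
Proof. by move=> sU su m; apply: C_upto_sub (su m). Qed.

Lemma smooth_partial U u k : smooth U u -> smooth U (partial k u).
Proof. by move=> su m; have [_ /(_ k)[]] := su m.+1. Qed.

Lemma smooth_cont U u x : smooth U u -> U x -> {for x, continuous u}.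
Proof. by move=> su; exact: C_upto_cont (su 0%N). Qed.

Lemma C_upto_cst m U (a : V) : C_upto m U (fun=> a).
Proof.
elim: m a => [|m IHm] a; first by split=> // x _; exact: cst_continuous.
split=> [x _|k]; first exact: cst_continuous.
split=> [x _|]; first exact: derivable_cst.
rewrite (_ : partial k (fun=> a) = fun=> 0); first exact: IHm.
by apply/funext => x; exact: derive_cst.
Qed.

Lemma C_uptoD m U u v : open U -> C_upto m U u -> C_upto m U v ->
  C_upto m U (fun x => u x + v x).
Proof.
move=> oU; elim: m u v => [|m IHm] u v [cu du] [cv dv].
all: have c x : U x -> {for x, continuous (fun x => u x + v x)}
       by move=> Ux; exact: (continuousD (cu x Ux) (cv x Ux)).
  by [].
split=> // k; have [duk cuk] := du k; have [dvk cvk] := dv k; split.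
  by move=> x Ux; exact: derivableD (duk x Ux) (dvk x Ux).
apply: C_upto_eq (IHm _ _ cuk cvk) => // x Ux.
by rewrite /partial -[RHS]/('D__ (u + v) x) deriveD //; [exact: duk|exact: dvk].
Qed.

Lemma C_upto_sum m U (I : Type) (s : seq I) (F : I -> 'rV[R]_d -> V) :
  open U -> (forall i, C_upto m U (F i)) ->
  C_upto m U (fun x => \sum_(i <- s) F i x).
Proof.
move=> oU cF; elim: s => [|i s IHs].
  by under eq_fun do rewrite big_nil; exact: C_upto_cst.
by under eq_fun do rewrite big_cons; exact: C_uptoD.
Qed.

End Codomain.

(** Smoothness of matrix-valued maps is checked entrywise, so that all closure
    properties reduce to real-valued functions. *)
Lemma C_upto_mx m U p q (F : 'rV[R]_d -> 'M[R]_(p, q)) : open U ->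
  C_upto m U F <-> forall i j, C_upto m U (fun x => F x i j : R^o).
Proof.
move=> oU; split.
  have cnt (G : 'rV[R]_d -> 'M[R]_(p, q)) i j (x : 'rV[R]_d) :
      {for x, continuous G} -> {for x, continuous (fun y => G y i j : R^o)}.
    move=> cG; apply: (@continuous_comp _ _ _ G (fun A : 'M[R]_(p, q) => A i j)) => //.
    exact: coord_continuous.
  move=> cF i j; elim: m F cF => [|m IHm] F [cF dF].
    by split=> // x Ux; apply: cnt; exact: cF.
  split=> [x Ux|]; first by apply: cnt; exact: cF.
  move=> k; have [dk ck] := dF k; split.
    by move=> x Ux; move/derivable_mxP : (dk x Ux).
  apply: C_upto_eq (IHm _ ck) => // x Ux.
  by rewrite /partial derive_mx ?mxE //; exact: dk.
have cnt n (G : 'rV[R]_d -> 'M[R]_(p, q)) x :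
    (forall i j, C_upto n U (fun x => G x i j : R^o)) -> U x ->
    {for x, continuous G}.
  by move=> cG Ux; apply: continuous_mx => i j; exact: C_upto_cont (cG i j) Ux.
elim: m F => [|m IHm] F cF; first by split=> // x; exact: cnt cF.
split=> [x|k]; first exact: cnt cF.
have dk x : U x -> derivable F x (delta_mx 0 k).
  by move=> Ux; apply/derivable_mxP => i j; have [_ /(_ k)[+ _]] := cF i j; apply.
split=> //; apply: IHm => i j; have [_ /(_ k)[_]] := cF i j.
apply: C_upto_eq => // x Ux.
by rewrite /partial derive_mx ?mxE //; exact: dk.
Qed.

Lemma smooth_mx U p q (F : 'rV[R]_d -> 'M[R]_(p, q)) : open U ->
  smooth U F <-> forall i j, smooth U (fun x => F x i j : R^o).
Proof.
move=> oU; split=> [sF i j m|sF m]; first exact: (C_upto_mx _ _ oU).1 (sF m) i j.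
by apply/(C_upto_mx _ _ oU) => i j; exact: sF.
Qed.

Implicit Types u v : 'rV[R]_d -> R^o.

Lemma C_uptoM m U u v : open U -> C_upto m U u -> C_upto m U v ->
  C_upto m U (fun x => u x * v x : R^o).
Proof.
move=> oU; elim: m u v => [|m IHm] u v uC vC; have [cu du] := uC;
  have [cv dv] := vC.
all: have c x : U x -> {for x, continuous (fun x => u x * v x : R^o)}
       by move=> Ux; exact: (continuousM (cu x Ux) (cv x Ux)).
  by [].
split=> // k; have [duk cuk] := du k; have [dvk cvk] := dv k; split.
  by move=> x Ux; exact: derivableM (duk x Ux) (dvk x Ux).
apply: (C_upto_eq oU _
    (C_uptoD oU (IHm _ _ (C_uptoW uC) cvk) (IHm _ _ (C_uptoW vC) cuk))).
move=> x Ux; rewrite /partial -[RHS]/('D__ (u * v) x) deriveM //.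
- exact: duk.
- exact: dvk.
Qed.

Lemma C_upto_coord m U (j : 'I_d) : C_upto m U (fun x => x 0 j : R^o).
Proof.
case: m => [|m]; first by split=> // x _; exact: coord_continuous.
split=> [x _|k]; first exact: coord_continuous.
have dj (x : 'rV[R]_d) : differentiable (fun x : 'rV[R]_d => x 0 j : R^o) x.
  exact: differentiable_coord.
split=> [x _|]; first exact: diff_derivable.
rewrite (_ : partial k _ = fun=> ((k == j)%:R : R^o)); first exact: C_upto_cst.
apply/funext => x; rewrite /partial /derive.
rewrite (_ : (fun _ => _) = fun h : R => h^-1 *: (h *: (k == j)%:R)); last first.
  by apply/funext => h /=; rewrite !mxE eqxx /= [j == k]eq_sym addrK.
apply: cvg_lim => //; apply: cvg_trans (@cvg_cst R^o (k == j)%:R R (0 : R)^' _).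
apply: near_eq_cvg; near=> h; rewrite scalerA mulVf ?scale1r //.
by near: h; exact: nbhs_dnbhs_neq.
Unshelve. all: by end_near. Qed.

(** By induction on the order, since the derivative of 1/u is -u'/u^2 and the
    induction hypothesis applies to 1/u. *)
Lemma C_uptoV m U u : open U -> (forall x, U x -> u x != 0) ->
  C_upto m U u -> C_upto m U (fun x => (u x)^-1 : R^o).
Proof.
move=> oU u0; elim: m u u0 => [|m IHm] u u0 uC; have [cu du] := uC.
all: have c x : U x -> {for x, continuous (fun x => (u x)^-1 : R^o)}
       by move=> Ux; apply: cvgV (cu x Ux); exact: u0.
  by [].
split=> // k; have [duk cuk] := du k; split.
  by move=> x Ux; apply: (@derivableV _ _ u); [exact: u0|exact: duk].
have iC := IHm _ u0 (C_uptoW uC).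
have := C_uptoM oU (C_uptoM oU (C_uptoM oU iC iC) (C_upto_cst m U (-1 : R^o))) cuk.
apply: C_upto_eq => // x Ux; rewrite /partial.
rewrite (@deriveV _ _ u) ?u0 //; last exact: duk.
by rewrite mulrN1 -invfM.
Qed.

Lemma smooth_differentiable U u x : open U -> smooth U u -> U x ->
  differentiable u x.
Proof.
move=> oU su Ux; have [_ du] := su 1%N.
have [k|k|//] := @C1_differentiable R d u x.
  by have [dk _] := du k; apply: filterS (open_near oU Ux) => y; exact: dk.
by have [_ [ck _]] := du k; exact: ck.
Qed.

End CUpto.

Section Smooth.
Variables (R : realType) (d : nat) (U : set 'rV[R]_d).
Hypothesis oU : open U.

Lemma smooth_cst (V : normedModType R) (a : V) : smooth U (fun=> a).
Proof. by move=> m; exact: C_upto_cst. Qed.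

Lemma smooth_coord (j : 'I_d) : smooth U (fun x => x 0 j : R^o).
Proof. by move=> m; exact: C_upto_coord. Qed.

Lemma smoothD (V : normedModType R) (u v : 'rV[R]_d -> V) :
  smooth U u -> smooth U v -> smooth U (fun x => u x + v x).
Proof. by move=> su sv m; exact: C_uptoD. Qed.

Lemma smooth_sum (V : normedModType R) (I : Type) (s : seq I)
    (F : I -> 'rV[R]_d -> V) :
  (forall i, smooth U (F i)) -> smooth U (fun x => \sum_(i <- s) F i x).
Proof. by move=> sF m; apply: C_upto_sum => // i; exact: sF. Qed.

Lemma smoothM (u v : 'rV[R]_d -> R^o) :
  smooth U u -> smooth U v -> smooth U (fun x => u x * v x : R^o).
Proof. by move=> su sv m; exact: C_uptoM. Qed.

Lemma smooth_prod (I : Type) (s : seq I) (F : I -> 'rV[R]_d -> R^o) :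
  (forall i, smooth U (F i)) -> smooth U (fun x => \prod_(i <- s) F i x : R^o).
Proof.
move=> sF; elim: s => [|i s IHs].
  by under eq_fun do rewrite big_nil; exact: smooth_cst.
by under eq_fun do rewrite big_cons; exact: smoothM.
Qed.

Lemma smoothV (u : 'rV[R]_d -> R^o) : (forall x, U x -> u x != 0) ->
  smooth U u -> smooth U (fun x => (u x)^-1 : R^o).
Proof. by move=> u0 su m; exact: C_uptoV. Qed.

Lemma smoothMl (c : R) (u : 'rV[R]_d -> R^o) :
  smooth U u -> smooth U (fun x => c * u x : R^o).
Proof. by move=> su; apply: smoothM => //; exact: smooth_cst. Qed.

Lemma smoothB (u v : 'rV[R]_d -> R^o) :
  smooth U u -> smooth U v -> smooth U (fun x => u x - v x : R^o).
Proof.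
move=> su sv; apply: smoothD => //.
by under eq_fun do rewrite -mulN1r; exact: smoothMl.
Qed.

Lemma smooth_entry p q (F : 'rV[R]_d -> 'M[R]_(p, q)) i j :
  smooth U F -> smooth U (fun x => F x i j : R^o).
Proof. by move/(smooth_mx _ oU); exact. Qed.

Lemma C_upto_mulmx m p q r (A : 'rV[R]_d -> 'M[R]_(p, q))
    (B : 'rV[R]_d -> 'M[R]_(q, r)) :
  C_upto m U A -> C_upto m U B -> C_upto m U (fun x => A x *m B x).
Proof.
move=> /(C_upto_mx _ _ oU) sA /(C_upto_mx _ _ oU) sB.
apply/(C_upto_mx _ _ oU) => i j; under eq_fun do rewrite mxE.
by apply: C_upto_sum => // k; exact: C_uptoM.
Qed.

Lemma smooth_mulmx p q r (A : 'rV[R]_d -> 'M[R]_(p, q))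
    (B : 'rV[R]_d -> 'M[R]_(q, r)) :
  smooth U A -> smooth U B -> smooth U (fun x => A x *m B x).
Proof. by move=> sA sB m; exact: C_upto_mulmx. Qed.

Lemma smooth_det p (A : 'rV[R]_d -> 'M[R]_p) :
  smooth U A -> smooth U (fun x => \det (A x) : R^o).
Proof.
move=> sA; rewrite /determinant; apply: smooth_sum => s; apply: smoothMl.
by apply: smooth_prod => i; exact: smooth_entry.
Qed.

(** By the adjugate formula. *)
Lemma smooth_invmx p (A : 'rV[R]_d -> 'M[R]_p) :
  (forall x, U x -> A x \in unitmx) ->
  smooth U A -> smooth U (fun x => invmx (A x)).
Proof.
move=> uA sA; apply: (@smooth_eq _ _ _ _ (fun x => (\det (A x))^-1 *: \adj (A x))) => //.
  by move=> x Ux; rewrite /invmx uA.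
apply/(smooth_mx _ oU) => i j; under eq_fun do rewrite !mxE.
apply: smoothM; first apply: smoothV; last apply: smoothMl; try exact: smooth_det.
  by move=> x /uA; rewrite unitmxE unitfE.
apply: smooth_det; apply/(smooth_mx _ oU) => k l.
by under eq_fun do rewrite !mxE; exact: smooth_entry.
Qed.

Lemma smooth_row_mx p q r (A : 'rV[R]_d -> 'M[R]_(p, q))
    (B : 'rV[R]_d -> 'M[R]_(p, r)) :
  smooth U A -> smooth U B -> smooth U (fun x => row_mx (A x) (B x)).
Proof.
move=> sA sB; apply/(smooth_mx _ oU) => i j.
under eq_fun do rewrite mxE; case: (fintype.split j) => k; exact: smooth_entry.
Qed.

Lemma smooth_mxvec p q (A : 'rV[R]_d -> 'M[R]_(p, q)) :
  smooth U A -> smooth U (fun x => mxvec (A x)).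
Proof.
move=> sA; apply/(smooth_mx _ oU) => i j; case/mxvec_indexP: j => j k.
by rewrite ord1; under eq_fun do rewrite mxvecE; exact: smooth_entry.
Qed.

Lemma smooth_vec_mx p q (v : 'rV[R]_d -> 'rV[R]_(p * q)) :
  smooth U v -> smooth U (fun x => vec_mx (v x)).
Proof.
move=> sv; apply/(smooth_mx _ oU) => i j.
by under eq_fun do rewrite mxE; exact: smooth_entry.
Qed.

Lemma differentiable_mx p q (F : 'rV[R]_d -> 'M[R]_(p, q)) x :
  (forall i j, differentiable (fun y => F y i j : R^o) x) -> differentiable F x.
Proof.
move=> dF.
have -> : F = \sum_i \sum_j (fun y => F y i j *: delta_mx i j).
  apply/funext => y; rewrite fct_sumE [LHS]matrix_sum_delta.
  by apply: eq_bigr => i _; rewrite fct_sumE.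
apply: differentiable_sum => i; apply: differentiable_sum => j.
exact: differentiableZl.
Qed.

Lemma smooth_mx_differentiable p q (F : 'rV[R]_d -> 'M[R]_(p, q)) x :
  smooth U F -> U x -> differentiable F x.
Proof.
move=> sF Ux; apply: differentiable_mx => i j.
by apply: (smooth_differentiable oU) => //; exact: smooth_entry.
Qed.

End Smooth.

Lemma deriveE_partial (R : realType) d (V : normedModType R) (u : 'rV[R]_d -> V) x v :
  differentiable u x -> 'D_v u x = lcomb (fun k => partial k u x) v.
Proof.
move=> du; rewrite deriveE // linear_lcomb; apply: eq_bigr => k _.
by rewrite /partial deriveE.
Qed.

Lemma derive_entry (R : realType) (V : normedModType R) p q (F : V -> 'M[R]_(p, q)) x v i j :
  derivable F x v -> ('D_v F x) i j = 'D_v (fun y => F y i j : R^o) x.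
Proof. by move=> dF; rewrite derive_mx // mxE. Qed.

(** By induction on the order: the partial derivatives of u o f are sums of
    products of partial derivatives of f with (partial l u) o f, and the latter is
    again a composite with a smooth function. *)
Lemma smooth_comp (R : realType) d e (U : set 'rV[R]_d) (W : set 'rV[R]_e)
    (f : 'rV[R]_d -> 'rV[R]_e) p q (F : 'rV[R]_e -> 'M[R]_(p, q)) :
  open U -> open W -> (forall x, U x -> W (f x)) ->
  smooth U f -> smooth W F -> smooth U (F \o f).
Proof.
move=> oU oW UW sf /(smooth_mx _ oW) sF; apply/(smooth_mx _ oU) => i j m.
move: (sF i j) => {sF}; set u := (X in smooth W X -> _) => su.
rewrite -[X in C_upto m U X]/(u \o f); elim: m u su => [|m IHm] u su.
all: have c x : U x -> {for x, continuous (u \o f)}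
       by move=> Ux; apply: continuous_comp;
          [exact: smooth_cont sf Ux|exact: smooth_cont su (UW _ Ux)].
  by [].
have df x : U x -> differentiable f x by move=> Ux; exact: (smooth_mx_differentiable oU).
have du x : U x -> differentiable u (f x).
  by move=> Ux; apply: (smooth_differentiable oW) => //; exact: UW.
split=> // k; split=> [x Ux|].
  by apply: diff_derivable; apply: differentiable_comp; [exact: df|exact: du].
have C l : C_upto m U (fun x => (partial k f x) 0 l * (partial l u \o f) x : R^o).
  apply: C_uptoM => //; last exact/IHm/smooth_partial.
  exact: (smooth_entry oU _ _ (smooth_partial _ sf)).
have := C_upto_sum (index_enum 'I_e) oU C; apply: C_upto_eq => // x Ux.
rewrite /partial (deriveE _ (differentiable_comp (df _ Ux) (du _ Ux))).
rewrite diff_comp /=; [|exact: df|exact: du].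
rewrite -(deriveE _ (df _ Ux)) -(deriveE _ (du _ Ux)).
rewrite (@deriveE_partial _ _ _ u) //.
exact: du.
Qed.

(** * Derivatives of matrix-valued maps and symmetry of second derivatives *)

Lemma linear_mx_continuous (R : realType) p q (W : normedModType R)
    (L : {linear 'M[R]_(p, q) -> W}) : continuous L.
Proof.
move=> A.
have -> : (L : 'M[R]_(p, q) -> W) =
   \sum_i \sum_j (fun B : 'M[R]_(p, q) => B i j *: L (delta_mx i j)).
  apply/funext => B; rewrite [in LHS](matrix_sum_delta B) linear_sum fct_sumE.
  apply: eq_bigr => i _; rewrite linear_sum fct_sumE; apply: eq_bigr => j _.
  by rewrite linearZ.
rewrite -[X in continuous_at _ X]/(\sum_i \sum_j _); apply: differentiable_continuous.
apply: differentiable_sum => i; apply: differentiable_sum => j.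
exact/differentiableZl/differentiable_coord.
Qed.

Section DeriveMatrix.
Variables (R : realType) (V : normedModType R).

Lemma is_derive_linear (W W' : normedModType R) (L : {linear W -> W'})
    (F : V -> W) dF x v : continuous L ->
  is_derive x v F dF -> is_derive x v (fun y => L (F y)) (L dF).
Proof.
move=> cL [dFx <-].
have H : (fun h : R => h^-1 *: (((fun y => L (F y)) \o shift x) (h *: v) - L (F x)))
    @ (0 : R)^' --> L ('D_v F x).
  have -> : (fun h : R => h^-1 *: (((fun y => L (F y)) \o shift x) (h *: v) - L (F x)))
      = L \o (fun h : R => h^-1 *: ((F \o shift x) (h *: v) - F x)).
    by apply/funext => h /=; rewrite [L (_ *: _)]linearZ [L (_ - _)]linearB.
  exact: (@cvg_comp R W W' (fun h => h^-1 *: ((F \o shift x) (h *: v) - F x)) L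
    _ _ _ dFx (cL _)).
by split; [apply/cvg_ex; exists (L ('D_v F x))|exact/cvg_lim].
Qed.

Lemma is_derive_linear_mx p q r s (L : {linear 'M[R]_(p, q) -> 'M[R]_(r, s)})
    (F : V -> 'M[R]_(p, q)) dF x v :
  is_derive x v F dF -> is_derive x v (fun y => L (F y)) (L dF).
Proof. by apply: is_derive_linear; exact: linear_mx_continuous. Qed.

Lemma is_derive_mx p q (F : V -> 'M[R]_(p, q)) (dF : 'M[R]_(p, q)) x v :
  (forall i j, is_derive x v (fun y => F y i j : R^o) (dF i j)) <->
  is_derive x v F dF.
Proof.
split=> [H|[dFx <-] i j]; last first.
  by split; [move/derivable_mxP: dFx|rewrite derive_entry].
have dFx : derivable F x v by apply/derivable_mxP => i j; have [] := H i j.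
by split=> //; apply/matrixP => i j; rewrite derive_entry //; have [] := H i j.
Qed.

Lemma is_derive_mulmx p q r (A : V -> 'M[R]_(p, q)) (B : V -> 'M[R]_(q, r))
    (dA : 'M[R]_(p, q)) (dB : 'M[R]_(q, r)) x v :
  is_derive x v A dA -> is_derive x v B dB ->
  is_derive x v (fun y => A y *m B y) (dA *m B x + A x *m dB).
Proof.
move=> /is_derive_mx HA /is_derive_mx HB; apply/is_derive_mx => i j.
have -> : (fun y => (A y *m B y) i j) =
    \sum_k ((fun y => A y i k : R) * (fun y => B y k j : R)).
  by apply/funext => y; rewrite mxE fct_sumE.
have -> : (dA *m B x + A x *m dB) i j =
    \sum_k (A x i k *: dB k j + B x k j *: dA i k).
  rewrite !mxE -big_split /=; apply: eq_bigr => k _.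
  by rewrite addrC [dA i k * _]mulrC.
by apply: is_derive_sum => k; apply: is_deriveM.
Qed.

Lemma is_derive_scale p q (c : V -> R^o) (dc : R) (F : V -> 'M[R]_(p, q))
    (dF : 'M[R]_(p, q)) x v :
  is_derive x v c dc -> is_derive x v F dF ->
  is_derive x v (fun y => c y *: F y) (dc *: F x + c x *: dF).
Proof.
move=> Hc /is_derive_mx HF; apply/is_derive_mx => i j.
have -> : (fun y => (c y *: F y) i j : R^o) = c * (fun y => F y i j : R^o).
  by apply/funext => y; rewrite mxE.
have -> : (dc *: F x + c x *: dF) i j = c x *: dF i j + F x i j *: (dc : R^o).
  by rewrite !mxE addrC [dc * _]mulrC.
exact: is_deriveM.
Qed.

End DeriveMatrix.

Lemma is_derive_row_mx (R : realType) (V : normedModType R) p q r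
    (A : V -> 'M[R]_(p, q)) (B : V -> 'M[R]_(p, r)) (dA : 'M[R]_(p, q))
    (dB : 'M[R]_(p, r)) x v :
  is_derive x v A dA -> is_derive x v B dB ->
  is_derive x v (fun y => row_mx (A y) (B y)) (row_mx dA dB).
Proof.
move=> /is_derive_mx DA /is_derive_mx DB; apply/is_derive_mx => i j.
rewrite mxE; under eq_fun do rewrite mxE.
by case: (fintype.split j) => k; [exact: DA|exact: DB].
Qed.

(** Differentiate F^-1 F = 1. *)
Lemma derive_invmx (R : realType) (V : normedModType R) n (F : V -> 'M[R]_n)
    (dF : 'M[R]_n) (x v : V) :
  (\forall y \near x, F y \in unitmx) -> derivable (fun y => invmx (F y)) x v ->
  is_derive x v F dF ->
  is_derive x v (fun y => invmx (F y)) (- (invmx (F x) *m dF *m invmx (F x))).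
Proof.
move=> nu di DF; have Di := @DeriveDef _ _ _ _ _ _ _ di erefl.
suff E : 'D_v (fun y => invmx (F y)) x = - (invmx (F x) *m dF *m invmx (F x)).
  by rewrite E in Di.
have ux := nbhs_singleton nu.
have [_ E] := is_derive_mulmx Di DF.
have E0 : 'D_v (fun y => invmx (F y) *m F y) x = 0.
  rewrite (@near_eq_derive _ _ _ _ (fun=> 1%:M)) ?derive_cst //.
  by apply: filterS nu => y uy; rewrite mulVmx.
move: E; rewrite E0 => /(congr1 (mulmx^~ (invmx (F x)))).
rewrite mul0mx mulmxDl -[_ *m F x *m _]mulmxA mulmxV // mulmx1 => /esym/eqP.
by rewrite addr_eq0 => /eqP.
Qed.

Lemma derive_comp_linear (R : realType) (V V' W : normedModType R)
    (L : {linear V -> V'}) (F : V' -> W) x v :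
  'D_v (F \o L) x = 'D_(L v) F (L x).
Proof.
have E : (fun h : R => h^-1 *: (((F \o L) \o shift x) (h *: v) - (F \o L) x)) =
    (fun h : R => h^-1 *: ((F \o shift (L x)) (h *: L v) - F (L x))).
  by apply/funext => h /=; rewrite linearP.
by rewrite /derive E.
Qed.

Lemma is_derive_translate (R : realType) (V W : normedModType R) (u : V -> W)
    (c x v : V) (du : W) :
  is_derive (x + c) v u du -> is_derive x v (fun y => u (y + c)) du.
Proof.
have E : (fun t : R => t^-1 *: (((fun y => u (y + c)) \o shift x) (t *: v) - u (x + c)))
  = (fun t : R => t^-1 *: ((u \o shift (x + c)) (t *: v) - u (x + c))).
  by apply/funext => t /=; rewrite addrA.
by case; rewrite /derivable /derive => H1 H2; split; rewrite /derivable /derive E.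
Qed.

Lemma mvt_axis (R : realType) d (u : 'rV[R]_d -> R^o) (x : 'rV[R]_d) k (h : R) :
  0 <= h ->
  (forall s : R, 0 <= s <= h -> derivable u (x + s *: delta_mx 0 k) (delta_mx 0 k)) ->
  exists2 s : R, 0 <= s <= h &
    u (x + h *: delta_mx 0 k) - u x = h * partial k u (x + s *: delta_mx 0 k).
Proof.
move=> h0 du.
have sh (s : R) : 0 <= s <= 1 -> 0 <= s * h <= h.
  by move=> /andP[s0 s1]; rewrite mulr_ge0 // ler_piMl.
have ds (s : R) : 0 <= s <= 1 ->
    is_derive (x + s *: (h *: delta_mx 0 k)) (h *: delta_mx 0 k) u
      (h *: 'D_(delta_mx 0 k) u (x + (s * h) *: delta_mx 0 k)).
  by move=> s01; rewrite scalerA; apply/is_deriveZdir/du/sh.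
have [|s s01 ->] := @mvt_line R 'rV[R]_d u x (h *: delta_mx 0 k).
  by move=> s /ds[].
by exists (s * h); [exact: sh|have [_ ->] := ds s s01].
Qed.

Lemma dist_half_le (R : realType) (A B C e : R) :
  `|A - C| <= e / 2 -> `|B - C| <= e / 2 -> `|A - B| <= e.
Proof.
move=> AC BC; rewrite (le_trans (ler_distD C A B)) // (splitr e) lerD //.
by rewrite distrC.
Qed.

Section Schwarz.
Variables (R : realType) (d : nat) (U : set 'rV[R]_d) (u : 'rV[R]_d -> R^o).
Hypotheses (oU : open U) (su : smooth U u).

Let derivable_in (v : 'rV[R]_d -> R^o) k x :
  smooth U v -> U x -> derivable v x (delta_mx 0 k).
Proof. by move=> sv Ux; exact/diff_derivable/(smooth_differentiable oU). Qed.

Let second_difference (a b : 'I_d) x (h : R) : 0 < h ->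
  (forall s t : R, 0 <= s <= h -> 0 <= t <= h ->
     U (x + s *: delta_mx 0 a + t *: delta_mx 0 b)) ->
  exists s t : R, [/\ 0 <= s <= h, 0 <= t <= h &
    u (x + h *: delta_mx 0 a + h *: delta_mx 0 b) - u (x + h *: delta_mx 0 a)
      - u (x + h *: delta_mx 0 b) + u x =
    h * (h * partial b (partial a u) (x + s *: delta_mx 0 a + t *: delta_mx 0 b))].
Proof.
move=> h0 Uh; have hh : 0 <= h <= h by rewrite lexx ltW.
have zh : 0 <= (0 : R) <= h by rewrite lexx ltW.
pose g (y : 'rV[R]_d) : R^o := u (y + h *: delta_mx 0 b) - u y.
have dg (s : R) : 0 <= s <= h ->
   is_derive (x + s *: delta_mx 0 a) (delta_mx 0 a) g
     (partial a u (x + s *: delta_mx 0 a + h *: delta_mx 0 b)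
      - partial a u (x + s *: delta_mx 0 a)).
  move=> sh; have E1 : is_derive (x + s *: delta_mx 0 a) (delta_mx 0 a)
      (fun y => u (y + h *: delta_mx 0 b))
      (partial a u (x + s *: delta_mx 0 a + h *: delta_mx 0 b)).
    exact/is_derive_translate/DeriveDef/erefl/(@derivable_in u a _ su)/Uh.
  apply: is_deriveB => //; apply: DeriveDef => //; apply: derivable_in => //.
  by rewrite -[_ + _]addr0 -(scale0r (delta_mx 0 b)); exact: Uh.
have [|s sh Es] := @mvt_axis R d g x a h (ltW h0).
  by move=> s /dg[].
have [|t th Et] := @mvt_axis R d (partial a u) (x + s *: delta_mx 0 a) b h (ltW h0).
  by move=> t th; apply: derivable_in (smooth_partial a su) _; exact: Uh.
exists s, t; split=> //; rewrite -Et.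
have [_ <-] := dg s sh; rewrite -Es /g opprB !addrA; ring.
Qed.

(** Schwarz: the second difference of u over a small square equals h^2 times each
    of the mixed derivatives at some point of the square, and both mixed
    derivatives are continuous. *)
Lemma partialC (a b : 'I_d) x : U x ->
  partial a (partial b u) x = partial b (partial a u) x.
Proof.
move=> Ux; apply/eqP; rewrite -subr_eq0 -normr_le0; apply/ler_addgt0Pr => e e0.
rewrite add0r; have e2 : 0 < e / 2 by rewrite divr_gt0.
have cab := smooth_cont (smooth_partial a (smooth_partial b su)) Ux.
have cba := smooth_cont (smooth_partial b (smooth_partial a su)) Ux.
have : \forall y \near x, [/\ U y,
    `|partial a (partial b u) x - partial a (partial b u) y| <= e / 2 &
    `|partial b (partial a u) x - partial b (partial a u) y| <= e / 2].
  move/continuous_le_norm: cab => /(_ _ e2); move/continuous_le_norm: cba => /(_ _ e2).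
  by apply: filterS3 (open_near oU Ux) => y *; split.
move=> /nbhs_line_ball[r r0 Hr].
pose h := r / 3; have h0 : 0 < h by rewrite divr_gt0.
have small (k l : 'I_d) (s t : R) : 0 <= s <= h -> 0 <= t <= h ->
    `|s *: delta_mx 0 k + t *: delta_mx 0 l : 'rV[R]_d| < r.
  have n1 (k' : 'I_d) : `|delta_mx 0 k' : 'rV[R]_d| <= 1.
    apply: mx_norm_le => // i j; rewrite mxE.
    by case: (_ && _); rewrite /= ?normr1 ?normr0.
  move=> /andP[s0 sh] /andP[t0 th].
  apply: le_lt_trans (ler_normD _ _) _; rewrite !normrZ !ger0_norm //.
  apply: (@le_lt_trans _ _ (h + h)).
    by apply: lerD; [rewrite -[leRHS]mulr1|rewrite -[leRHS]mulr1]; exact: ler_pM.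
  by rewrite /h; lra.
have [|s [t [sh th E1]]] := @second_difference a b x h h0.
  by move=> s t sh th; rewrite -addrA; have [] := Hr _ (small a b s t sh th).
have [|s' [t' [sh' th' E2]]] := @second_difference b a x h h0.
  by move=> s' t' sh' th'; rewrite -addrA; have [] := Hr _ (small b a s' t' sh' th').
have {E1 E2} E : partial b (partial a u) (x + s *: delta_mx 0 a + t *: delta_mx 0 b) =
    partial a (partial b u) (x + s' *: delta_mx 0 b + t' *: delta_mx 0 a).
  apply: (mulfI (lt0r_neq0 h0)); apply: (mulfI (lt0r_neq0 h0)).
  apply: etrans (esym E1) (etrans _ E2).
  rewrite (addrAC x (h *: delta_mx 0 b)); congr (_ + _); exact: addrAC.
move: E; rewrite -!addrA => E.
have [_ _ B1] := Hr _ (small a b s t sh th).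
have [_ B2 _] := Hr _ (small b a s' t' sh' th').
by rewrite E in B1; exact: dist_half_le B2 B1.
Qed.

End Schwarz.

(** * Linear differential equations on the unit interval *)

(** The differential equations live on [0,1]. Composing with this retraction
    replaces functions on [0,1] by functions on the whole line, so that continuity
    and bounds can be stated without restrictions. *)
Definition clamp (R : realType) (r : R) : R := Num.max 0 (Num.min r 1).

Lemma clamp_itv (R : realType) (r : R) : 0 <= clamp r <= 1.
Proof. by rewrite /clamp le_max lexx ge_max ler01 ge_min lexx orbT. Qed.

Lemma clamp_id (R : realType) (r : R) : 0 <= r <= 1 -> clamp r = r.
Proof. by case/andP => r0 r1; rewrite /clamp min_l // max_r. Qed.

Lemma clamp_le (R : realType) (r s : R) : `|clamp r - clamp s| <= `|r - s|.
Proof.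
have cl (z : R) : [\/ z <= 0 /\ clamp z = 0, 0 <= z /\ z <= 1 /\ clamp z = z |
                   1 <= z /\ clamp z = 1].
  have [z0|z0] := leP z 0.
    constructor 1; split=> //; rewrite /clamp min_l ?max_l //.
    exact: le_trans z0 ler01.
  have [z1|z1] := leP z 1; first by constructor 2; rewrite clamp_id ?(ltW z0).
  by constructor 3; rewrite /clamp min_r ?max_r // ltW.
have aux (x y : R) : x <= y -> 0 <= clamp y - clamp x <= y - x.
  move=> xy; apply/andP.
  case: (cl x) => [[? ->]|[? [? ->]]|[? ->]];
    case: (cl y) => [[? ->]|[? [? ->]]|[? ->]]; split; lra.
by have [/aux|/ltW/aux] := leP s r => /andP[H1 H2]; [|rewrite distrC [leRHS]distrC];
  rewrite !ger0_norm //; lra.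
Qed.

Section BoundedDerivative.
Variable R : realType.

Lemma derive_bound (F dF : R -> R) (C : R) :
  {within `[0, 1], continuous F} ->
  (forall r : R, 0 < r < 1 -> is_derive r 1 F (dF r)) ->
  (forall r : R, 0 < r < 1 -> `|dF r| <= C) ->
  forall r s : R, 0 <= r <= 1 -> 0 <= s <= 1 -> `|F r - F s| <= C * `|r - s|.
Proof.
move=> cF DF dFC.
have aux (r s : R) : 0 <= r -> r < s -> s <= 1 -> `|F s - F r| <= C * `|s - r|.
  move=> r0 rs s1.
  have in01 c : c \in `]r, s[ -> 0 < c < 1.
    rewrite in_itv /= => /andP[rc cs].
    by rewrite (le_lt_trans r0 rc) (lt_le_trans cs s1).
  have [|c crs ->] := @MVT R F dF r s rs (fun c h => DF c (in01 c h)).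
    apply: continuous_subspaceW cF => x /=; rewrite !in_itv /= => /andP[rx xs].
    by rewrite (le_trans r0 rx) (le_trans xs s1).
  by rewrite normrM ler_wpM2r //; exact/dFC/in01.
move=> r s /andP[r0 r1] /andP[s0 s1]; case: (ltgtP r s) => [rs|sr|->].
- by rewrite distrC [`|r - s|]distrC; exact: aux.
- exact: aux.
- by rewrite !subrr normr0 mulr0.
Qed.

(** The indefinite integral from 0, frozen outside of [0,1]. *)
Definition primitive (f : R -> R) (r : R) : R :=
  parameterized_integral lebesgue_measure 0 (clamp r) f.

Lemma primitive0 (f : R -> R) : primitive f 0 = 0.
Proof.
rewrite /primitive clamp_id ?lexx ?ler01 // /parameterized_integral.
by rewrite set_itv1 Rintegral_set1.
Qed.

Section Primitive.
Variable f : R -> R.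
Hypothesis cf : continuous f.

Lemma primitive_derive (r : R) : 0 < r < 1 -> is_derive r 1 (primitive f) (f r).
Proof.
move=> /andP[r0 r1].
have If : lebesgue_measure.-integrable `[0, 1] (EFin \o f).
  apply: continuous_compact_integrable; first exact: segment_compact.
  exact: continuous_subspaceT.
have [d1 d2] := continuous_FTC1_closed r1 If r0 (@cf r).
have E : \forall y \near r,
   (\int[lebesgue_measure]_(t in [set` `[0, y]]) f t)%R = primitive f y.
  near=> y; rewrite /primitive clamp_id //.
  by apply/andP; split; apply: ltW; near: y; [exact: lt_nbhsr|exact: lt_nbhsl].
apply: near_eq_is_derive E _; split; first exact: d1.
by rewrite -derive1E.
Unshelve. all: by end_near. Qed.

Lemma primitive_bound (C : R) : (forall r, `|f r| <= C) ->
  forall r s, `|primitive f r - primitive f s| <= C * `|r - s|.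
Proof.
move=> fC.
have P r : primitive f r = primitive f (clamp r).
  by rewrite /primitive [clamp (clamp r)]clamp_id // clamp_itv.
have If : lebesgue_measure.-integrable `[0, 1] (EFin \o f).
  apply: continuous_compact_integrable; first exact: segment_compact.
  exact: continuous_subspaceT.
have cP : {within `[0, 1], continuous (primitive f)}.
  apply: (@subspace_eq_continuous _ _ _
    (fun x => parameterized_integral lebesgue_measure 0 x f)).
    by move=> x; rewrite inE /= in_itv /= => x01; rewrite /from_subspace /primitive clamp_id.
  exact: (parameterized_integral_continuous ler01 If).
move=> r s; rewrite (P r) (P s).
apply: (@le_trans _ _ (C * `|clamp r - clamp s|)).
  apply: (derive_bound cP primitive_derive); by [move=> *; exact: fC|exact: clamp_itv].
apply: ler_wpM2l; last exact: clamp_le.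
exact: le_trans (normr_ge0 _) (fC 0).
Qed.

End Primitive.

Lemma primitiveB (f g : R -> R) (r : R) : continuous f -> continuous g ->
  primitive (fun t => f t - g t) r = primitive f r - primitive g r.
Proof.
move=> cf cg.
have I (h : R -> R) : continuous h ->
    lebesgue_measure.-integrable `[0, clamp r] (EFin \o h).
  move=> ch; apply: continuous_compact_integrable; first exact: segment_compact.
  exact: continuous_subspaceT.
by rewrite /primitive /parameterized_integral RintegralB //; exact: I.
Qed.

(** A sequence whose k-th increment is at most 2^-(k+1) is squeezed between the
    monotone sequences a k - 2^-k and a k + 2^-k. Stating the limit with this
    explicit rate spares any use of uniform convergence below. *)
Lemma geometric_limit (a : nat -> R) :
  (forall k, `|a k.+1 - a k| <= 2^-1 ^+ k.+1) ->
  exists l, forall k, `|a k - l| <= 2^-1 ^+ k.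
Proof.
move=> ha; pose b k := a k - 2^-1 ^+ k; pose c k := a k + 2^-1 ^+ k.
have step k : b k <= b k.+1 /\ c k.+1 <= c k.
  have := ha k; rewrite ler_norml /b /c exprS => /andP[h1 h2].
  by split; lra.
have bS k m : (k <= m)%N -> b k <= b m.
  move=> /subnK<-; elim: (m - k)%N => // i IH.
  by rewrite addSn (le_trans IH) //; have [] := step (i + k)%N.
have cS k m : (k <= m)%N -> c m <= c k.
  move=> /subnK<-; elim: (m - k)%N => // i IH.
  by rewrite addSn (le_trans _ IH) //; have [] := step (i + k)%N.
have bc k m : b k <= c m.
  have h i : b i <= c i.
    by rewrite /b /c lerD2l ge0_cp // exprn_ge0 // invr_ge0.
  have [km|mk] := leqP k m; first exact: le_trans (bS _ _ km) (h m).
  exact: le_trans (h k) (cS _ _ (ltnW mk)).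
have hs : has_sup (range b).
  by split; [exists (b 0%N); exists 0%N|exists (c 0%N) => _ [k _ <-]].
exists (sup (range b)) => k; rewrite ler_distlC.
have h1 : b k <= sup (range b) by apply: sup_upper_bound => //; exists k.
have h2 : sup (range b) <= c k by apply: ge_sup; [exact: hs.1|move=> _ [m _ <-]].
by move: h1 h2; rewrite /b /c => h1 h2; apply/andP; split; lra.
Qed.

Lemma geometric_le0 (x C : R) : (forall k, x <= C * 2^-1 ^+ k) -> x <= 0.
Proof.
move=> hx; apply/ler_addgt0Pr => e e0; rewrite add0r.
have C0 : 0 <= Num.max C 0 by rewrite le_max lexx orbT.
have [k hk] : exists k : nat, Num.max C 0 / e < k%:R.
  by exists (Num.bound (Num.max C 0 / e)); apply: archi_boundP; rewrite divr_ge0 // ltW.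
apply: (le_trans (hx k)); rewrite exprVn ler_pdivrMr ?exprn_gt0 //.
apply: (@le_trans _ _ (Num.max C 0)); first by rewrite le_max lexx.
move: hk; rewrite ltr_pdivrMr // mulrC => /ltW/le_trans; apply.
rewrite ler_pM2l // -natrX ler_nat.
by rewrite ltnW // ltn_expl.
Qed.

End BoundedDerivative.

Lemma mulmx_norm_le (R : realType) p q r (A : 'M[R]_(p, q)) (B : 'M[R]_(q, r)) :
  `|A *m B| <= q%:R * (`|A| * `|B|).
Proof.
apply: mx_norm_le => [|i j]; first by rewrite !mulr_ge0.
rewrite mxE; apply: le_trans (ler_norm_sum _ _ _) _.
apply: (@le_trans _ _ (\sum_(k < q) `|A| * `|B|)).
  by apply: ler_sum => k _; rewrite normrM ler_pM // mx_entry_le.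
by rewrite sumr_const card_ord mulr_natl.
Qed.

Lemma lipschitz_continuous_norm (R : realType) (V W : normedModType R) (F : V -> W) (C : R) :
  (forall r s, `|F r - F s| <= C * `|r - s|) -> continuous F.
Proof.
move=> FC r; apply/continuous_le_norm => e e0.
have C1 : 0 < `|C| + 1 by rewrite ltr_wpDl.
have d0 : 0 < e / (`|C| + 1) by rewrite divr_gt0.
apply/nbhs_ballP; exists (e / (`|C| + 1)) => // s; rewrite -ball_normE /= => rs.
apply: le_trans (FC r s) _; apply: (@le_trans _ _ ((`|C| + 1) * `|r - s|)).
  by rewrite ler_wpM2r // ler_wpDr // ler_norm.
by move: rs; rewrite ltr_pdivlMr // mulrC => /ltW.
Qed.

Lemma mx_derive_bound (R : realType) p q (F dF : R -> 'M[R]_(p, q)) (C : R) :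
  continuous F ->
  (forall r : R, 0 < r < 1 -> is_derive r 1 F (dF r)) ->
  (forall r : R, 0 < r < 1 -> `|dF r| <= C) ->
  forall r : R, 0 <= r <= 1 -> `|F r - F 0| <= C.
Proof.
move=> cF DF dFC r r01; have C0 : 0 <= C.
  by apply: le_trans (normr_ge0 _) (dFC 2^-1 _); rewrite invr_gt0 invf_lt1 // ltr1n ltr0n.
apply: mx_norm_le => // i j; rewrite !mxE.
apply: le_trans (@derive_bound R (fun s => F s i j) (fun s => dF s i j) C _ _ _ r 0 _ _) _.
- apply: continuous_subspaceT => s.
  apply: (@continuous_comp _ _ _ F (fun B : 'M[R]_(p, q) => B i j)); first exact: cF.
  exact: coord_continuous.
- by move=> s /DF/is_derive_mx.
- by move=> s /dFC; apply: le_trans; exact: mx_entry_le.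
- exact: r01.
- by rewrite lexx ler01.
- by have /andP[r0 r1] := r01; rewrite subr0 ger0_norm // ler_piMr.
Qed.

Lemma clamp_continuous (R : realType) : continuous (@clamp R).
Proof.
apply: (@lipschitz_continuous_norm R R^o R^o _ 1) => s t.
by rewrite mul1r; exact: clamp_le.
Qed.

Section LinearODE.
Variables (R : realType) (N : nat) (A : R -> 'M[R]_N) (L : R).
Hypotheses (cA : continuous A) (AL : forall r, `|A r| <= L).
Hypothesis NL : N%:R * L <= 2^-1.

Definition primitive_mx (F : R -> 'M[R]_N) (r : R) : 'M[R]_N :=
  \matrix_(i, j) primitive (fun s => F s i j) r.

Definition picard_step (y : R -> 'M[R]_N) (r : R) : 'M[R]_N :=
  1%:M + primitive_mx (fun s => A s *m y s) r.

Definition picard (k : nat) : R -> 'M[R]_N := iter k picard_step (fun=> 1%:M).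

Let continuous_entry (F : R -> 'M[R]_N) i j :
  continuous F -> continuous (fun s => F s i j).
Proof.
move=> cF r; apply: (@continuous_comp _ _ _ F (fun B : 'M[R]_N => B i j)).
  exact: cF.
exact: coord_continuous.
Qed.

Let continuous_Ay (y : R -> 'M[R]_N) :
  continuous y -> continuous (fun s => A s *m y s).
Proof.
move=> cy r; exact: (@continuous_mulmx R R^o _ _ _ A y r (@cA r) (@cy r)).
Qed.

Let Ay_bound (y : R -> 'M[R]_N) C : (forall r, `|y r| <= C) ->
  forall r, `|A r *m y r| <= 2^-1 * C.
Proof.
move=> yC r; apply: le_trans (mulmx_norm_le _ _) _; rewrite mulrA.
have C0 : 0 <= C := le_trans (normr_ge0 _) (yC 0).
by apply: le_trans (ler_wpM2r C0 NL); rewrite ler_pM // ler_wpM2l.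
Qed.

Let picard_step_lip (y : R -> 'M[R]_N) C : continuous y ->
  (forall r, `|y r| <= C) ->
  forall r s, `|picard_step y r - picard_step y s| <= 2^-1 * C * `|r - s|.
Proof.
move=> cy yC r s; have Ayb := Ay_bound yC.
apply: mx_norm_le => [|i j].
  by rewrite mulr_ge0 //; exact: le_trans (normr_ge0 _) (Ayb 0).
rewrite !mxE [X in `|X|](_ : _ = primitive (fun s => (A s *m y s) i j) r -
   primitive (fun s => (A s *m y s) i j) s); last ring.
apply: primitive_bound => [|t]; first exact/continuous_entry/continuous_Ay.
exact: le_trans (mx_entry_le _ _ _) (Ayb t).
Qed.

Let picard_step0 y : picard_step y 0 = 1%:M.
Proof.
rewrite /picard_step [X in _ + X](_ : _ = 0) ?addr0 //.
by apply/matrixP => i j; rewrite !mxE primitive0.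
Qed.

Let picard_step_clamp y r : picard_step y r = picard_step y (clamp r).
Proof.
congr (_ + _); apply/matrixP => i j; rewrite !mxE /primitive.
by rewrite [clamp (clamp r)]clamp_id // clamp_itv.
Qed.

Let mx1_norm : `|1%:M : 'M[R]_N| <= 1.
Proof.
by apply: mx_norm_le => // i j; rewrite mxE; case: eqP; rewrite /= ?normr1 ?normr0.
Qed.

Let picard_continuous_bounded k :
  continuous (picard k) /\ forall r, `|picard k r| <= 2.
Proof.
elim: k => [|k [cy yb]] /=.
  split=> [|r]; first exact: cst_continuous.
  by apply: le_trans mx1_norm _; rewrite ler1n.
have lip := picard_step_lip cy yb.
split; first exact: lipschitz_continuous_norm lip.
move=> r; rewrite picard_step_clamp.
rewrite -(subrK (picard_step (picard k) 0) (picard_step _ _)).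
apply: le_trans (ler_normD _ _) _; rewrite {2}picard_step0.
rewrite (_ : 2 = 1 + 1 :> R); last by rewrite -natr1.
apply: lerD mx1_norm; apply: le_trans (lip _ _) _.
rewrite subr0 mulVf // mul1r; have /andP[c0 c1] := clamp_itv r.
by rewrite ger0_norm.
Qed.

Let picard_step_sub (y z : R -> 'M[R]_N) C : continuous y -> continuous z ->
  (forall r, `|y r - z r| <= C) ->
  forall r, `|picard_step y r - picard_step z r| <= 2^-1 * C.
Proof.
move=> cy cz yzC r; have b := Ay_bound yzC.
have C0 : 0 <= 2^-1 * C := le_trans (normr_ge0 _) (b 0).
apply: mx_norm_le => // i j; rewrite !mxE.
rewrite opprD addrACA subrr add0r -primitiveB;
  [|exact/continuous_entry/continuous_Ay..].
set f := fun t => _; have fE : f = (fun t => (A t *m (y t - z t)) i j).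
  apply/funext => t; rewrite mulmxBr /f.
  by move: (A t *m y t) (A t *m z t) => B D; rewrite !mxE.
have cf : continuous f.
  rewrite fE; apply/continuous_entry/continuous_Ay => s.
  apply: (@continuousD _ _ _ y (fun s => - z s) s (@cy s)).
  exact: (@continuousN _ _ _ z s (@cz s)).
rewrite (_ : primitive f r = primitive f (clamp r) - primitive f 0); last first.
  by rewrite primitive0 subr0 /primitive [clamp (clamp r)]clamp_id // clamp_itv.
apply: le_trans (primitive_bound cf (C := 2^-1 * C) _ _ _) _.
  by move=> t; rewrite fE; exact: le_trans (mx_entry_le _ _ _) (b t).
rewrite subr0; have /andP[c0 c1] := clamp_itv r.
by rewrite ger0_norm // ler_piMr.
Qed.

(** Picard iteration for y' = A y, y(0) = 1. The hypothesis N L <= 1/2 makes the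
    integral operator a contraction of factor 1/2 for the supremum norm; the
    equation is linear, so smallness of A, here obtained by shortening the rays,
    replaces the usual restriction of the time interval. *)
Lemma linear_ode : exists y : R -> 'M[R]_N,
  [/\ continuous y, y 0 = 1%:M, forall r, `|y r| <= 2 &
   forall r : R, 0 < r < 1 -> is_derive r 1 y (A r *m y r)].
Proof.
have cauchy k r : `|picard k.+1 r - picard k r| <= 2^-1 ^+ k.+1.
  elim: k r => [|k IHk] r; last first.
    rewrite exprS; apply: picard_step_sub IHk r.
      exact: (picard_continuous_bounded k.+1).1.
    exact: (picard_continuous_bounded k).1.
  rewrite /= picard_step_clamp -[X in _ - X](picard_step0 (fun=> 1%:M)) expr1.
  have b1 (r' : R) : `|(fun=> 1%:M : 'M[R]_N) r'| <= 1 by exact: mx1_norm.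
  have [c1 _] := picard_continuous_bounded 0.
  apply: le_trans (picard_step_lip c1 b1 _ _) _.
  rewrite subr0 mulr1; have /andP[h0 h1] := clamp_itv r.
  by rewrite ger0_norm // ler_piMr // invr_ge0.
have lim r i j : exists l, forall k, `|picard k r i j - l| <= 2^-1 ^+ k.
  apply: geometric_limit => k; apply: le_trans (cauchy k r).
  by have := mx_entry_le (picard k.+1 r - picard k r) i j; rewrite !mxE.
pose y r := \matrix_(i, j) sval (cid (lim r i j)) : 'M[R]_N.
have half0 : 0 <= 2^-1 :> R by rewrite invr_ge0.
have yP k r : `|picard k r - y r| <= 2^-1 ^+ k.
  apply: mx_norm_le => [|i j]; first exact: exprn_ge0.
  by rewrite !mxE; case: (cid (lim r i j)) => l /= ->.
have y_bound r : `|y r| <= 2.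
  rewrite -subr_le0; apply: (@geometric_le0 R _ 1) => k; rewrite mul1r.
  have := (picard_continuous_bounded k).2 r; have := yP k r.
  have := ler_distD (picard k r) (y r) 0; rewrite !subr0 distrC; lra.
have y_lip r s : `|y r - y s| <= 1 * `|r - s|.
  rewrite -subr_le0; apply: (@geometric_le0 R _ 2) => k.
  have [cp bp] := picard_continuous_bounded k.
  have h : `|picard k r - picard k s| <= 1 * `|r - s|.
    case: k cp bp => [|k] cp bp; first by rewrite /= subrr normr0 mul1r.
    have [cp' bp'] := picard_continuous_bounded k.
    by apply: le_trans (picard_step_lip cp' bp' r s) _; rewrite mulVf.
  have h2 : 2^-1 ^+ k.+1 = 2^-1 * 2^-1 ^+ k :> R by rewrite exprS.
  have := yP k r; have := yP k s.
  have := ler_distD (picard k r) (y r) (y s).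
  have := ler_distD (picard k s) (picard k r) (y s).
  rewrite [`|y r - picard k r|]distrC; move: h; lra.
have cy : continuous y := lipschitz_continuous_norm y_lip.
have yE r : y r = picard_step y r.
  apply/eqP; rewrite -subr_eq0 -normr_le0; apply: (@geometric_le0 R _ 1) => k.
  have h := picard_step_sub (picard_continuous_bounded k).1 cy (yP k) r.
  have := yP k.+1 r; have := ler_distD (picard k.+1 r) (y r) (picard_step y r).
  rewrite exprS [`|y r - picard k.+1 r|]distrC; move: h; rewrite -[picard_step _ r]/(picard k.+1 r).
  lra.
exists y; split=> //; first by rewrite yE picard_step0.
move=> r r01; apply/is_derive_mx => i j.
have -> : (fun s => y s i j : R^o) =
    cst ((1%:M : 'M[R]_N) i j) + primitive (fun s => (A s *m y s) i j).
  by apply/funext => s; rewrite yE !mxE.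
rewrite -[(A r *m y r) i j]add0r; apply: is_deriveD.
by apply: primitive_derive => //; exact/continuous_entry/continuous_Ay.
Qed.

End LinearODE.

(** * Parallel frames of a flat connection *)

Section LocalBounds.
Variables (R : realType) (d : nat) (U : set 'rV[R]_d) (x0 : 'rV[R]_d).
Hypotheses (oU : open U) (Ux0 : U x0).

(** Finitely many local estimates hold with a common radius and constant. *)
Lemma uniform_radius (I : finType) (P : I -> R -> R -> Prop) :
  (forall i r C r' C', 0 < r' -> r' <= r -> C <= C' -> P i r C -> P i r' C') ->
  (forall i, exists r C, 0 < r /\ P i r C) ->
  exists r C, [/\ 0 < r, 0 <= C & forall i, P i r C].
Proof.
move=> mono /choice[r /choice[C rC]].
exists (\big[Num.min/1]_i r i), (\big[Num.max/0]_i C i).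
have r0 : 0 < \big[Num.min/1]_i r i.
  by apply: lt_bigmin => // i _; have [] := rC i.
split=> //; first exact: bigmax_ge_id.
move=> i; have [_] := rC i; apply: mono => //; first exact: bigmin_le_cond.
exact: le_bigmax.
Qed.

Definition bounded_C1 (u : 'rV[R]_d -> R^o) (r C : R) :=
  forall x y, `|x - x0| < r -> `|y - x0| < r ->
  [/\ U x, `|u x| <= C & `|u y - u x| <= C * `|y - x|].

Lemma lcomb_norm_le (W : normedModType R) (c : 'I_d -> W) (C : R) h :
  (forall k, `|c k| <= C) -> `|lcomb c h| <= d%:R * C * `|h|.
Proof.
move=> cC; apply: le_trans (ler_norm_sum _ _ _) _.
apply: (@le_trans _ _ (\sum_(k < d) C * `|h|)); last first.
  by rewrite sumr_const card_ord -mulrA mulr_natl.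
apply: ler_sum => k _; rewrite normrZ mulrC.
by apply: ler_pM => //; exact: mx_entry_le.
Qed.

Lemma segment_ball (x y : 'rV[R]_d) (r s : R) : 0 <= s <= 1 ->
  `|x - x0| < r -> `|y - x0| < r -> `|x + s *: (y - x) - x0| < r.
Proof.
move=> /andP[s0 s1] xr yr.
have -> : x + s *: (y - x) - x0 = (1 - s) *: (x - x0) + s *: (y - x0).
  rewrite !scalerBr !scalerBl !scale1r; set a := s *: x; set b := s *: y.
  by apply/matrixP => i j; rewrite !mxE; ring.
apply: le_lt_trans (ler_normD _ _) _; rewrite !normrZ !ger0_norm ?subr_ge0 //.
have m : Num.max `|x - x0| `|y - x0| < r by rewrite gt_max xr yr.
apply: le_lt_trans m; set m := Num.max _ _.
have xm : `|x - x0| <= m by rewrite /m le_max lexx.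
have ym : `|y - x0| <= m by rewrite /m le_max lexx orbT.
apply: (@le_trans _ _ ((1 - s) * m + s * m)); last by rewrite -mulrDl subrK mul1r.
by apply: lerD; apply: ler_wpM2l; rewrite ?subr_ge0.
Qed.

Lemma smooth_bounded_C1 (u : 'rV[R]_d -> R^o) :
  smooth U u -> exists r C, 0 < r /\ bounded_C1 u r C.
Proof.
move=> su.
have near1 (v : 'rV[R]_d -> R^o) : smooth U v -> \forall x \near x0, `|v x| <= `|v x0| + 1.
  move=> sv; have /continuous_le_norm/(_ 1 ltr01) := smooth_cont sv Ux0.
  apply: filterS => x; have := ler_distD 0 (v x) (v x0).
  have := ler_normB (v x0) (v x0 - v x); rewrite subKr; lra.
have : \forall x \near x0, forall k, `|partial k u x| <= `|partial k u x0| + 1.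
  by apply: (filter_forall (nbhs_filter x0)) => k; exact/near1/smooth_partial.
move=> /(filterS3 _ _ (open_near oU Ux0) (near1 _ su)).
pose C : R := \big[Num.max/(`|u x0 : R| + 1)]_k (`|partial k u x0 : R| + 1).
move=> /(_ (fun x => [/\ U x, `|u x| <= C & forall k, `|partial k u x| <= C])).
have CP (x : 'rV[R]_d) : U x -> `|u x| <= `|u x0| + 1 ->
    (forall k, `|partial k u x| <= `|partial k u x0| + 1) ->
    [/\ U x, `|u x| <= C & forall k, `|partial k u x| <= C].
  move=> Ux ux pu; split=> //; first by apply: (le_trans ux); rewrite /C; exact: bigmax_ge_id.
  by move=> k; apply: le_trans (pu k) _; exact: le_bigmax.
move=> /(_ CP)/nbhs_line_ball[r r0 Hr].
have Hr' x : `|x - x0| < r -> [/\ U x, `|u x| <= C & forall k, `|partial k u x| <= C].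
  by move=> /Hr; rewrite addrC subrK.
have C0 : 0 <= C.
  have [|_ + _] := Hr' x0; first by rewrite subrr normr0.
  by apply: le_trans; exact: normr_ge0.
exists r, (Num.max C (d%:R * C)); split=> // x y xr yr; have [Ux ux _] := Hr' x xr.
split=> //; first by rewrite le_max ux.
have [s s01|s s01] := @mvt_line R 'rV[R]_d u x (y - x).
  have [Us _ _] := Hr' _ (segment_ball s01 xr yr).
  exact/diff_derivable/(smooth_differentiable oU).
rewrite subrKC => ->; have [Us _ Ds] := Hr' _ (segment_ball s01 xr yr).
rewrite deriveE_partial; last exact: (smooth_differentiable oU).
apply: le_trans (lcomb_norm_le _ Ds) _.
by rewrite ler_wpM2r // le_max lexx orbT.
Qed.

Definition bounded_C2 (u : 'rV[R]_d -> R^o) (r C : R) :=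
  bounded_C1 u r C /\ forall x y, `|x - x0| < r -> `|y - x0| < r ->
  `|u y - u x - 'D_(y - x) u x| <= C * `|y - x| ^+ 2.

(** Taylor's formula of order one with a remainder that is uniform near x0. *)
Lemma smooth_bounded_C2 (u : 'rV[R]_d -> R^o) :
  smooth U u -> exists r C, 0 < r /\ bounded_C2 u r C.
Proof.
move=> su; have [r [C [r0 b1]]] := smooth_bounded_C1 su.
have [||r' [C' [r'0 C'0 b2]]] :=
    @uniform_radius 'I_d (fun k r C => bounded_C1 (partial k u) r C).
- move=> k r1 C1 r2 C2 r20 r21 C12 b x y xr yr.
  have [|//|Ux ux uyx] := b x y; [exact: lt_le_trans r21|exact: lt_le_trans r21|].
  by split; [|exact: le_trans C12|apply: le_trans uyx _; rewrite ler_wpM2r].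
- by move=> k; exact/smooth_bounded_C1/smooth_partial.
exists (Num.min r r'), (Num.max C (d%:R * C')).
split; first by rewrite lt_min r0 r'0.
split=> x y; rewrite !lt_min => /andP[xr xr'] /andP[yr yr'].
  have [Ux ux uyx] := b1 x y xr yr; split=> //; first by rewrite le_max ux.
  by apply: le_trans uyx _; rewrite ler_wpM2r // le_max lexx.
have [s s01|s s01] := @mvt_line R 'rV[R]_d u x (y - x).
  have [Us _ _] := b1 _ x (segment_ball s01 xr yr) xr.
  exact/diff_derivable/(smooth_differentiable oU).
rewrite subrKC => ->.
have [Us _ _] := b1 _ x (segment_ball s01 xr yr) xr.
have [Ux _ _] := b1 x x xr xr.
rewrite !deriveE_partial; [|exact: (smooth_differentiable oU)..].
rewrite /lcomb -sumrB; under eq_bigr do rewrite -scalerBr.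
apply: le_trans (lcomb_norm_le (C := C' * `|y - x|) _ _) _.
  move=> k; have [_ _] := b2 k x _ xr' (segment_ball s01 xr' yr').
  move/le_trans; apply; rewrite ler_wpM2l // addrC addKr normrZ.
  by have /andP[s0 s1] := s01; rewrite ger0_norm // ler_piMl.
rewrite mulrA -mulrA -expr2 ler_wpM2r ?exprn_ge0 //.
by rewrite le_max lexx orbT.
Qed.

End LocalBounds.

Section ParallelFrame.
Variables (R : realType) (d N : nat) (U : set 'rV[R]_d) (x0 : 'rV[R]_d).
Hypotheses (oU : open U) (Ux0 : U x0).
Variable Gam : 'I_d -> 'rV[R]_d -> 'M[R]_N.
Hypothesis sGam : forall a, smooth U (Gam a).
Hypothesis Gam_flat : forall x, U x -> forall a b,
  partial a (Gam b) x - partial b (Gam a) x =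
  Gam a x *m Gam b x - Gam b x *m Gam a x.

Definition along (h x : 'rV[R]_d) : 'M[R]_N := lcomb (fun a => Gam a x) h.

Lemma alongD h k x : along (h + k) x = along h x + along k x.
Proof. exact: linearD. Qed.

Lemma differentiable_along h x : U x -> differentiable (along h) x.
Proof.
move=> Ux; have -> : along h = \sum_a (h 0 a \*: Gam a).
  by apply/funext => y; rewrite fct_sumE.
by apply: differentiable_sum => a; apply: differentiableZ; exact: (smooth_mx_differentiable oU).
Qed.

Lemma derive_along h k x : U x -> 'D_k (along h) x =
  \sum_a \sum_b (h 0 a * k 0 b) *: partial b (Gam a) x.
Proof.
move=> Ux; have dG a : differentiable (Gam a) x by exact: (smooth_mx_differentiable oU).
have -> : along h = \sum_a (h 0 a \*: Gam a).
  by apply/funext => y; rewrite fct_sumE.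
rewrite derive_sum; last by move=> a; apply/derivableZ/diff_derivable.
apply: eq_bigr => a _; rewrite deriveZ; last exact: diff_derivable.
rewrite deriveE_partial // /lcomb scaler_sumr.
by apply: eq_bigr => b _; rewrite scalerA.
Qed.

(** Flatness for arbitrary constant directions, by bilinearity. It is used to
    exchange the directions of differentiation. *)
Lemma along_flat h k x : U x ->
  'D_h (along k) x = 'D_k (along h) x + along h x *m along k x - along k x *m along h x.
Proof.
move=> Ux; suff E : 'D_h (along k) x - 'D_k (along h) x =
    along h x *m along k x - along k x *m along h x.
  by rewrite -addrA -E addrC subrK.
rewrite !derive_along // [in X in X - _]exchange_big -sumrB /along /lcomb.
rewrite mulmx_suml mulmx_suml.
rewrite [X in _ - X](_ : _ = \sum_a \sum_b (h 0 a * k 0 b) *: (Gam b x *m Gam a x)); last first.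
  rewrite exchange_big /=; apply: eq_bigr => b _; rewrite mulmx_sumr.
  apply: eq_bigr => a _.
  by rewrite -scalemxAl -scalemxAr scalerA mulrC.
rewrite -sumrB; apply: eq_bigr => a _; rewrite mulmx_sumr -!sumrB.
apply: eq_bigr => b _.
by rewrite -scalemxAl -scalemxAr scalerA [k 0 b * _]mulrC -!scalerBr Gam_flat.
Qed.

Let along_bounds : exists r K, [/\ 0 < r, 0 <= K &
  forall x y, `|x - x0| < r -> `|y - x0| < r -> U x /\ forall h,
  [/\ `|along h x| <= K * `|h|,
      `|along h y - along h x| <= K * (`|h| * `|y - x|) &
      `|along h y - along h x - 'D_(y - x) (along h) x| <= K * (`|h| * `|y - x| ^+ 2)]].
Proof.
have [r1 r10 Ur1] := nbhs_line_ball (open_near oU Ux0).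
have [||r2 [C [r20 C0 b]]] := @uniform_radius R ('I_d * 'I_N * 'I_N)%type
    (fun i r C => bounded_C2 U x0 (fun x => Gam i.1.1 x i.1.2 i.2) r C).
- move=> i r C r' C' r'0 r'r CC' [b1 b2]; split=> x y xr yr.
    have [|//|Ux ux uyx] := b1 x y; [exact: lt_le_trans r'r|exact: lt_le_trans r'r|].
    by split; [|exact: le_trans CC'|apply: le_trans uyx _; rewrite ler_wpM2r].
  have h := b2 x y (lt_le_trans xr r'r) (lt_le_trans yr r'r).
  by apply: le_trans h _; rewrite ler_wpM2r ?exprn_ge0.
- move=> [[a i] j]; apply: smooth_bounded_C2 => //.
  exact: (smooth_entry oU).
exists (Num.min r1 r2), (d%:R * C); rewrite mulr_ge0 // lt_min r10 r20.
split=> // x y; rewrite !lt_min => /andP[xr1 xr2] /andP[yr1 yr2].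
have Ux : U x by rewrite -(subrK x0 x) addrC; exact: Ur1.
split=> // h; split.
- apply: lcomb_norm_le => a; apply: mx_norm_le => // i j.
  by have [/(_ x y xr2 yr2)[]] := b (a, i, j).
- rewrite /along /lcomb -sumrB; under eq_bigr do rewrite -scalerBr.
  apply: le_trans (lcomb_norm_le (C := C * `|y - x|) _ _) _.
    move=> a; apply: mx_norm_le => [|i j]; first by rewrite mulr_ge0.
    by have [/(_ x y xr2 yr2)[_ _]] := b (a, i, j); rewrite !mxE.
  by rewrite !mulrA [_ * `|y - x| * _]mulrAC.
- rewrite derive_along // /along /lcomb.
  have -> : \sum_a \sum_b (h 0 a * (y - x) 0 b) *: partial b (Gam a) x =
      \sum_a h 0 a *: 'D_(y - x) (Gam a) x.
    apply: eq_bigr => a _; rewrite deriveE_partial; last exact: (smooth_mx_differentiable oU).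
    by rewrite /lcomb scaler_sumr; apply: eq_bigr => b' _; rewrite scalerA.
  rewrite -!sumrB; under eq_bigr do rewrite -!scalerBr.
  apply: le_trans (lcomb_norm_le (C := C * `|y - x| ^+ 2) _ _) _.
    move=> a; apply: mx_norm_le => [|i j]; first by rewrite mulr_ge0 ?exprn_ge0.
    have [_ /(_ x y xr2 yr2)] := b (a, i, j); rewrite !mxE derive_entry //.
    exact/diff_derivable/(smooth_mx_differentiable oU).
  by rewrite le_eqVlt; apply/orP; left; apply/eqP; ring.
Qed.

(** Let Y_h solve Y' = Gamma_h Y along the ray from x0 to x0 + h, with Y_h(0) = 1,
    and put P(x0 + h) = Y_h(1). The expected variation of Y_h in the direction k is
    t Gamma_k Y_h; flatness says exactly that the error
    W = Y_{h+k} - Y_h - t Gamma_k Y_h satisfies W' = Gamma_{h+k} W + O(k^2), so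
    that W = O(k^2) and dP(k) = Gamma_k P. Differentiating the solutions with
    respect to parameters is thus not needed. *)
Theorem parallel_frame : exists (r : R) (P : 'rV[R]_d -> 'M[R]_N),
  [/\ 0 < r, P x0 = 1%:M &
   forall x, `|x - x0| < r -> [/\ U x, differentiable P x &
     forall a, partial a P x = Gam a x *m P x]].
Proof.
have [r0 [K [r00 K0 bK]]] := along_bounds.
have NK0 : 0 <= N%:R * K :> R by rewrite mulr_ge0.
(* the radius that makes the solution operator of each radial equation a
   contraction of factor 1/2 *)
pose r := Num.min r0 (2^-1 / (N%:R * K + 1)).
have r_gt0 : 0 < r by rewrite lt_min r00 divr_gt0 // ltr_wpDl.
have rr0 (h : 'rV[R]_d) : `|h| < r -> `|h| < r0 by rewrite lt_min => /andP[].
have NKr (h : 'rV[R]_d) : `|h| < r -> N%:R * (K * `|h|) <= 2^-1.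
  rewrite lt_min => /andP[_]; rewrite ltr_pdivlMr ?ltr_wpDl // mulrDr mulr1 => hr.
  rewrite mulrA mulrC; apply: le_trans (ltW hr); by rewrite lerDl.
(* clamping keeps the ray inside the ball for every real t *)
pose ray (h : 'rV[R]_d) (t : R) := x0 + clamp t *: h.
have ray_in h t : `|h| < r -> `|ray h t - x0| < r0.
  move=> /rr0 hr; rewrite /ray addrC addKr normrZ.
  have /andP[c0 c1] := clamp_itv t; rewrite ger0_norm //.
  by apply: le_lt_trans hr; rewrite ler_piMl.
have along_ray_cont h k : `|h| < r -> continuous (fun t => along k (ray h t)).
  move=> hr; apply: (@lipschitz_continuous_norm R R^o _ _ (K * (`|k| * `|h|))) => s t.
  have [_ /(_ k)[_ b _]] := bK _ _ (ray_in h t hr) (ray_in h s hr).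
  apply: (le_trans b); rewrite -!mulrA ler_wpM2l // ler_wpM2l //.
  rewrite /ray opprD addrACA subrr add0r -scalerBl normrZ mulrC ler_wpM2l //.
  exact: clamp_le.
have /choice[Y YP] : forall h, exists y : R -> 'M[R]_N, `|h| < r ->
  [/\ continuous y, y 0 = 1%:M, forall t, `|y t| <= 2 &
   forall t : R, 0 < t < 1 -> is_derive t 1 y (along h (ray h t) *m y t)].
  move=> h; have [hr|] := boolP (`|h| < r); last by exists (fun=> 0).
  have [||y yP] := @linear_ode R N (fun t => along h (ray h t)) (K * `|h|) _ _ (NKr _ hr).
  - exact: along_ray_cont.
  - by move=> t; have [_ /(_ h)[]] := bK _ _ (ray_in h t hr) (ray_in h t hr).
  - by exists y.
pose W h k t := Y (h + k) t - Y h t - clamp t *: (along k (ray h t) *m Y h t).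
have cW h k : `|h| < r -> `|h + k| < r -> continuous (W h k).
  move=> hr hkr t; have [cY _ _ _] := YP h hr; have [cY' _ _ _] := YP _ hkr.
  have cc : {for t, continuous (fun s => clamp s *: (along k (ray h s) *m Y h s))}.
    apply: (@continuousZ R 'M[R]_N R^o (@clamp R)
      (fun s => along k (ray h s) *m Y h s) t).
      exact: clamp_continuous.
    apply: (@continuous_mulmx R R^o); last exact: cY.
    exact: along_ray_cont.
  apply: (@continuousB R 'M[R]_N R^o (fun s => Y (h + k) s - Y h s) _ t _ cc).
  apply: (@continuousB R 'M[R]_N R^o (Y (h + k)) (Y h) t); first exact: cY'.
  exact: cY.
(* the derivative of W: flatness has removed the terms of first order in k *)
pose D h k (t : R) : 'M[R]_N := let z := ray h t in
  along (h + k) (z + t *: k) *m W h k t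
  + (along h (z + t *: k) - along h z - 'D_(t *: k) (along h) z
     + (along k (z + t *: k) - along k z)) *m Y h t
  + t *: ((along h (z + t *: k) - along h z + along k (z + t *: k))
     *m (along k z *m Y h t)).
have DW h k : `|h| < r -> `|h + k| < r ->
    forall t : R, 0 < t < 1 -> is_derive t 1 (W h k) (D h k t).
  move=> hr hkr t t01; have [_ _ _ dY] := YP h hr; have [_ _ _ dY'] := YP _ hkr.
  have /andP[t0 t1] := t01.
  have ct : clamp t = t by rewrite clamp_id // !ltW.
  have Uz : U (ray h t) by have [] := bK _ _ (ray_in h t hr) (ray_in h t hr).
  have E : \forall s \near t, Y (h + k) s - Y h s
      - s *: (along k (x0 + s *: h) *m Y h s) = W h k s.
    near=> s; rewrite /W /ray clamp_id //.
    by apply/andP; split; apply: ltW; near: s; [exact: lt_nbhsr|exact: lt_nbhsl].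
  apply: near_eq_is_derive E _.
  have dray : is_derive t 1 (fun s : R => along k (x0 + s *: h))
      ('D_h (along k) (ray h t)).
    rewrite /ray ct; apply: is_derive_line; rewrite -{1}ct.
    exact/diff_derivable/differentiable_along.
  have := is_deriveB (is_deriveB (dY' t t01) (dY t t01))
    (is_derive_scale (@is_derive_id R R^o t 1) (is_derive_mulmx dray (dY t t01))).
  move=> H; suff -> : D h k t = along (h + k) (ray (h + k) t) *m Y (h + k) t -
     along h (ray h t) *m Y h t -
     (1 *: (along k (x0 + t *: h) *m Y h t) +
      t *: ('D_h (along k) (ray h t) *m Y h t +
       along k (x0 + t *: h) *m (along h (ray h t) *m Y h t))) by exact: H.
  clear H; have -> : ray (h + k) t = ray h t + t *: k by rewrite /ray ct scalerDr addrA.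
  rewrite /D /W ct (@along_flat h k _ Uz).
  have -> : 'D_(t *: k) (along h) (ray h t) = t *: 'D_k (along h) (ray h t).
    by have [] := is_deriveZdir t (diff_derivable (v := k) (@differentiable_along h _ Uz)).
  have -> : x0 + t *: h = ray h t by rewrite /ray ct.
  rewrite alongD.
  move: (along h (ray h t + t *: k)) (along k (ray h t + t *: k)) (along h (ray h t))
    (along k (ray h t)) ('D_k _ _) (Y (h + k) t) (Y h t) => a1 a2 a3 a4 a5 y1 y2.
  rewrite !(mulmxDl, mulmxDr, mulmxBl, mulmxBr, scalerDr, scalerBr, scalerN, mulNmx, mulmxN).
  rewrite -!(scalemxAl, scalemxAr) !mulmxA scale1r.
  by apply/matrixP => i j; rewrite !mxE; ring.
(* the constant of the remainder of second order *)
pose E (h : 'rV[R]_d) : R :=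
  2 * (N%:R * (K * (`|h| + 1))) + 2 * (N%:R * (K * (`|h| + 1))) * (N%:R * K).
have DE h k : `|h| < r -> `|h + k| < r -> forall M : R,
    (forall t : R, 0 <= t <= 1 -> `|W h k t| <= M) ->
    forall t : R, 0 < t < 1 -> `|D h k t| <= 2^-1 * M + E h * `|k| ^+ 2.
  move=> hr hkr M WM t t01; have /andP[t0 t1] := t01.
  have ct : clamp t = t by rewrite clamp_id // !ltW.
  have zk : ray h t + t *: k = ray (h + k) t by rewrite /ray ct scalerDr addrA.
  have zr := ray_in h t hr; have zkr := ray_in (h + k) t hkr; rewrite -zk in zkr.
  have [_ B1] := bK _ _ zr zkr; have [_ B2] := bK _ _ zkr zr.
  have [_ _ Y2 _] := YP h hr.
  have k0 := normr_ge0 k; have h0 := normr_ge0 h.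
  have tk : `|t *: k| <= `|k| by rewrite normrZ ger0_norm ?ler_piMl // ltW.
  rewrite /D; set z := ray h t in zk zr zkr B1 B2 *.
  have zE : z + t *: k - z = t *: k by rewrite addrC addKr.
  have [_ b1 b2] := B1 h; have [b3 b4 _] := B1 k; have [b5 _ _] := B2 k.
  rewrite zE in b1 b2 b4.
  have [b6 _ _] := B2 (h + k).
  set e := `|k| in k0 tk b1 b2 b3 b4 b5 b6 *; set n := `|h| in h0 b1 b2 *.
  have e1 : `|along h (z + t *: k) - along h z - 'D_(t *: k) (along h) z
     + (along k (z + t *: k) - along k z)| <= K * (n + 1) * e ^+ 2.
    apply: le_trans (ler_normD _ _) _.
    apply: (@le_trans _ _ (K * (n * e ^+ 2) + K * (e * e))); last first.
      by rewrite le_eqVlt; apply/orP; left; apply/eqP; ring.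
    apply: lerD; [apply: le_trans b2 _|apply: le_trans b4 _].
      by rewrite ler_wpM2l // ler_wpM2l // ler_pXn2r ?nnegrE.
    by rewrite ler_wpM2l // ler_wpM2l.
  have e2 : `|along h (z + t *: k) - along h z + along k (z + t *: k)| <= K * (n + 1) * e.
    apply: le_trans (ler_normD _ _) _.
    apply: (@le_trans _ _ (K * (n * e) + K * e)); last first.
      by rewrite le_eqVlt; apply/orP; left; apply/eqP; ring.
    by apply: lerD b5; apply: le_trans b1 _; rewrite ler_wpM2l // ler_wpM2l.
  have N0 : 0 <= N%:R :> R by exact: ler0n.
  have M0 : 0 <= M.
    by apply: le_trans (normr_ge0 _) (WM 0 _); rewrite lexx ler01.
  rewrite -addrA; apply: le_trans (ler_normD _ _) _; apply: lerD.
    apply: le_trans (mulmx_norm_le _ _) _; rewrite mulrA; apply: ler_pM => //.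
      apply: le_trans (NKr _ hkr); rewrite ler_wpM2l //.
    by apply: WM; rewrite !ltW.
  apply: le_trans (ler_normD _ _) _; rewrite /E mulrDl; apply: lerD.
    apply: le_trans (mulmx_norm_le _ _) _.
    apply: (@le_trans _ _ (N%:R * ((K * (n + 1) * e ^+ 2) * 2))).
      by rewrite ler_wpM2l // ler_pM.
    by rewrite le_eqVlt; apply/orP; left; apply/eqP; rewrite /n; ring.
  rewrite normrZ (ger0_norm (ltW t0)); apply: le_trans (ler_piMl (normr_ge0 _) (ltW t1)) _.
  apply: le_trans (mulmx_norm_le _ _) _.
  have e3 : `|along k z *m Y h t| <= N%:R * (K * e * 2).
    by apply: le_trans (mulmx_norm_le _ _) _; rewrite ler_wpM2l // ler_pM.
  apply: (@le_trans _ _ (N%:R * ((K * (n + 1) * e) * (N%:R * (K * e * 2))))).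
    by rewrite ler_wpM2l // ler_pM.
  by rewrite le_eqVlt; apply/orP; left; apply/eqP; rewrite /n; ring.
have W0 h k : `|h| < r -> `|h + k| < r -> W h k 0 = 0.
  move=> hr hkr; have [_ y0 _ _] := YP h hr; have [_ y0' _ _] := YP _ hkr.
  by rewrite /W y0 y0' clamp_id ?lexx ?ler01 // scale0r subr0 subrr.
(* from |W| <= M follows |W| <= M / 2 + E |k|^2; iterating this yields the fixed
   point 2 E |k|^2, whatever the initial bound M0 *)
have WE h k : `|h| < r -> `|h + k| < r -> `|W h k 1| <= 2 * E h * `|k| ^+ 2.
  move=> hr hkr; pose M0 : R := 4 + N%:R * (K * `|k| * 2).
  have [_ _ Y2 _] := YP h hr; have [_ _ Y2' _] := YP _ hkr.
  have it j (t : R) : 0 <= t <= 1 ->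
      `|W h k t| <= 2 * E h * `|k| ^+ 2 + M0 * 2^-1 ^+ j.
    elim: j t => [|j IHj] t t01.
      have E0 : 0 <= 2 * E h * `|k| ^+ 2.
        by rewrite !(mulr_ge0, addr_ge0, exprn_ge0, ler0n).
      apply: (@le_trans _ _ M0); last by rewrite expr0 mulr1 lerDr.
      have [_ /(_ k)[bk _ _]] := bK _ _ (ray_in h t hr) (ray_in h t hr).
      rewrite /W; apply: le_trans (ler_normB _ _) _; apply: lerD.
        apply: le_trans (ler_normB _ _) _; rewrite (_ : 4 = 2 + 2 :> R); last by ring.
        exact: lerD.
      have /andP[c0 c1] := clamp_itv t.
      rewrite normrZ ger0_norm //; apply: le_trans (ler_piMl (normr_ge0 _) c1) _.
      by apply: le_trans (mulmx_norm_le _ _) _; rewrite ler_wpM2l ?ler0n // ler_pM.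
    have := mx_derive_bound (cW h k hr hkr) (DW h k hr hkr) (DE h k hr hkr _ IHj) t01.
    rewrite W0 // subr0 => /le_trans; apply.
    rewrite (exprS 2^-1) le_eqVlt; apply/orP; left; apply/eqP.
    by move: (E h) (2^-1 ^+ j) (`|k| ^+ 2) => u v w; field.
  rewrite -subr_le0; apply: (@geometric_le0 R _ M0) => j.
  by rewrite lerBlDl; apply: it; rewrite ler01 lexx.
exists r, (fun x => Y (x - x0) 1); split=> //.
  rewrite subrr; have n0 : `|0 : 'rV[R]_d| < r by rewrite normr0.
  have [cY y0 _ dY] := YP _ n0.
  apply/eqP; rewrite -y0 -subr_eq0 -normr_le0.
  apply: (mx_derive_bound cY dY); last by rewrite ler01 lexx.
  by move=> t _; rewrite /along linear0 mul0mx normr0.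
move=> x xr; have [Ux _] := bK _ _ (rr0 _ xr) (rr0 _ xr).
(* WE at t = 1 is the estimate that makes dP the differential of P *)
pose dP := lcomb (fun a => Gam a x *m Y (x - x0) 1).
have [||dPx DPx] := @differentiable_eps R _ _ (fun x => Y (x - x0) 1) dP x.
- exact: lcomb_continuous.
- move=> e e0; set h := x - x0 in xr *.
  have EE : 0 < 2 * E h + 1.
    by rewrite ltr_wpDl // !(mulr_ge0, addr_ge0, ler0n).
  have s0 : 0 < Num.min (r - `|h|) (e / (2 * E h + 1)).
    by rewrite lt_min subr_gt0 xr divr_gt0.
  apply: (filterS _ (@near0_norm_lt R 'rV[R]_d _ s0)) => k.
  rewrite lt_min => /andP[k1 k2].
  have hkr : `|h + k| < r.
    by apply: le_lt_trans (ler_normD _ _) _; rewrite -ltrBrDl.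
  have := WE h k xr hkr; rewrite /W /ray clamp_id ?ler01 ?lexx // !scale1r.
  have -> : x0 + h = x by rewrite /h addrC subrK.
  have -> : k + x - x0 = h + k by rewrite /h -addrA addrC.
  have -> : along k x *m Y h 1 = dP k.
    rewrite /along /dP /lcomb mulmx_suml; apply: eq_bigr => a _.
    by rewrite scalemxAl.
  move/le_trans; apply; rewrite expr2 mulrA ler_wpM2r //.
  move: k2; rewrite ltr_pdivlMr // mulrC => /ltW; apply: le_trans.
  by rewrite ler_wpM2r // lerDl.
split=> // a; rewrite /partial deriveE // DPx.
exact: lcomb_delta.
Unshelve. all: by end_near. Qed.

End ParallelFrame.

Lemma open_preimage_in (R : realType) (V W : normedModType R) (U : set V)
    (O : set W) (f : V -> W) :
  open U -> open O -> (forall x, U x -> {for x, continuous f}) ->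
  open [set x | U x /\ O (f x)].
Proof.
move=> oU oO cf; rewrite openE => x [Ux Ofx]; rewrite /interior.
have : \forall y \near x, O (f y) by apply: (cf x Ux); exact: open_near.
by apply: filterS2 (open_near oU Ux) => y.
Qed.

Lemma open_ball_norm (R : realType) (V : normedModType R) (x0 : V) (r : R) :
  open [set x | `|x - x0| < r].
Proof.
rewrite (_ : mkset _ = ball x0 r); first exact: ball_open.
by rewrite -ball_normE; apply/seteqP; split=> x /=; rewrite distrC.
Qed.

(** The equation dP = Gamma P itself gives the smoothness of P, by induction on the
    order; P is invertible near x0 since its determinant is 1 there. *)
Theorem smooth_parallel_frame (R : realType) d N (U : set 'rV[R]_d) (x0 : 'rV[R]_d)
    (Gam : 'I_d -> 'rV[R]_d -> 'M[R]_N) :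
  open U -> U x0 -> (forall a, smooth U (Gam a)) ->
  (forall x, U x -> forall a b, partial a (Gam b) x - partial b (Gam a) x =
     Gam a x *m Gam b x - Gam b x *m Gam a x) ->
  exists (V : set 'rV[R]_d) (P : 'rV[R]_d -> 'M[R]_N),
  [/\ open V, V x0, V `<=` U, smooth V P &
   forall x, V x -> P x \in unitmx /\ forall a, partial a P x = Gam a x *m P x].
Proof.
move=> oU Ux0 sGam flatG.
have [r [P [r0 P1 rP]]] := parallel_frame oU Ux0 sGam flatG.
pose B := [set x : 'rV[R]_d | `|x - x0| < r].
have oB : open B by exact: open_ball_norm.
have BU : B `<=` U by move=> x /rP[].
have sP : smooth B P.
  elim=> [|m IHm]; first by split=> // x /rP[_ dP _]; exact: differentiable_continuous.
  split=> [x /rP[_ dP _]|k]; first exact: differentiable_continuous.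
  split=> [x /rP[_ dP _]|]; first exact: diff_derivable.
  have : C_upto m B (fun x => Gam k x *m P x).
    by apply: (C_upto_mulmx oB) => //; apply: (C_upto_sub BU); exact: sGam.
  by apply: (C_upto_eq oB) => x /rP[_ _ ->].
pose V := [set x | B x /\ (\det (P x) : R^o) != 0].
have VB : V `<=` B by move=> x [].
exists V, P; split.
- apply: (@open_preimage_in _ _ R^o B [set y | y != 0] (fun x => \det (P x))) => //.
  by move=> x Bx; exact: (smooth_cont (smooth_det oB sP)).
- by split; rewrite /B /= ?subrr ?normr0 // P1 det1 oner_eq0.
- by move=> x /VB/BU.
- exact: smooth_sub VB sP.
- by move=> x [/rP[_ _ dP] Px]; rewrite unitmxE unitfE.
Qed.

(** * Changes of charts and local fields *)

Lemma eq_row_mulmx (F : pzRingType) m n (A B : 'M[F]_(m, n)) :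
  (forall v : 'rV[F]_m, v *m A = v *m B) -> A = B.
Proof. by move=> AB; apply/row_matrixP => i; rewrite !rowE. Qed.

Lemma derive_chain (R : realType) (V W Z : normedModType R) (f : V -> W)
    (g : W -> Z) x v :
  differentiable f x -> differentiable g (f x) ->
  'D_v (g \o f) x = 'D_('D_v f x) g (f x).
Proof.
move=> df dg; rewrite (deriveE _ (differentiable_comp df dg)) diff_comp //=.
by rewrite (deriveE _ df) (deriveE _ dg).
Qed.

(** The algebra behind the fact that conjugation by the Jacobians transports a
    matrix to a (1,1)-tensor. *)
Lemma conj_cocycle (F : pzRingType) n (A Jij Jjk Jik Jki Jji : 'M[F]_n) :
  Jij *m Jjk = Jik -> Jjk *m Jki = Jji ->
  Jji *m A *m Jij *m Jjk = Jjk *m (Jki *m A *m Jik).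
Proof. by move=> <- <-; rewrite !mulmxA. Qed.

Section Charts.
Variables (R : realType) (T : pointedType) (d : nat).
Implicit Types c : chart R T d.

Definition overlap c1 c2 : set 'rV[R]_d := coord c1 @` (dom c1 `&` dom c2).

Definition transition c1 c2 : 'rV[R]_d -> 'rV[R]_d := coord c2 \o param c1.

Lemma coordK c p : set_inj (dom c) (coord c) -> dom c p ->
  param c (coord c p) = p.
Proof.
by move=> ic cp; apply: pinvKV ic _ _; rewrite inE.
Qed.

Lemma overlapP c1 c2 x : set_inj (dom c1) (coord c1) -> overlap c1 c2 x ->
  [/\ dom c1 (param c1 x), dom c2 (param c1 x) & coord c1 (param c1 x) = x].
Proof. by move=> ic [p [p1 p2] <-]; rewrite coordK. Qed.

Lemma overlap_coord c1 c2 p : dom c1 p -> dom c2 p -> overlap c1 c2 (coord c1 p).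
Proof. by exists p. Qed.

Lemma transition_overlap c1 c2 x : set_inj (dom c1) (coord c1) ->
  overlap c1 c2 x -> overlap c2 c1 (transition c1 c2 x).
Proof. by move=> ic /(overlapP ic)[p1 p2 _]; exact: overlap_coord. Qed.

Lemma compatibleC c1 c2 : compatible c1 c2 -> compatible c2 c1.
Proof. by move=> [? ? ? ?]; split; rewrite setIC. Qed.

(** With row vectors, multiplication by the Jacobian is differentiation of the
    change of coordinates; all properties of Jacobians are derived from this. *)
Lemma mul_jac c1 c2 p v : set_inj (dom c1) (coord c1) -> compatible c1 c2 ->
  dom c1 p -> dom c2 p ->
  v *m chart_jac c1 c2 p = 'D_v (transition c1 c2) (coord c1 p).
Proof.
move=> ic [w _ s1 _] p1 p2; have ov := overlap_coord p1 p2.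
by rewrite /chart_jac deriveEjacobian //; exact: (smooth_mx_differentiable w).
Qed.

Lemma jac_row c1 c2 x k l : set_inj (dom c1) (coord c1) -> compatible c1 c2 ->
  overlap c1 c2 x ->
  chart_jac c1 c2 (param c1 x) k l = (partial k (transition c1 c2) x) 0 l.
Proof.
move=> ic [w _ s1 _] ox; have [_ _ cx] := overlapP ic ox.
rewrite /chart_jac cx /partial deriveEjacobian; last exact: (smooth_mx_differentiable w).
by rewrite -rowE [RHS]mxE.
Qed.

Lemma smooth_jac c1 c2 : set_inj (dom c1) (coord c1) -> compatible c1 c2 ->
  smooth (overlap c1 c2) (chart_jac c1 c2 \o param c1).
Proof.
move=> ic cc; have [w _ s1 _] := cc; apply/(smooth_mx _ w) => k l.
apply: (@smooth_eq _ _ _ _ (fun x => (partial k (transition c1 c2) x) 0 l : R^o)) => //.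
  by move=> x ox; rewrite -jac_row.
by apply: (smooth_entry w); exact: smooth_partial.
Qed.

(** The chain rule. *)
Lemma jacM c1 c2 c3 p : set_inj (dom c1) (coord c1) -> set_inj (dom c2) (coord c2) ->
  compatible c1 c2 -> compatible c2 c3 -> compatible c1 c3 ->
  dom c1 p -> dom c2 p -> dom c3 p ->
  chart_jac c1 c2 p *m chart_jac c2 c3 p = chart_jac c1 c3 p.
Proof.
move=> i1 i2 c12 c23 c13 p1 p2 p3.
have o12 := overlap_coord p1 p2; have o13 := overlap_coord p1 p3.
have o23 := overlap_coord p2 p3; have P1 := coordK i1 p1.
have [w12 _ s12 _] := c12; have [w23 _ s23 _] := c23.
have T12 : transition c1 c2 (coord c1 p) = coord c2 p by rewrite /transition /= P1.
apply: eq_row_mulmx => v; rewrite mulmxA.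
apply: etrans (congr1 (mulmx^~ _) (mul_jac v i1 c12 p1 p2)) _.
apply: etrans (mul_jac _ i2 c23 p2 p3) (etrans _ (esym (mul_jac v i1 c13 p1 p3))).
have -> : 'D_v (transition c1 c3) (coord c1 p) =
    'D_v (transition c2 c3 \o transition c1 c2) (coord c1 p).
  apply: near_eq_derive.
  apply: filterS (open_near w12 o12) => x /(overlapP i1)[x1 x2 _].
  by rewrite /transition /= coordK.
have d12 : differentiable (transition c1 c2) (coord c1 p) by exact: (smooth_mx_differentiable w12).
have d23 : differentiable (transition c2 c3) (transition c1 c2 (coord c1 p)).
  by rewrite T12; exact: (smooth_mx_differentiable w23).
by rewrite (derive_chain v d12 d23) T12.
Qed.

Lemma jac_id c p : set_inj (dom c) (coord c) -> compatible c c -> dom c p ->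
  chart_jac c c p = 1%:M.
Proof.
move=> ic cc cp; have op := overlap_coord cp cp; have [w _ s _] := cc.
apply: eq_row_mulmx => v; rewrite mulmx1 mul_jac //.
rewrite (@near_eq_derive _ _ _ (transition c c) id) ?derive_id //.
by apply: filterS (open_near w op) => x /(overlapP ic)[].
Qed.

End Charts.

Section Atlas.
Variables (R : realType) (d : nat) (M : charted R d).
Hypothesis admM : forall i : idx M, admissible (atlas i).
Implicit Types i j k : idx M.

Lemma atlas_inj i : set_inj (dom (atlas i)) (coord (atlas i)).
Proof. by have [] := admM i. Qed.

Lemma atlas_compatible i j : compatible (atlas i) (atlas j).
Proof. by have [_ _] := admM i. Qed.

Lemma open_coord_dom i : open (coord (atlas i) @` dom (atlas i)).
Proof. by have [] := admM i. Qed.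

Lemma open_overlap i j : open (overlap (atlas i) (atlas j)).
Proof. by have [] := atlas_compatible i j. Qed.

Lemma atlas_coordK i p : dom (atlas i) p -> param (atlas i) (coord (atlas i) p) = p.
Proof. exact/coordK/atlas_inj. Qed.

Lemma atlas_jacM i j k p : dom (atlas i) p -> dom (atlas j) p -> dom (atlas k) p ->
  chart_jac (atlas i) (atlas j) p *m chart_jac (atlas j) (atlas k) p =
  chart_jac (atlas i) (atlas k) p.
Proof. by apply: jacM; do ?[exact: atlas_inj | exact: atlas_compatible]. Qed.

Lemma atlas_jac_id i p : dom (atlas i) p -> chart_jac (atlas i) (atlas i) p = 1%:M.
Proof. by apply: jac_id; [exact: atlas_inj | exact: atlas_compatible]. Qed.

Lemma atlas_jacV i j p : dom (atlas i) p -> dom (atlas j) p ->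
  chart_jac (atlas i) (atlas j) p *m chart_jac (atlas j) (atlas i) p = 1%:M.
Proof. by move=> pi pj; rewrite atlas_jacM // atlas_jac_id. Qed.

Lemma open_in_dom i : open_in (dom (atlas i)).
Proof. by move=> j; exact: open_overlap. Qed.

Lemma smooth_transition i j :
  smooth (overlap (atlas i) (atlas j)) (transition (atlas i) (atlas j)).
Proof. by have [] := atlas_compatible i j. Qed.

Lemma smooth_atlas_jac i j :
  smooth (overlap (atlas i) (atlas j)) (chart_jac (atlas i) (atlas j) \o param (atlas i)).
Proof. exact/smooth_jac/atlas_compatible/atlas_inj. Qed.

Lemma smooth_atlas_jac_inv i j :
  smooth (overlap (atlas i) (atlas j)) (chart_jac (atlas j) (atlas i) \o param (atlas i)).
Proof.
have ii := @atlas_inj i.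
apply: (@smooth_eq _ _ _ _ ((chart_jac (atlas j) (atlas i) \o param (atlas j))
    \o transition (atlas i) (atlas j))); first exact: open_overlap.
  by move=> x /(overlapP ii)[xi xj _]; rewrite /transition /= atlas_coordK.
apply: (smooth_comp (@open_overlap i j) (@open_overlap j i)).
- by move=> x; exact: transition_overlap.
- exact: smooth_transition.
- exact: smooth_atlas_jac.
Qed.

(** A vector field given by its components in the chart i, extended to all charts by
    the transformation law. The values outside of the domain of i are irrelevant.
    This provides enough fields for conditions that quantify over vector fields. *)
Definition field_in_chart i (v : 'rV[R]_d -> 'rV[R]_d) : components M 'rV[R]_d :=
  fun j p => v (coord (atlas i) p) *m chart_jac (atlas i) (atlas j) p.

Lemma field_in_chartE i v p : dom (atlas i) p ->
  field_in_chart i v i p = v (coord (atlas i) p).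
Proof. by move=> pi; rewrite /field_in_chart atlas_jac_id // mulmx1. Qed.

Lemma vector_field_in_chart i v :
  smooth (coord (atlas i) @` dom (atlas i)) v ->
  vector_field (dom (atlas i)) (field_in_chart i v).
Proof.
move=> sv; split=> [j|j k p pi pj pk]; last first.
  exact: etrans (congr1 _ (esym (atlas_jacM pi pj pk))) (mulmxA _ _ _).
have oji := @open_overlap j i; apply: (smooth_mulmx oji); last exact: smooth_atlas_jac_inv.
apply: (@smooth_comp _ _ _ _ _ (transition (atlas j) (atlas i)) _ _ v oji (@open_coord_dom i)) => //.
  by move=> x [p [pj pi] <-]; rewrite /transition /= atlas_coordK //; exists p.
exact: smooth_transition.
Qed.

Definition tensor_in_chart i (A : 'M[R]_d) : components M 'M[R]_d :=
  fun j p => chart_jac (atlas j) (atlas i) p *m A *m chart_jac (atlas i) (atlas j) p.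

Lemma tensor_in_chartE i A p : dom (atlas i) p -> tensor_in_chart i A i p = A.
Proof. by move=> pi; rewrite /tensor_in_chart atlas_jac_id // mul1mx mulmx1. Qed.

Lemma tensor_in_chart_at i A p : dom (atlas i) p ->
  tensor11_at p ((tensor_in_chart i A)^~ p).
Proof.
move=> pi j k pj pk; exact: conj_cocycle (atlas_jacM pi pj pk) (atlas_jacM pj pk pi).
Qed.

Lemma tensor11_field_in_chart i A : tensor11_field (dom (atlas i)) (tensor_in_chart i A).
Proof.
split=> [j|p]; last exact: tensor_in_chart_at.
have oji := @open_overlap j i.
apply: (smooth_mulmx oji); last exact: smooth_atlas_jac_inv.
by apply: (smooth_mulmx oji); [exact: smooth_atlas_jac|exact: smooth_cst].
Qed.

Lemma open_in_chart i (O : set 'rV[R]_d) : open O ->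
  open_in [set p | dom (atlas i) p /\ O (coord (atlas i) p)].
Proof.
move=> oO j; have oji := @open_overlap j i.
rewrite (_ : (_ @` _) = [set x | overlap (atlas j) (atlas i) x /\
    O (transition (atlas j) (atlas i) x)]).
  apply: open_preimage_in => // x ox.
  exact: smooth_cont (smooth_transition j i) ox.
apply/seteqP; split=> x /=.
  move=> [p [pj [pi Op]] <-]; split; first exact: overlap_coord.
  by rewrite /transition /= atlas_coordK.
move=> [/(overlapP (@atlas_inj j))[xj xi xE] Ox].
by exists (param (atlas j) x).
Qed.

Section Diffeomorphism.
Variables (i : idx M) (O : set 'rV[R]_d) (psi psi' : 'rV[R]_d -> 'rV[R]_d).
Hypotheses (oO : open O) (Osub : O `<=` coord (atlas i) @` dom (atlas i)).
Hypotheses (spsi : smooth O psi) (oO' : open (psi @` O)).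
Hypotheses (spsi' : smooth (psi @` O) psi') (psiK : forall x, O x -> psi' (psi x) = x).

Definition diffeo_chart : chart R M d :=
  Chart [set p | dom (atlas i) p /\ O (coord (atlas i) p)] (psi \o coord (atlas i)).

Lemma diffeo_chart_inj : set_inj (dom diffeo_chart) (coord diffeo_chart).
Proof.
move=> p q; rewrite !inE /= => -[pi Op] [qi Oq] /(congr1 psi').
by rewrite !psiK // => /(@atlas_inj i _ _ (mem_set pi) (mem_set qi)).
Qed.

Lemma diffeo_chart_param y : (psi @` O) y ->
  param diffeo_chart y = param (atlas i) (psi' y).
Proof.
move=> [x Ox <-]; rewrite psiK //; have [p pi px] := Osub Ox.
have -> : psi x = coord diffeo_chart p by rewrite /= px.
by rewrite coordK //= ?px ?[in RHS]atlas_coordK //; [rewrite -px atlas_coordK|exact: diffeo_chart_inj].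
Qed.

Lemma diffeo_chart_admissible : admissible diffeo_chart.
Proof.
have cdom : coord diffeo_chart @` dom diffeo_chart = psi @` O.
  apply/seteqP; split=> y /=; first by move=> [p [pi Op] <-]; exists (coord (atlas i) p).
  by move=> [x Ox <-]; have [p pi px] := Osub Ox; exists p; rewrite /= px.
split; [exact: diffeo_chart_inj|by rewrite cdom|move=> j].
have ii := @atlas_inj i; have ij := @atlas_inj j.
have oij := @open_overlap i j; have oji := @open_overlap j i.
have E1 : coord diffeo_chart @` (dom diffeo_chart `&` dom (atlas j)) =
    [set y | (psi @` O) y /\ (overlap (atlas i) (atlas j)) (psi' y)].
  apply/seteqP; split=> y /=.
    move=> [p [[pi Op] pj] <-]; split; first by exists (coord (atlas i) p).
    by rewrite psiK //; exact: overlap_coord.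
  move=> [[x Ox <-]]; rewrite psiK // => /(overlapP ii)[xi xj xE].
  by exists (param (atlas i) x); rewrite ?xE.
have E2 : coord (atlas j) @` (dom diffeo_chart `&` dom (atlas j)) =
    [set x | overlap (atlas j) (atlas i) x /\ O (transition (atlas j) (atlas i) x)].
  apply/seteqP; split=> y /=.
    move=> [p [[pi Op] pj] <-]; split; first exact: overlap_coord.
    by rewrite /transition /= atlas_coordK.
  move=> [/(overlapP ij)[yj yi yE] Oy].
  by exists (param (atlas j) y).
have o1 : open [set y | (psi @` O) y /\ (overlap (atlas i) (atlas j)) (psi' y)].
  by apply: open_preimage_in => // y; exact: smooth_cont.
have o2 : open [set x | overlap (atlas j) (atlas i) x /\ O (transition (atlas j) (atlas i) x)].
  by apply: open_preimage_in => // y; exact: smooth_cont (smooth_transition j i).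
split.
- by rewrite E1.
- by rewrite E2.
- rewrite E1; apply: (@smooth_eq _ _ _ _ (transition (atlas i) (atlas j) \o psi')) => //.
    by move=> y [Oy _]; rewrite /= diffeo_chart_param.
  apply: (smooth_comp o1 oij); first by move=> y [].
    by apply: smooth_sub spsi' => y [].
  exact: smooth_transition.
- rewrite E2; apply: (smooth_comp o2 oO); first by move=> y [].
    by apply: smooth_sub (smooth_transition j i) => y [].
  by [].
Qed.

Lemma diffeo_chart_jac p v : dom diffeo_chart p ->
  v *m chart_jac (atlas i) diffeo_chart p = 'D_v psi (coord (atlas i) p).
Proof.
move=> [pi Op]; have ii := @atlas_inj i.
have ci : compatible (atlas i) diffeo_chart.
  by apply: compatibleC; have [_ _] := diffeo_chart_admissible.
have op : overlap (atlas i) diffeo_chart (coord (atlas i) p) by exact: overlap_coord.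
rewrite mul_jac //.
apply: near_eq_derive; have [w _ _ _] := ci.
by apply: filterS (open_near w op) => x /(overlapP ii)[_ _ xE]; rewrite /transition /= xE.
Qed.

Lemma diffeo_chart_jacM j p : dom (atlas j) p -> dom diffeo_chart p ->
  chart_jac (atlas j) diffeo_chart p =
  chart_jac (atlas j) (atlas i) p *m chart_jac (atlas i) diffeo_chart p.
Proof.
move=> pj pc; have [pi _] := pc; have [_ _ cc] := diffeo_chart_admissible.
rewrite jacM //; do ?[exact: atlas_inj|exact: atlas_compatible].
  exact: compatibleC.
exact: compatibleC.
Qed.

End Diffeomorphism.

End Atlas.

(** * The bundle of (1,1)-tensors is a manifold *)

Section Cylinder.
Variables (R : realType) (n m : nat).

Definition base_coord (z : 'rV[R]_(n + n * m)) : 'rV[R]_n := lsubmx z.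
Definition fibre_coord (z : 'rV[R]_(n + n * m)) : 'M[R]_(n, m) := vec_mx (rsubmx z).

Definition cylinder (O : set 'rV[R]_n) : set 'rV[R]_(n + n * m) := base_coord @^-1` O.

Lemma base_coord_row_mx x (t : 'M[R]_(n, m)) : base_coord (row_mx x (mxvec t)) = x.
Proof. exact: row_mxKl. Qed.

Lemma fibre_coord_row_mx x (t : 'M[R]_(n, m)) : fibre_coord (row_mx x (mxvec t)) = t.
Proof. by rewrite /fibre_coord row_mxKr mxvecK. Qed.

Lemma row_mx_coord z : row_mx (base_coord z) (mxvec (fibre_coord z)) = z.
Proof. by rewrite /fibre_coord vec_mxK hsubmxK. Qed.

Fact base_coord_linear : linear base_coord.
Proof. by move=> a u v; rewrite /base_coord linearP. Qed.
HB.instance Definition _ :=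
  GRing.isLinear.Build R 'rV[R]_(n + n * m) 'rV[R]_n *:%R base_coord base_coord_linear.

Fact fibre_coord_linear : linear fibre_coord.
Proof. by move=> a u v; rewrite /fibre_coord !linearP. Qed.
HB.instance Definition _ :=
  GRing.isLinear.Build R 'rV[R]_(n + n * m) 'M[R]_(n, m) *:%R fibre_coord fibre_coord_linear.

Lemma open_cylinder O : open O -> open (cylinder O).
Proof.
move=> oO; rewrite /cylinder; apply: (@open_comp _ _ base_coord) => // z _.
exact: linear_mx_continuous.
Qed.

Lemma smooth_base_coord (U : set 'rV[R]_(n + n * m)) : open U -> smooth U base_coord.
Proof.
move=> oU; apply/(smooth_mx _ oU) => i j; rewrite ord1 /base_coord.
by under eq_fun do rewrite mxE; exact: smooth_coord.
Qed.

Lemma smooth_fibre_coord (U : set 'rV[R]_(n + n * m)) : open U -> smooth U fibre_coord.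
Proof.
move=> oU; apply: (smooth_vec_mx oU); apply/(smooth_mx _ oU) => i j; rewrite ord1.
by under eq_fun do rewrite mxE; exact: smooth_coord.
Qed.

Lemma smooth_cylinder p q (O : set 'rV[R]_n) (F : 'rV[R]_n -> 'M[R]_(p, q)) :
  open O -> smooth O F -> smooth (cylinder O) (fun z => F (base_coord z)).
Proof.
move=> oO sF; apply: (smooth_comp (f := base_coord) (open_cylinder oO) oO) => //.
exact/smooth_base_coord/open_cylinder.
Qed.

End Cylinder.

Section TensorBundle.
Variables (R : realType) (n : nat) (M : charted R n).
Hypothesis mM : manifold M.

Let admM (i : idx M) : admissible (atlas i).
Proof. by have [+ _ _] := mM; apply. Qed.

Implicit Types i j : idx M.

(** Extended by 0 off the domains, as required of a point of the bundle; through
    T11_of it shows that the image of an induced chart is a full cylinder. *)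
Definition T11_comps i (p : M) (t : 'M[R]_n) j : 'M[R]_n :=
  if `[< dom (atlas j) p >] then tensor_in_chart i t j p else 0.

Fact T11_comps_at i p t : dom (atlas i) p -> tensor11_at p (T11_comps i p t).
Proof.
move=> pi j k pj pk; rewrite /T11_comps !asboolT //.
exact: (tensor_in_chart_at admM).
Qed.

Fact T11_comps_out i p t j : ~ dom (atlas j) p -> T11_comps i p t j = 0.
Proof. by move=> pj; rewrite /T11_comps asboolF. Qed.

Definition T11_of i p t (pi : dom (atlas i) p) : T11_point M :=
  T11Point (T11_comps_at t pi) (@T11_comps_out i p t).

Lemma T11_ofE i p t (pi : dom (atlas i) p) : comps (T11_of t pi) i = t.
Proof. by rewrite /= /T11_comps asboolT // (tensor_in_chartE admM). Qed.

Lemma comps_change (P : T11_point M) i j :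
  dom (atlas i) (foot P) -> dom (atlas j) (foot P) ->
  comps P j = tensor_in_chart i (comps P i) j (foot P).
Proof.
move=> Pi Pj; have E := compsP Pi Pj; have V := atlas_jacV admM Pj Pi.
apply: etrans (esym (mul1mx _)) _; apply: etrans (congr1 (mulmx^~ _) (esym V)) _.
apply: etrans (esym (mulmxA _ _ _)) _.
exact: etrans (congr1 _ (esym E)) (mulmxA _ _ _).
Qed.

Lemma T11_point_eq (P Q : T11_point M) i :
  foot P = foot Q -> dom (atlas i) (foot P) -> comps P i = comps Q i -> P = Q.
Proof.
move=> fPQ Pi cPQ; have {}cPQ : comps P = comps Q.
  apply/funext => j; have [Pj|Pj] := pselect (dom (atlas j) (foot P)).
    by rewrite (comps_change Pi Pj) cPQ fPQ -comps_change -?fPQ.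
  by rewrite (comps_out Pj) comps_out // -fPQ.
case: P Q fPQ cPQ {Pi} => [p c h1 h2] [q c' h1' h2'] /= fE cE.
case: q / fE in h1' h2' *; case: c' / cE in h1' h2' *.
by congr T11Point; exact: Prop_irrelevance.
Qed.

Lemma coord_T11 i (P : T11_point M) :
  coord (T11_chart i) P = row_mx (coord (atlas i) (foot P)) (mxvec (comps P i)).
Proof. by []. Qed.

Lemma T11_chart_inj i : set_inj (dom (T11_chart i)) (coord (T11_chart i)).
Proof.
move=> P Q; rewrite !inE => Pi Qi; rewrite !coord_T11 => /eq_row_mx[fE cE].
apply: (@T11_point_eq _ _ i) => //.
  by apply: (@atlas_inj _ _ _ admM i); rewrite ?inE.
exact: (can_inj mxvecK) cE.
Qed.

Lemma T11_overlap i j :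
  overlap (T11_chart i) (T11_chart j) =
  @cylinder R n n (overlap (atlas i) (atlas j)).
Proof.
apply/seteqP; split=> z; rewrite /overlap /cylinder /=.
  by move=> [P [Pi Pj] <-]; exists (foot P) => //; rewrite base_coord_row_mx.
move=> [p [pi pj] px]; exists (T11_of (fibre_coord z) pi) => //.
by rewrite [comps _ _]T11_ofE px row_mx_coord.
Qed.

Lemma T11_coord_dom i : coord (T11_chart i) @` dom (T11_chart i) =
  @cylinder R n n (coord (atlas i) @` dom (atlas i)).
Proof.
have := T11_overlap i i; rewrite /overlap !setIid; exact.
Qed.

(** In induced coordinates t is conjugated by the Jacobian of the base, which is
    smooth in x; hence the changes of induced charts are smooth. *)
Lemma T11_transition i j z :
  overlap (T11_chart i) (T11_chart j) z ->
  transition (T11_chart i) (T11_chart j) z =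
  row_mx (transition (atlas i) (atlas j) (base_coord z))
    (mxvec ((chart_jac (atlas j) (atlas i) \o param (atlas i)) (base_coord z)
       *m fibre_coord z *m (chart_jac (atlas i) (atlas j) \o param (atlas i)) (base_coord z))).
Proof.
move=> [P [Pi Pj] <-]; rewrite /transition /= (coordK (@T11_chart_inj i) Pi).
rewrite !base_coord_row_mx fibre_coord_row_mx (atlas_coordK admM Pi).
by rewrite (comps_change Pi Pj).
Qed.

Lemma T11_admissible i : @admissible R (n + n * n) (T11 M) (T11_chart i).
Proof.
split; first exact: T11_chart_inj.
  by rewrite T11_coord_dom; apply: open_cylinder; exact: (@open_coord_dom _ _ _ admM).
have co i' j' : open (overlap (T11_chart i') (T11_chart j')).
  by rewrite T11_overlap; apply: open_cylinder; exact: (@open_overlap _ _ _ admM).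
have st i' j' : smooth (overlap (T11_chart i') (T11_chart j'))
    (transition (T11_chart i') (T11_chart j')).
  have oM := @open_overlap _ _ _ admM i' j'; have oC := co i' j'.
  apply: (@smooth_eq _ _ _ _ (fun z =>
    row_mx (transition (atlas i') (atlas j') (base_coord z))
    (mxvec ((chart_jac (atlas j') (atlas i') \o param (atlas i')) (base_coord z)
       *m fibre_coord z *m (chart_jac (atlas i') (atlas j') \o param (atlas i')) (base_coord z))))) => //.
    by move=> z /T11_transition.
  apply: (smooth_row_mx oC).
    rewrite T11_overlap; exact: (@smooth_cylinder R n n 1 n _ _ oM (@smooth_transition _ _ _ admM i' j')).
  apply/(smooth_mxvec oC)/(smooth_mulmx oC); first apply: (smooth_mulmx oC).
  - rewrite T11_overlap; exact: (@smooth_cylinder R n n n n _ _ oM (@smooth_atlas_jac_inv _ _ _ admM i' j')).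
  - exact: smooth_fibre_coord.
  - rewrite T11_overlap; exact: (@smooth_cylinder R n n n n _ _ oM (@smooth_atlas_jac _ _ _ admM i' j')).
move=> j; split; [exact: co|by have := co j i; rewrite /overlap setIC|exact: st|].
by have := st j i; rewrite /overlap setIC.
Qed.

Lemma T11_open_foot (A : set M) : open_in A -> open_in ([set P | A (foot P)] : set (T11 M)).
Proof.
move=> oA i; rewrite (_ : _ @` _ = @cylinder R n n
  (coord (@atlas R n M i) @` (dom (@atlas R n M i) `&` A))).
  exact/open_cylinder/oA.
apply/seteqP; split=> z; rewrite /cylinder /=.
  by move=> [P [Pi PA] <-]; exists (foot P) => //; rewrite base_coord_row_mx.
move=> [p [pi pA] px]; exists (T11_of (fibre_coord z) pi) => //.
by rewrite [comps _ _]T11_ofE px row_mx_coord.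
Qed.

(** Two points over different points of M are separated by preimages of open sets
    of M; two points of the same fibre lie in one induced chart and are separated
    there by balls. *)
Lemma T11_manifold : manifold (T11 M).
Proof.
have [_ sepM [s cov]] := mM.
split; [exact: T11_admissible|move=> P Q PQ|by exists s => P; exact: cov].
have [fE|fE] := pselect (foot P = foot Q); last first.
  have [A [B [oA oB Ap Bq AB]]] := sepM _ _ fE.
  exists [set P | A (foot P)], [set P | B (foot P)]; split=> //.
  - exact: T11_open_foot.
  - exact: T11_open_foot.
  - by apply/seteqP; split=> // X [XA XB]; have : (A `&` B) (foot X) by []; rewrite AB.
have [k Pk] := cov (foot P); set i := s k in Pk.
have Qi : dom (atlas i) (foot Q) by rewrite -fE.
pose c := coord (T11_chart i).
have cPQ : c P <> c Q by move=> cE; apply: PQ; apply: (@T11_chart_inj i); rewrite ?inE.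
pose e := `|c P - c Q| / 2.
have e0 : 0 < e by rewrite divr_gt0 // normr_gt0 subr_eq0; exact/eqP.
exists [set X : T11 M | dom (T11_chart i) X /\ `|c X - c P| < e],
  [set X : T11 M | dom (T11_chart i) X /\ `|c X - c Q| < e]; split.
- exact: (@open_in_chart _ _ (T11 M) T11_admissible i _ (open_ball_norm _ _)).
- exact: (@open_in_chart _ _ (T11 M) T11_admissible i _ (open_ball_norm _ _)).
- by split=> //; rewrite subrr normr0.
- by split=> //; rewrite subrr normr0.
- apply/seteqP; split=> // X /= [[_ XP] [_ XQ]].
  have := ler_distD (c X) (c P) (c Q); rewrite [`|c P - c X|]distrC.
  by rewrite leNgt [ltRHS](splitr `|c P - c Q|) -/e ltrD.
Qed.

End TensorBundle.

(** * The Levi-Civita connection in a chart *)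

Definition commutator (R : pzRingType) n (A B : 'M[R]_n) : 'M[R]_n := A *m B - B *m A.

(** Test against the matrices delta_mx i j. *)
Lemma commutator_central (F : fieldType) n (A : 'M[F]_n) :
  (forall t, commutator A t = 0) -> exists c : F, A = c%:M.
Proof.
case: n A => [|n] A At; first by exists 0; apply/matrixP => -[].
have E i j k : A k i = (k == i)%:R * A j j.
  have /matrixP/(_ k j) := At (delta_mx i j).
  rewrite !mxE (bigD1 i) //= big1 ?addr0; last first.
    by move=> l li; rewrite mxE (negPf li) mulr0.
  rewrite (bigD1 j) //= big1 ?addr0; last first.
    by move=> l lj; rewrite mxE (negPf lj) andbF mul0r.
  by rewrite !mxE !eqxx !andbT mulr1 => /eqP; rewrite subr_eq0 => /eqP.
by exists (A 0 0); apply/matrixP => k i; rewrite (E i 0 k) mxE mulr_natl.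
Qed.

Lemma smooth_commutator (R : realType) d n (U : set 'rV[R]_d) (A B : 'rV[R]_d -> 'M[R]_n) :
  open U -> smooth U A -> smooth U B -> smooth U (fun x => commutator (A x) (B x)).
Proof.
move=> oU sA sB.
have -> : (fun x => commutator (A x) (B x)) =
    (fun x => A x *m B x + - 1%:M *m (B x *m A x)).
  by apply/funext => x; rewrite mulNmx mul1mx.
apply: (smoothD oU); first exact: (smooth_mulmx oU).
have s1 : smooth U (fun=> - 1%:M : 'M[R]_n) by move=> m; exact: C_upto_cst.
exact: (smooth_mulmx oU) s1 (smooth_mulmx oU sB sA).
Qed.

Section ChartGeometry.
Variables (R : realType) (n : nat) (O : set 'rV[R]_n) (G : 'rV[R]_n -> 'M[R]_n).
Hypotheses (oO : open O) (sG : smooth O G).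
Hypothesis symG : forall x, O x -> (G x)^T = G x.
Hypothesis unitG : forall x, O x -> G x \in unitmx.

(** The connection form: with row vectors it acts on vector fields by right
    multiplication, and on (1,1)-tensors by minus the commutator. *)
Definition christoffel_mx (a : 'I_n) (x : 'rV[R]_n) : 'M[R]_n :=
  \matrix_(b, c) christoffel G x a b c.

(** Minus the commutator, since row vectors compose in the opposite order. *)
Definition curvature_mx (a b : 'I_n) (x : 'rV[R]_n) : 'M[R]_n :=
  partial a (christoffel_mx b) x - partial b (christoffel_mx a) x
  - commutator (christoffel_mx a x) (christoffel_mx b x).

Definition metric_partial (a b c : 'I_n) (x : 'rV[R]_n) : R :=
  partial a (fun y => G y b c : R^o) x.

Lemma metric_partialC a b c x : O x -> metric_partial a b c x = metric_partial a c b x.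
Proof.
move=> Ox; apply: near_eq_derive; apply: filterS (open_near oO Ox) => y Oy.
by rewrite -{1}(symG Oy) mxE.
Qed.

Lemma smooth_christoffel a : smooth O (christoffel_mx a).
Proof.
have sp k i j : smooth O (fun x => metric_partial k i j x : R^o).
  exact: smooth_partial (smooth_entry oO _ _ sG).
apply/(smooth_mx _ oO) => b c; under eq_fun do rewrite mxE.
apply: (smoothMl oO); apply: (smooth_sum oO) => l; apply: (smoothM oO).
  exact: (smooth_entry oO) (smooth_invmx oO unitG sG).
by apply: (smoothB oO); first apply: (smoothD oO); exact: sp.
Qed.

Lemma differentiable_christoffel a x : O x -> differentiable (christoffel_mx a) x.
Proof. by move=> Ox; apply: (smooth_mx_differentiable oO) => //; exact: smooth_christoffel. Qed.

Lemma partial_metric a x b c : O x -> (partial a G x) b c = metric_partial a b c x.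
Proof. by move=> Ox; rewrite /partial derive_entry //; exact/diff_derivable/(smooth_mx_differentiable oO). Qed.

(** The Christoffel symbols of the first kind. *)
Lemma christoffel_metric a x b c : O x -> (christoffel_mx a x *m G x) b c =
  2^-1 * (metric_partial a c b x + metric_partial b a c x - metric_partial c a b x).
Proof.
move=> Ox; rewrite mxE.
transitivity (2^-1 * \sum_l (\sum_k invmx (G x) k l * G x k c) *
    (metric_partial a l b x + metric_partial b a l x - metric_partial l a b x)).
  under eq_bigr do rewrite mxE /christoffel -mulrA mulr_suml.
  rewrite -mulr_sumr exchange_big; congr (_ * _); apply: eq_bigr => l _.
  by rewrite mulr_suml; apply: eq_bigr => k _; rewrite mulrAC.
have E l : \sum_k invmx (G x) k l * G x k c = (c == l)%:R.
  have /matrixP/(_ c l) := mulmxV (unitG Ox); rewrite !mxE => <-.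
  apply: eq_bigr => k _; rewrite mulrC; congr (_ * _).
  by rewrite -{1}(symG Ox) mxE.
congr (_ * _); under eq_bigr do rewrite E.
rewrite (bigD1 c) //= big1 ?addr0 => [|l]; first by rewrite eqxx mul1r.
by rewrite eq_sym => /negPf->; rewrite mul0r.
Qed.

Lemma metric_compatible a x : O x ->
  partial a G x = christoffel_mx a x *m G x + G x *m (christoffel_mx a x)^T.
Proof.
move=> Ox; have -> : G x *m (christoffel_mx a x)^T = (christoffel_mx a x *m G x)^T.
  by rewrite trmx_mul symG.
apply/matrixP => b c; rewrite partial_metric // mxE [X in _ = _ + X]mxE.
rewrite !christoffel_metric // (metric_partialC a c b Ox).
rewrite (metric_partialC b a c Ox) (metric_partialC c a b Ox).
by field.
Qed.

Lemma curvature_mxE a b x : O x ->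
  curvature_mx a b x = \matrix_(c, l) curvature G x a b c l.
Proof.
move=> Ox; have dG k : derivable (christoffel_mx k) x (delta_mx 0 a).
  exact/diff_derivable/differentiable_christoffel.
have dG' k : derivable (christoffel_mx k) x (delta_mx 0 b).
  exact/diff_derivable/differentiable_christoffel.
apply/matrixP => c l; rewrite /curvature_mx /commutator /curvature /partial.
have Efun k : (fun y => christoffel_mx k y c l : R^o) = (fun y => christoffel G y k c l).
  by apply/funext => y; rewrite mxE.
have ent (A B C D : 'M[R]_n) :
    (A - B - (C - D)) c l = A c l - B c l + (D c l - C c l).
  by rewrite !mxE; ring.
rewrite [RHS]mxE; apply: etrans (ent _ _ _ _) _; congr (_ - _ + _).
- exact: etrans (derive_entry c l (dG b))
    (congr1 (fun u => 'D_(delta_mx 0 a) u x) (Efun b)).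
- exact: etrans (derive_entry c l (dG' a))
    (congr1 (fun u => 'D_(delta_mx 0 b) u x) (Efun a)).
- rewrite !mxE -sumrB; apply: eq_bigr => m _; rewrite !mxE.
  by rewrite mulrC [in X in _ - X = _]mulrC.
Qed.

(** Differentiating the compatibility of G with the connection twice, the second
    derivatives of G cancel by symmetry, and what remains is the skewness of the
    curvature operators. *)
Lemma curvature_skew a b x : O x ->
  curvature_mx a b x *m G x + G x *m (curvature_mx a b x)^T = 0.
Proof.
move=> Ox.
have E c d : partial c (partial d G) x =
    partial c (christoffel_mx d) x *m G x + G x *m (partial c (christoffel_mx d) x)^T
    + christoffel_mx d x *m partial c G x + partial c G x *m (christoffel_mx d x)^T.
  have := @near_eq_derive _ _ _ (partial d G)
    (fun y => christoffel_mx d y *m G y + G y *m (christoffel_mx d y)^T) x (delta_mx 0 c).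
  rewrite /partial => -> //; last first.
    by apply: filterS (open_near oO Ox) => y; exact: metric_compatible.
  have dC : is_derive x (delta_mx 0 c) (christoffel_mx d) (partial c (christoffel_mx d) x).
    exact/DeriveDef/erefl/diff_derivable/differentiable_christoffel.
  have dG : is_derive x (delta_mx 0 c) G (partial c G x).
    exact/DeriveDef/erefl/diff_derivable/(smooth_mx_differentiable oO).
  have [_ D] := is_deriveD (is_derive_mulmx dC dG)
    (is_derive_mulmx dG (is_derive_linear_mx trmx dC)).
  apply: etrans D _; rewrite -/(partial c (christoffel_mx d) x) -/(partial c G x).
  move: (partial c (christoffel_mx d) x *m G x) (christoffel_mx d x *m partial c G x)
    (partial c G x *m (christoffel_mx d x)^T)
    (G x *m (partial c (christoffel_mx d) x)^T) => A B C D'.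
  by rewrite [C + D']addrC !addrA; congr (_ + _); rewrite addrAC.
have S : partial a (partial b G) x = partial b (partial a G) x.
  apply/matrixP => i j.
  have e c d : (partial c (partial d G) x) i j =
      partial c (partial d (fun y => G y i j : R^o)) x.
    have dd : derivable (partial d G) x (delta_mx 0 c).
      exact/diff_derivable/(smooth_mx_differentiable oO (smooth_partial d sG) Ox).
    apply: etrans (derive_entry i j dd) _; apply: near_eq_derive.
    by apply: filterS (open_near oO Ox) => y Oy; exact: partial_metric.
  exact: etrans (e a b) (etrans (partialC oO (smooth_entry oO i j sG) a b Ox)
    (esym (e b a))).
have {S} := etrans (esym (E a b)) (etrans S (E b a)).
rewrite !(metric_compatible _ Ox) /curvature_mx /commutator.
move: (partial a (christoffel_mx b) x) (partial b (christoffel_mx a) x)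
  (christoffel_mx a x) (christoffel_mx b x) (G x) => A' B' A B g H.
rewrite !(linearB, linearD, trmx_mul, mulmxBl, mulmxBr, mulmxDl, mulmxDr) /=.
rewrite !(trmx_mul, mulNmx, mulmxN, opprK) -!mulmxA.
rewrite !(linearB, linearD, trmx_mul, mulmxBl, mulmxBr, mulmxDl, mulmxDr) /= -!mulmxA in H.
move/matrixP: H => H; apply/matrixP => i j; move: (H i j).
rewrite !mxE; lra.
Qed.

(** Only scalar matrices commute with all t, and a scalar matrix that is skew for a
    metric vanishes. This is the step that recovers the curvature from its action
    on (1,1)-tensors. *)
Lemma curvature_mx_central a b x : O x ->
  (forall t, commutator (curvature_mx a b x) t = 0) -> curvature_mx a b x = 0.
Proof.
move=> Ox /commutator_central[c cE]; have := curvature_skew a b Ox.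
rewrite cE tr_scalar_mx mul_scalar_mx mul_mx_scalar -scalerDl => cG.
have /(congr1 (mulmx^~ (invmx (G x)))) := cG.
rewrite mul0mx -scalemxAl mulmxV ?unitG // => /matrixP c0.
apply/matrixP => i j; have := c0 i j; rewrite !mxE.
by case: eqP => _; rewrite ?mulr1n ?mulr0n //; lra.
Qed.

End ChartGeometry.

Section FibreMetric.
Variables (R : realType) (n : nat).

(** As a trace, the fibre metric can be differentiated by the product rule. *)
Lemma fibre_metricE (G A B : 'M[R]_n) :
  fibre_metric G A B = \tr ((invmx G)^T *m A *m G *m B^T).
Proof.
rewrite /fibre_metric /mxtrace.
transitivity (\sum_i \sum_c \sum_l \sum_j G i c * invmx G j l * A j i * B l c).
  by apply: eq_bigr => i _; apply: eq_bigr => c _; rewrite exchange_big.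
transitivity (\sum_l \sum_c \sum_i \sum_j G i c * invmx G j l * A j i * B l c).
  rewrite exchange_big; under eq_bigr do rewrite exchange_big.
  by rewrite exchange_big.
apply: eq_bigr => l _; rewrite mxE; apply: eq_bigr => c _.
rewrite !mxE mulr_suml; apply: eq_bigr => i _.
rewrite !mxE !mulr_suml; apply: eq_bigr => j _; rewrite !mxE; ring.
Qed.

Lemma fibre_metric0l (G B : 'M[R]_n) : fibre_metric G 0 B = 0.
Proof. by rewrite fibre_metricE mulmx0 !mul0mx linear0. Qed.

End FibreMetric.

Lemma trace_transport (F : comNzRingType) n (Gi g K A B : 'M[F]_n) :
  - \tr (Gi *m (K *m A - A *m K) *m g *m B^T)
  - \tr (Gi *m A *m g *m (K *m B - B *m K)^T) =
  \tr (((- (K^T *m Gi) - Gi *m K) *m A *m g + Gi *m A *m (K *m g + g *m K^T)) *m B^T).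
Proof.
have TN (X : 'M[F]_n) : \tr (- X) = - \tr X by rewrite linearN.
have TD (X Y : 'M[F]_n) : \tr (X + Y) = \tr X + \tr Y by rewrite linearD.
have -> : (K *m B - B *m K)^T = B^T *m K^T - K^T *m B^T.
  by apply/matrixP => i j; rewrite linearB /= !trmx_mul.
rewrite !(mulmxBr, mulmxBl, mulmxDr, mulmxDl, mulNmx, mulmxN) !mulmxA !(TD, TN).
have -> : \tr (Gi *m A *m g *m B^T *m K^T) = \tr (K^T *m Gi *m A *m g *m B^T).
  by rewrite mxtrace_mulC !mulmxA.
move: (\tr _) (\tr _) (\tr _) (\tr _) => a b c d.
ring.
Qed.

Section ParallelFibreMetric.
Variables (R : realType) (n : nat) (O : set 'rV[R]_n) (G : 'rV[R]_n -> 'M[R]_n).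
Hypotheses (oO : open O) (sG : smooth O G).
Hypothesis symG : forall x, O x -> (G x)^T = G x.
Hypothesis unitG : forall x, O x -> G x \in unitmx.

Local Notation conn := (along (christoffel_mx G)).

Lemma derive_metric v x : O x ->
  is_derive x v G (conn v x *m G x + G x *m (conn v x)^T).
Proof.
move=> Ox; have dG := smooth_mx_differentiable oO sG Ox.
split; first exact: diff_derivable.
rewrite deriveE_partial // /along /lcomb linear_sum mulmx_suml mulmx_sumr -big_split.
apply: eq_bigr => a _; rewrite (metric_compatible oO sG symG unitG) //.
by rewrite scalerDr /= linearZ /= -scalemxAl -scalemxAr.
Qed.

Lemma derive_metric_inv v x : O x ->
  is_derive x v (fun y => invmx (G y))
    (- (invmx (G x) *m conn v x) - (conn v x)^T *m invmx (G x)).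
Proof.
move=> Ox; have di := smooth_mx_differentiable oO (smooth_invmx oO unitG sG) Ox.
have nu : \forall y \near x, G y \in unitmx.
  by apply: filterS (open_near oO Ox) => y; exact: unitG.
apply: is_derive_eq (derive_invmx nu (diff_derivable di) (derive_metric v Ox)) _.
rewrite mulmxDr (mulKmx (unitG Ox)) mulmxDl opprD mulmxA.
by rewrite (mulmxK (unitG Ox)).
Qed.

(** Parallel transport of (1,1)-tensors is an isometry of the fibres: this is the
    compatibility of the connection with the metric, carried over to tensors. *)
Lemma derive_fibre_metric v x A B : O x ->
  is_derive x v (fun y => fibre_metric (G y) A B : R^o)
    (- fibre_metric (G x) (commutator (conn v x) A) B
     - fibre_metric (G x) A (commutator (conn v x) B)).
Proof.
move=> Ox; set K := conn v x.
have DiT := is_derive_linear_mx trmx (derive_metric_inv v Ox).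
have DA : is_derive x v (fun=> A) 0 by exact: is_derive_cst.
have DB : is_derive x v (fun=> B^T) 0 by exact: is_derive_cst.
have D := is_derive_mulmx (is_derive_mulmx (is_derive_mulmx DiT DA)
  (derive_metric v Ox)) DB.
have ct : continuous (mxtrace : 'M[R]_n -> R^o) by exact: linear_mx_continuous.
have := is_derive_linear (L := mxtrace : {linear 'M[R]_n -> R^o}) ct D.
have -> : (fun y => fibre_metric (G y) A B : R^o) =
    (fun y => \tr ((invmx (G y))^T *m A *m G y *m B^T) : R^o).
  by apply/funext => y; exact: fibre_metricE.
have GiT : (invmx (G x))^T = invmx (G x) by rewrite trmx_inv symG.
move=> H; rewrite !fibre_metricE GiT trace_transport.
move: H; rewrite !mulmx0 !addr0 linearB /= linearN /= !trmx_mul trmxK GiT.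
exact.
Qed.

End ParallelFibreMetric.

(** * The phi-operator as a tensor *)

Section Bilin.
Variables (R : realType) (d : nat).
Implicit Types (h : 'M[R]_d) (u v w : 'rV[R]_d).

Lemma bilinDm h h' v w : bilin (h + h') v w = bilin h v w + bilin h' v w.
Proof. by rewrite /bilin mulmxDr mulmxDl mxE. Qed.

Lemma bilinDl h u v w : bilin h (u + v) w = bilin h u w + bilin h v w.
Proof. by rewrite /bilin !mulmxDl mxE. Qed.

Lemma bilinDr h u v w : bilin h u (v + w) = bilin h u v + bilin h u w.
Proof. by rewrite /bilin linearD mulmxDr mxE. Qed.

Lemma bilinZl h c v w : bilin h (c *: v) w = c * bilin h v w.
Proof. by rewrite /bilin -!scalemxAl mxE. Qed.

Lemma bilinZr h c v w : bilin h v (c *: w) = c * bilin h v w.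
Proof. by rewrite /bilin linearZ /= -scalemxAr mxE. Qed.

Lemma bilinNl h v w : bilin h (- v) w = - bilin h v w.
Proof. by rewrite -scaleN1r bilinZl mulN1r. Qed.

Lemma bilinNr h v w : bilin h v (- w) = - bilin h v w.
Proof. by rewrite -scaleN1r bilinZr mulN1r. Qed.

Lemma bilinC h v w : h^T = h -> bilin h v w = bilin h w v.
Proof.
move=> hT; rewrite /bilin; have -> : v *m h *m w^T = (w *m h *m v^T)^T.
  by rewrite !trmx_mul trmxK hT mulmxA.
by rewrite mxE.
Qed.

Lemma is_derive_bilin (V : normedModType R) (h : V -> 'M[R]_d) (Y Z : V -> 'rV[R]_d)
    (dh : 'M[R]_d) (dY dZ : 'rV[R]_d) (x v : V) :
  is_derive x v h dh -> is_derive x v Y dY -> is_derive x v Z dZ ->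
  is_derive x v (fun y => bilin (h y) (Y y) (Z y) : R^o)
    (bilin dh (Y x) (Z x) + bilin (h x) dY (Z x) + bilin (h x) (Y x) dZ).
Proof.
move=> Dh DY DZ.
have /is_derive_mx/(_ 0 0) := is_derive_mulmx (is_derive_mulmx DY Dh)
  (is_derive_linear_mx trmx DZ).
rewrite mulmxDl /bilin; move: (dY *m h x *m _) (Y x *m dh *m _) (_ *m dZ^T) => A B C.
by rewrite !mxE [B 0 0 + _]addrC.
Qed.

End Bilin.

(** Derivatives and values of forms are generalized first: otherwise ring compares
    these terms up to conversion. *)
Ltac bilin_ring :=
  repeat match goal with
  | |- context [bilin ?h ?v ?w] => generalize (bilin h v w); intro
  end; ring.

Lemma deriveDdir (R : realType) (V W : normedModType R) (u : V -> W) x v w :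
  differentiable u x -> 'D_(v + w) u x = 'D_v u x + 'D_w u x.
Proof. by move=> du; rewrite !deriveE // linearD. Qed.

Lemma deriveZdir (R : realType) (V W : normedModType R) (u : V -> W) x c v :
  differentiable u x -> 'D_(c *: v) u x = c *: 'D_v u x.
Proof. by move=> du; rewrite !deriveE // linearZ. Qed.

Ltac tensor_ring :=
  repeat match goal with
  | |- context [derive ?f ?x ?v] => generalize (derive f x v); intro
  end;
  rewrite ?(mulmxDr, bilinDm, bilinDl, bilinDr); bilin_ring.

Section TachibanaTensor.
Variables (R : realType) (d : nat) (phi h : 'rV[R]_d -> 'M[R]_d) (x : 'rV[R]_d).
Hypotheses (dphi : differentiable phi x) (dh : differentiable h x).
Hypothesis phi_sym : forall v w, bilin (h x) (v *m phi x) w = bilin (h x) v (w *m phi x).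

(** What is left of the phi-operator when the derivatives of the three fields have
    cancelled. *)
Definition tachibana_tensor (a b c : 'rV[R]_d) : R :=
  bilin ('D_(a *m phi x) h x) b c - bilin ('D_a h x) (b *m phi x) c
  - bilin (h x) (b *m 'D_a phi x) c + bilin (h x) (a *m 'D_b phi x) c
  + bilin (h x) b (a *m 'D_c phi x).

(** Expanding by the product rule, the terms that contain derivatives of X cancel in
    general; those that contain derivatives of Y and Z cancel because phi is
    symmetric for h. *)
Lemma tachibanaE (X Y Z : 'rV[R]_d -> 'rV[R]_d) :
  differentiable X x -> differentiable Y x -> differentiable Z x ->
  tachibana phi h X Y Z x = tachibana_tensor (X x) (Y x) (Z x).
Proof.
move=> dX dY dZ.
have D (p q : nat) (F : 'rV[R]_d -> 'M[R]_(p, q)) v : differentiable F x -> is_derive x v F ('D_v F x).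
  by move=> dF; exact/DeriveDef/erefl/diff_derivable.
have DXphi v := is_derive_mulmx (D _ _ X v dX) (D _ _ phi v dphi).
have DYphi v := is_derive_mulmx (D _ _ Y v dY) (D _ _ phi v dphi).
have lie (F : 'rV[R]_d -> 'rV[R]_d) : differentiable F x ->
    lie_derivative11 F phi X x = X x *m 'D_(F x) phi x - 'D_(X x *m phi x) F x
      + 'D_(X x) F x *m phi x.
  move=> dF; rewrite /lie_derivative11 /lie_bracket.
  have [_ ->] := DXphi (F x); rewrite mulmxBl.
  move: (_ *m _) (_ *m _) ('D__ _ _) (_ *m _) => A B C E.
  by apply/matrixP => i j; rewrite !mxE; ring.
rewrite /tachibana !lie //.
have [_ ->] := is_derive_bilin (D _ _ h (X x *m phi x) dh) (D _ _ Y _ dY) (D _ _ Z _ dZ).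
have [_ ->] := is_derive_bilin (D _ _ h (X x) dh) (DYphi (X x)) (D _ _ Z _ dZ).
rewrite !(bilinDl, bilinDr, bilinNl, bilinNr) /tachibana_tensor.
rewrite (phi_sym (Y x) ('D_(X x) Z x)).
have arith (a1 a2 a3 a4 a5 a6 a7 a8 b1 : R) :
    a1 + a2 + a3 - (a4 + (a5 + a6) + a7) + (a8 - a2 + a5) + (b1 - a3 + a7) =
    a1 - a4 - a6 + a8 + b1 by ring.
exact: arith.
Qed.

Lemma tachibana_tensorDl a a' b c :
  tachibana_tensor (a + a') b c = tachibana_tensor a b c + tachibana_tensor a' b c.
Proof.
rewrite /tachibana_tensor !mulmxDl !(deriveDdir _ _ dh, deriveDdir _ _ dphi).
by tensor_ring.
Qed.

Lemma tachibana_tensorDm a b b' c :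
  tachibana_tensor a (b + b') c = tachibana_tensor a b c + tachibana_tensor a b' c.
Proof.
rewrite /tachibana_tensor !mulmxDl !(deriveDdir _ _ dh, deriveDdir _ _ dphi).
by tensor_ring.
Qed.

Lemma tachibana_tensorDr a b c c' :
  tachibana_tensor a b (c + c') = tachibana_tensor a b c + tachibana_tensor a b c'.
Proof.
rewrite /tachibana_tensor (deriveDdir _ _ dphi).
by tensor_ring.
Qed.

End TachibanaTensor.

Lemma tachibana_pointwise (R : realType) d (phi h : 'rV[R]_d -> 'M[R]_d) (x : 'rV[R]_d)
    (X Y Z X' Y' Z' : 'rV[R]_d -> 'rV[R]_d) :
  differentiable phi x -> differentiable h x ->
  (forall v w, bilin (h x) (v *m phi x) w = bilin (h x) v (w *m phi x)) ->
  differentiable X x -> differentiable Y x -> differentiable Z x ->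
  differentiable X' x -> differentiable Y' x -> differentiable Z' x ->
  X x = X' x -> Y x = Y' x -> Z x = Z' x ->
  tachibana phi h X Y Z x = tachibana phi h X' Y' Z' x.
Proof.
move=> dphi dh sym dX dY dZ dX' dY' dZ' eX eY eZ.
apply: etrans (tachibanaE dphi dh sym dX dY dZ) _.
by apply: etrans _ (esym (tachibanaE dphi dh sym dX' dY' dZ')); rewrite eX eY eZ.
Qed.

(** * The frame of horizontal and vertical fields *)

Section AdaptedFrame.
Variables (R : realType) (n : nat) (O : set 'rV[R]_n) (G : 'rV[R]_n -> 'M[R]_n).
Hypotheses (oO : open O) (sG : smooth O G).
Hypothesis symG : forall x, O x -> (G x)^T = G x.
Hypothesis unitG : forall x, O x -> G x \in unitmx.

Local Notation conn := (along (christoffel_mx G)).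
Local Notation Z := (@cylinder R n n O).
Local Notation base := (@base_coord R n n).
Local Notation fibre := (@fibre_coord R n n).

(** The horizontal lift of the constant field a, in induced coordinates. *)
Definition hfield (a : 'rV[R]_n) (z : 'rV[R]_(n + n * n)) : 'rV[R]_(n + n * n) :=
  row_mx a (mxvec (commutator (conn a (base z)) (fibre z))).

Definition vfield (B : 'M[R]_n) (z : 'rV[R]_(n + n * n)) : 'rV[R]_(n + n * n) :=
  row_mx 0 (mxvec B).

(** Indexing the horizontal and vertical fields by a sum type allows one statement
    for both kinds. *)
Definition frame (s : 'rV[R]_n + 'M[R]_n) : 'rV[R]_(n + n * n) -> 'rV[R]_(n + n * n) :=
  match s with inl a => hfield a | inr B => vfield B end.

Definition frame_sign (s : 'rV[R]_n + 'M[R]_n) : R :=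
  match s with inl _ => -1 | inr _ => 1 end.

Definition curvature_op (a b : 'rV[R]_n) (x : 'rV[R]_n) : 'M[R]_n :=
  'D_a (conn b) x - 'D_b (conn a) x - commutator (conn a x) (conn b x).

(** The fibre component of the Lie bracket of two fields of the frame. *)
Definition frame_bracket (s r : 'rV[R]_n + 'M[R]_n) (z : 'rV[R]_(n + n * n)) : 'M[R]_n :=
  match s, r with
  | inl a, inl b => commutator (curvature_op a b (base z)) (fibre z)
  | inr B, inl a => commutator (conn a (base z)) B
  | inl a, inr B => - commutator (conn a (base z)) B
  | inr _, inr _ => 0
  end.

Lemma frame_span (u z : 'rV[R]_(n + n * n)) : exists a B, u = hfield a z + vfield B z.
Proof.
exists (base u), (fibre u - commutator (conn (base u) (base z)) (fibre z)).
rewrite /hfield /vfield add_row_mx addr0 -linearD addrC subrK.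
by rewrite row_mx_coord.
Qed.

Lemma is_derive_hfield a z w : Z z -> is_derive z w (hfield a)
  (vfield (commutator ('D_(base w) (conn a) (base z)) (fibre z)
           + commutator (conn a (base z)) (fibre w)) z).
Proof.
move=> Oz; have dc := differentiable_along oO (smooth_christoffel oO sG unitG) a Oz.
have Dc : is_derive z w (fun y => conn a (base y)) ('D_(base w) (conn a) (base z)).
  split; last exact: (derive_comp_linear base (conn a)).
  apply: diff_derivable; apply: differentiable_comp => //.
  by apply: linear_differentiable; exact: linear_mx_continuous.
have Df : is_derive z w fibre (fibre w).
  exact: (is_derive_linear_mx fibre (is_derive_id z w)).
have Da : is_derive z w (fun=> a) 0 by exact: is_derive_cst.
have /is_derive_eq := is_derive_row_mx Da (is_derive_linear_mx mxvec
  (is_deriveB (is_derive_mulmx Dc Df) (is_derive_mulmx Df Dc))).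
apply; rewrite /vfield /commutator; congr (row_mx _ (mxvec _)).
move: (_ *m fibre z) (_ *m fibre w) (fibre w *m _) (fibre z *m _).
move=> A B C D; by apply/matrixP => i j; rewrite !mxE; ring.
Qed.

Lemma is_derive_vfield B z w : is_derive z w (vfield B) 0.
Proof. exact: is_derive_cst. Qed.

(** All brackets are vertical, and those of two horizontal fields measure the
    curvature: the horizontal distribution is integrable exactly when the curvature
    acts trivially on (1,1)-tensors. *)
Lemma frame_lie_bracket s r z : Z z ->
  lie_bracket (frame s) (frame r) z = vfield (frame_bracket s r z) z.
Proof.
move=> Oz; rewrite /lie_bracket.
have V0 : vfield 0 z = 0 by rewrite /vfield linear0 row_mx0.
have VB B C : vfield B z - vfield C z = vfield (B - C) z.
  by rewrite /vfield opp_row_mx add_row_mx subr0 -linearB.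
have bH a : base (hfield a z) = a by rewrite base_coord_row_mx.
have fH a : fibre (hfield a z) = commutator (conn a (base z)) (fibre z).
  by rewrite fibre_coord_row_mx.
have bV B : base (vfield B z) = 0 by rewrite base_coord_row_mx.
have fV B : fibre (vfield B z) = B by rewrite fibre_coord_row_mx.
have c0 A : commutator 0 A = 0 :> 'M[R]_n by rewrite /commutator mul0mx mulmx0 subrr.
case: s r => [a|A] [b|B] /=.
- have [_ ->] := is_derive_hfield b (hfield a z) Oz.
  have [_ ->] := is_derive_hfield a (hfield b z) Oz.
  rewrite VB !bH !fH; congr (vfield _ z).
  rewrite /curvature_op /commutator.
  move: ('D_a _ _) ('D_b _ _) (conn a (base z)) (conn b (base z)) (fibre z) => D E K L t.
  rewrite !(mulmxBl, mulmxBr) !mulmxA.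
  move: (D *m t) (t *m D) (E *m t) (t *m E) (L *m K *m t) (L *m t *m K) (K *m t *m L)
    (t *m K *m L) (K *m L *m t) (t *m L *m K) => X1 X2 X3 X4 X5 X6 X7 X8 X9 X10.
  by apply/matrixP => i j; rewrite !mxE; ring.
- have [_ ->] := is_derive_vfield B z (hfield a z).
  have [_ ->] := is_derive_hfield a (vfield B z) Oz.
  by rewrite bV fV derive0 c0 -[X in X - _ = _]V0 VB sub0r add0r.
- have [_ ->] := is_derive_vfield A z (hfield b z).
  have [_ ->] := is_derive_hfield b (vfield A z) Oz.
  by rewrite bV fV derive0 c0 -[X in _ - X = _]V0 VB subr0 add0r.
- have [_ ->] := is_derive_vfield A z (vfield B z).
  have [_ ->] := is_derive_vfield B z (vfield A z).
  by rewrite subrr V0.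
Qed.

Lemma smooth_conn a : smooth O (conn a).
Proof.
apply: (smooth_sum oO) => k; apply/(smooth_mx _ oO) => i j.
under eq_fun do rewrite mxE; apply: (smoothMl oO); apply: (smooth_entry oO).
exact: smooth_christoffel oO sG unitG k.
Qed.

Lemma smooth_frame s : smooth Z (frame s).
Proof.
have oZ : open Z by exact: open_cylinder.
case: s => [a|B] /=; last exact: smooth_cst.
apply: (smooth_row_mx oZ); first exact: smooth_cst.
have sc := @smooth_cylinder R n n n n O (conn a) oO (smooth_conn a).
have sf := @smooth_fibre_coord R n n Z oZ.
by apply: (smooth_mxvec oZ); exact: smooth_commutator.
Qed.

Lemma differentiable_frame s z : Z z -> differentiable (frame s) z.
Proof. exact: (smooth_mx_differentiable (open_cylinder oO) (smooth_frame s)). Qed.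

Lemma curvature_op_basis a b x :
  curvature_op (delta_mx 0 a) (delta_mx 0 b) x = curvature_mx G a b x.
Proof.
have E k : conn (delta_mx 0 k) = christoffel_mx G k.
  by apply/funext => y; rewrite /along lcomb_delta.
by rewrite /curvature_op !E.
Qed.

Lemma curvature_op0 : (forall a b x, O x -> curvature_mx G a b x = 0) ->
  forall a b x, O x -> curvature_op a b x = 0.
Proof.
move=> flat a b x Ox; have sc := smooth_christoffel oO sG unitG.
have flatG y : O y -> forall k l, partial k (christoffel_mx G l) y - partial l (christoffel_mx G k) y =
    christoffel_mx G k y *m christoffel_mx G l y - christoffel_mx G l y *m christoffel_mx G k y.
  by move=> Oy k l; apply: subr0_eq; exact: flat.
rewrite /curvature_op (along_flat oO sc flatG a b Ox) /commutator.
move: ('D__ _ _) (_ *m _) (_ *m _) => D A B.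
by apply/matrixP => i j; rewrite !mxE; ring.
Qed.

Section Model.
Variables (q : 'rV[R]_n -> R) (phi h : 'rV[R]_(n + n * n) -> 'M[R]_(n + n * n)).

Definition frame_metric (s r : 'rV[R]_n + 'M[R]_n) (x : 'rV[R]_n) : R :=
  match s, r with
  | inl a, inl b => q x * bilin (G x) a b
  | inr A, inr B => fibre_metric (G x) A B
  | _, _ => 0
  end.

Hypotheses (sphi : smooth Z phi) (sh : smooth Z h).
Hypothesis phi_frame : forall s z, Z z -> frame s z *m phi z = frame_sign s *: frame s z.
Hypothesis h_frame : forall s r z, Z z ->
  bilin (h z) (frame s z) (frame r z) = frame_metric s r (base z).

Lemma model_phi_sym z v w : Z z -> bilin (h z) (v *m phi z) w = bilin (h z) v (w *m phi z).
Proof.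
move=> Oz; have [a [A ->]] := frame_span v z; have [b [B ->]] := frame_span w z.
have pF s : frame s z *m phi z = frame_sign s *: frame s z by exact: phi_frame.
have hF s r : bilin (h z) (frame s z *m phi z) (frame r z) =
    bilin (h z) (frame s z) (frame r z *m phi z).
  by rewrite !pF bilinZl bilinZr h_frame //; case: s r => [?|?] [?|?] //=; rewrite !mulr0.
rewrite !mulmxDl !bilinDl !bilinDr.
by congr (_ + _ + (_ + _)); [exact: (hF (inl a) (inl b))|exact: (hF (inl a) (inr B))
  |exact: (hF (inr A) (inl b))|exact: (hF (inr A) (inr B))].
Qed.

Lemma smooth_bilin_frame s r :
  smooth Z (fun z => bilin (h z) (frame s z) (frame r z) : R^o).
Proof.
have oZ : open Z by exact: open_cylinder.
apply: (smooth_entry oZ); apply: (smooth_mulmx oZ).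
  by apply: (smooth_mulmx oZ) => //; exact: smooth_frame.
apply/(smooth_mx _ oZ) => i j; under eq_fun do rewrite mxE.
by apply: (smooth_entry oZ); exact: smooth_frame.
Qed.

(** Near z the field X phi is a constant multiple of X, and the bracket of the two
    fields is an eigenvector of phi for the eigenvalue 1 because it is vertical. *)
Lemma lie_derivative_frame s r z : Z z ->
  lie_derivative11 (frame r) phi (frame s) z =
  (frame_sign s - 1) *: frame (inr (frame_bracket r s z)) z.
Proof.
move=> Oz; have oZ : open Z by exact: open_cylinder.
have dF k : differentiable (frame k) z by exact: differentiable_frame.
have -> : lie_derivative11 (frame r) phi (frame s) z =
    frame_sign s *: lie_bracket (frame r) (frame s) z
    - lie_bracket (frame r) (frame s) z *m phi z.
  rewrite /lie_derivative11; congr (_ - _); rewrite {1}/lie_bracket phi_frame //.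
  rewrite (@near_eq_derive _ _ _ _ (frame_sign s \*: frame s)); last first.
    by apply: filterS (open_near oZ Oz) => y Oy; rewrite phi_frame.
  by rewrite deriveZ ?deriveZdir ?scalerBr //; exact: diff_derivable.
rewrite frame_lie_bracket // -[vfield _ z]/(frame (inr _) z) phi_frame //=.
by rewrite scalerBl.
Qed.

(** On the frame the field Y phi is a constant multiple of Y, the metric is a function
    of the base point only, and the Lie derivatives of phi are known. The horizontal
    eigenvalue being -1 and the vertical one 1, the second summand survives for
    horizontal X only. *)
Lemma tachibana_frame s r u z : Z z ->
  tachibana phi h (frame s) (frame r) (frame u) z =
  (frame_sign s - frame_sign r) *
    'D_(base (frame s z)) (fun x => frame_metric r u x : R^o) (base z)
  + (frame_sign s - 1) * (frame_metric (inr (frame_bracket r s z)) u (base z)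
                          + frame_metric r (inr (frame_bracket u s z)) (base z)).
Proof.
move=> Oz; have oZ : open Z by exact: open_cylinder.
have near_Z := open_near oZ Oz.
pose F z := bilin (h z) (frame r z) (frame u z) : R^o.
have dF : differentiable F z by exact: smooth_differentiable oZ (smooth_bilin_frame r u) Oz.
have DF v : 'D_v F z = 'D_(base v) (fun x => frame_metric r u x : R^o) (base z).
  rewrite -derive_comp_linear; apply: near_eq_derive.
  by apply: filterS near_Z => y Oy; exact: h_frame.
have Dphi v : 'D_v (fun y => bilin (h y) (frame r y *m phi y) (frame u y) : R^o) z =
    frame_sign r * 'D_v F z.
  rewrite (@near_eq_derive _ _ _ _ (frame_sign r \*: F)); last first.
    by apply: filterS near_Z => y Oy; rewrite phi_frame // bilinZl.
  by rewrite deriveZ //; exact: diff_derivable.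
rewrite /tachibana Dphi phi_frame // deriveZdir // DF !lie_derivative_frame //.
rewrite bilinZl bilinZr !h_frame //.
have arith (e1 e2 D a b : R) : e1 * D - e2 * D + (e1 - 1) * a + (e1 - 1) * b =
   (e1 - e2) * D + (e1 - 1) * (a + b) by ring.
exact: arith.
Qed.

Lemma tachibana_frame_curvature a b B z : Z z ->
  tachibana phi h (frame (inl a)) (frame (inl b)) (frame (inr B)) z =
  - 2 * fibre_metric (G (base z)) (commutator (curvature_op b a (base z)) (fibre z)) B.
Proof.
move=> Oz; rewrite tachibana_frame //= addr0.
have arith (D c : R) : (-1 - -1) * D + (-1 - 1) * c = - 2 * c by ring.
exact: arith.
Qed.

(** There are eight cases. When X is horizontal and Y, Z are vertical, the derivative
    of the fibre metric cancels the two brackets, by derive_fibre_metric. When X is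
    vertical, the functions of the base point have derivative 0 along X. The other
    cases vanish because horizontal and vertical fields are orthogonal and because
    the curvature is zero. *)
Lemma tachibana_frame0 s r u z : Z z ->
  (forall a b, curvature_op a b (base z) = 0) ->
  tachibana phi h (frame s) (frame r) (frame u) z = 0.
Proof.
move=> Oz flat; rewrite tachibana_frame //.
have c0 a b : commutator (curvature_op a b (base z)) (fibre z) = 0.
  by rewrite flat /commutator mul0mx mulmx0 subrr.
have fm0 A : fibre_metric (G (base z)) A 0 = 0 by rewrite fibre_metricE trmx0 mulmx0 linear0.
have arith1 (D : R) : (-1 - -1) * D + (-1 - 1) * (0 + 0) = 0 by ring.
have arith2 (D x y : R) : (1 - 1) * D + (1 - 1) * (x + y) = 0 by ring.
have arith3 (x y : R) : (1 - -1) * 0 + (1 - 1) * (x + y) = 0 by ring.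
have D0 x v : 'D_v (fun=> 0 : R^o) x = 0 by exact: derive_cst.
have bV A : base (vfield A z) = 0 by rewrite base_coord_row_mx.
case: s => [a|A]; case: r => [b|B]; case: u => [c|C] /=.
- exact: arith1.
- by rewrite D0 c0 fibre_metric0l mulr0 add0r addr0 mulr0.
- by rewrite D0 c0 fm0 mulr0 add0r addr0 mulr0.
- have [_ ->] := derive_fibre_metric oO sG symG unitG (base (hfield a z)) B C Oz.
  rewrite base_coord_row_mx; have arith4 (x y : R) : (-1 - 1) * (- x - y) + (-1 - 1) * (x + y) = 0 by ring.
  exact: arith4.
- by rewrite bV derive0; exact: arith3.
- by rewrite D0; exact: arith3.
- exact: arith2.
- exact: arith2.
Qed.

Lemma tachibana_model X Y W z : Z z ->
  differentiable X z -> differentiable Y z -> differentiable W z ->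
  (forall a b, curvature_op a b (base z) = 0) -> tachibana phi h X Y W z = 0.
Proof.
move=> Oz dX dY dW flat; have oZ : open Z by exact: open_cylinder.
have dphi : differentiable phi z by exact: (smooth_mx_differentiable oZ).
have dh : differentiable h z by exact: (smooth_mx_differentiable oZ).
have sym v w : bilin (h z) (v *m phi z) w = bilin (h z) v (w *m phi z) by exact: model_phi_sym.
have T0 s r u : tachibana_tensor phi h z (frame s z) (frame r z) (frame u z) = 0.
  rewrite -(tachibanaE dphi dh sym); do ?exact: differentiable_frame.
  exact: tachibana_frame0.
rewrite (tachibanaE dphi dh sym) //.
have [a [A ->]] := frame_span (X z) z; have [b [B ->]] := frame_span (Y z) z.
have [c [C ->]] := frame_span (W z) z.
rewrite !(tachibana_tensorDl dphi dh, tachibana_tensorDm h dphi, tachibana_tensorDr h dphi).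
have := T0 (inl a) (inl b) (inl c); have := T0 (inr A) (inl b) (inl c).
have := T0 (inl a) (inr B) (inl c); have := T0 (inr A) (inr B) (inl c).
have := T0 (inl a) (inl b) (inr C); have := T0 (inr A) (inl b) (inr C).
have := T0 (inl a) (inr B) (inr C); have := T0 (inr A) (inr B) (inr C).
by move=> /= -> -> -> -> -> -> -> ->; rewrite !addr0.
Qed.

(** With B the commutator of the curvature and t, the value of the phi-operator on two
    horizontal fields and the vertical lift of B is, up to the factor -2, the square
    length of B. *)
Lemma tachibana_model_flat x : O x ->
  (forall z v, Z z -> v != 0 -> 0 < bilin (h z) v v) ->
  (forall a b B z, base z = x ->
     tachibana phi h (frame (inl a)) (frame (inl b)) (frame (inr B)) z = 0) ->
  forall a b, curvature_mx G a b x = 0.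
Proof.
move=> Ox hpos T0 a b; apply: (curvature_mx_central oO sG symG unitG) => // t.
set C := commutator _ t; pose z := row_mx x (mxvec t) : 'rV[R]_(n + n * n).
have bz : base z = x by rewrite base_coord_row_mx.
have fz : fibre z = t by rewrite fibre_coord_row_mx.
have Oz : Z z by rewrite /cylinder /= bz.
have := T0 (delta_mx 0 b) (delta_mx 0 a) C z bz.
rewrite tachibana_frame_curvature // bz fz curvature_op_basis -/C.
have -> : fibre_metric (G x) C C = bilin (h z) (vfield C z) (vfield C z).
  by rewrite (h_frame (inr C) (inr C) Oz) /= bz.
have [C0|C0] := eqVneq (vfield C z) 0.
  move=> _; rewrite -[LHS](fibre_coord_row_mx (0 : 'rV_n)) -/(vfield C z) C0.
  by rewrite linear0.
have /eqP := lt0r_neq0 (hpos z _ Oz C0); move: (bilin _ _ _) => r r0 /eqP.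
by rewrite mulf_eq0 oppr_eq0 pnatr_eq0 /= => /eqP.
Qed.

End Model.
End AdaptedFrame.

(** * Lifts, structure and metric in induced charts *)

Lemma posdef_unitmx (R : realType) n (A : 'M[R]_n) :
  (forall v : 'rV[R]_n, v != 0 -> 0 < bilin A v v) -> A \in unitmx.
Proof.
move=> Apos; rewrite -row_free_unit; apply: inj_row_free => v vA0.
apply/eqP/negPn/negP => /Apos; have -> : bilin A v v = 0 by rewrite /bilin vA0 mul0mx mxE.
by rewrite ltxx.
Qed.

Section Lifts.
Variables (R : realType) (n : nat) (M : charted R n) (mM : manifold M).
Variables (g : components M 'M[R]_n) (g_metric : riemannian_metric g).
Implicit Types (i j : idx M) (P : T11_point M).

Let admM i : admissible (atlas i).
Proof. by have [+ _ _] := mM; apply. Qed.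

Let admT i : @admissible R (n + n * n) (T11 M) (T11_chart i).
Proof. by have [+ _ _] := T11_manifold mM; apply. Qed.

Local Notation O i := (coord (@atlas R n M i) @` dom (@atlas R n M i)).
Local Notation G i := (in_chart g i).
Local Notation Z i := (@cylinder R n n (O i)).
Local Notation tc i := (coord (@T11_chart R n M i)).

Lemma open_chart i : open (O i).
Proof. exact: open_coord_dom. Qed.

Lemma smooth_metric i : smooth (O i) (G i).
Proof. by have [+ _ _ _] := g_metric; move=> /(_ i); rewrite setIT. Qed.

Lemma metric_sym i x : O i x -> (G i x)^T = G i x.
Proof.
by have [_ _ + _] := g_metric; move=> sg [p pi <-]; rewrite /in_chart atlas_coordK //; exact: sg.
Qed.

Lemma metric_pos i x : O i x -> forall v : 'rV[R]_n, v != 0 -> 0 < bilin (G i x) v v.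
Proof.
by have [_ _ _ +] := g_metric; move=> sg [p pi <-]; rewrite /in_chart atlas_coordK //; exact: sg.
Qed.

Lemma metric_unit i x : O i x -> G i x \in unitmx.
Proof. by move=> /metric_pos; exact: posdef_unitmx. Qed.

Lemma base_T11 i P : base_coord (tc i P) = coord (atlas i) (foot P).
Proof. exact: base_coord_row_mx. Qed.

Lemma fibre_T11 i P : fibre_coord (tc i P) = comps P i.
Proof. exact: fibre_coord_row_mx. Qed.

Lemma T11_cylinder i P : dom (atlas i) (foot P) -> Z i (tc i P).
Proof. by move=> Pi; rewrite /cylinder /= base_T11; exists (foot P). Qed.

(** The double sum in the fibre part of the horizontal lift is a commutator with the
    connection form. *)
Lemma hliftE X i P : hlift g X i P = hfield (G i) (X i (foot P)) (tc i P).
Proof.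
rewrite /hfield base_T11 fibre_T11; congr (row_mx _ (mxvec _)).
apply/matrixP => j k; rewrite !mxE.
have E (x : 'rV[R]_n) a b : (along (christoffel_mx (G i)) (X i (foot P)) x) a b =
    \sum_s X i (foot P) 0 s * christoffel (G i) x s a b.
  by rewrite summxE; apply: eq_bigr => s _; rewrite !mxE.
under [X in _ = X - _]eq_bigr do rewrite E mulr_suml.
under [X in _ = _ - X]eq_bigr do rewrite E mulr_sumr.
rewrite [X in _ = X - _]exchange_big [X in _ = _ - X]exchange_big -sumrB.
apply: eq_bigr => s _; rewrite -sumrB mulr_sumr; apply: eq_bigr => m _.
move: (X i _ 0 s) (christoffel _ _ s j m) (christoffel _ _ s m k) (comps P i m k) (comps P i j m).
by move=> a b c d e; ring.
Qed.

Lemma vliftE A i P : vlift A i P = vfield (A i (foot P)) (tc i P).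
Proof. by []. Qed.

(** Every vector of the frame is the value of a lift of a local section, so that what
    is known of J and of the metric on lifts determines them completely. *)
Lemma lifts_in_chart i (a : 'rV[R]_n) (B : 'M[R]_n) P : dom (atlas i) (foot P) ->
  hlift g (field_in_chart i (fun=> a)) i P = frame (G i) (inl a) (tc i P) /\
  vlift (tensor_in_chart i B) i P = frame (G i) (inr B) (tc i P).
Proof.
move=> Pi; rewrite hliftE vliftE (field_in_chartE admM) // (tensor_in_chartE admM) //.
Qed.

Lemma constant_field i a : vector_field (dom (atlas i)) (field_in_chart i (fun=> a)).
Proof. by apply: vector_field_in_chart => // m; apply: C_upto_cst. Qed.


Lemma frame_T11 i z : Z i z -> exists2 P, dom (atlas i) (foot P) & tc i P = z.
Proof. by rewrite -(T11_coord_dom mM) => -[P Pi <-]; exists P. Qed.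

Lemma in_chart_T11 (V : Type) (F : components (T11 M) V) i P :
  dom (atlas i) (foot P) -> in_chart F i (tc i P) = F i P.
Proof. by move=> Pi; rewrite /in_chart (@atlas_coordK _ _ (T11 M) admT i P Pi). Qed.

Section HorizontalVertical.
Variables (J : components (T11 M) 'M[R]_(n + n * n)).
Hypothesis J_structure : horizontal_vertical_structure g J.

Lemma J_frame i s z : Z i z ->
  frame (G i) s z *m in_chart J i z = frame_sign s *: frame (G i) s z.
Proof.
move=> /frame_T11[P Pi <-]; rewrite in_chart_T11 //.
have [_ Js] := J_structure; have oD := @open_in_dom _ _ _ admM i.
have Jl a B := Js _ _ _ oD (tensor11_field_in_chart admM i B) (constant_field i a) i P Pi Pi.
case: s => [a|B].
  by have [+ _] := Jl a 0; rewrite /app11; have [-> _] := lifts_in_chart a 0 Pi; rewrite scaleN1r.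
by have [_ +] := Jl 0 B; rewrite /app11; have [_ ->] := lifts_in_chart 0 B Pi; rewrite scale1r.
Qed.

Lemma smooth_J i : smooth (Z i) (in_chart J i).
Proof.
have [[sJ _] _] := J_structure; have := sJ i; rewrite setIT -(T11_coord_dom mM); exact.
Qed.

Lemma J_involutive i P : dom (atlas i) (foot P) -> J i P *m J i P = 1%:M.
Proof.
move=> Pi; rewrite -(in_chart_T11 J Pi).
apply: eq_row_mulmx => v; rewrite mulmx1 mulmxA.
have [a [A ->]] := frame_span (G i) v (tc i P).
have JF s : frame (G i) s (tc i P) *m in_chart J i (tc i P) *m in_chart J i (tc i P) =
    frame (G i) s (tc i P).
  rewrite !(J_frame s (T11_cylinder Pi)) -scalemxAl (J_frame s (T11_cylinder Pi)) scalerA.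
  by case: s => ?; rewrite /= ?mulrNN mulr1 scale1r.
by rewrite !mulmxDl (JF (inl a)) (JF (inr A)).
Qed.

End HorizontalVertical.

Section Sasaki.
Variables (f : M -> R) (Sg : components (T11 M) 'M[R]_(n + n * n)).
Hypothesis Sg_sasaki : rescaled_sasaki g f Sg.

Lemma smooth_Sg i : smooth (Z i) (in_chart Sg i).
Proof.
have [[sS _ _ _] _] := Sg_sasaki; have := sS i; rewrite setIT -(T11_coord_dom mM); exact.
Qed.

Lemma Sg_pos i z v : Z i z -> v != 0 -> 0 < bilin (in_chart Sg i z) v v.
Proof.
move=> /frame_T11[P Pi <-]; rewrite in_chart_T11 //.
by have [[_ _ _ pS] _] := Sg_sasaki; exact: pS.
Qed.

Lemma Sg_frame i s r z : Z i z ->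
  bilin (in_chart Sg i z) (frame (G i) s z) (frame (G i) r z) =
  frame_metric (G i) (f \o param (atlas i)) s r (base_coord z).
Proof.
move=> /frame_T11[P Pi <-]; rewrite in_chart_T11 // base_T11.
have [[_ _ symS _] Ss] := Sg_sasaki; have oD := @open_in_dom _ _ _ admM i.
have tF := tensor11_field_in_chart admM i.
have Sl A B a b := Ss _ _ _ _ _ oD (tF A) (tF B) (constant_field i a) (constant_field i b) i P Pi Pi.
have fG (F : M -> R) : F (foot P) = (F \o param (atlas i)) (coord (atlas i) (foot P)).
  by rewrite /= atlas_coordK.
have gG : g i (foot P) = G i (coord (atlas i) (foot P)) by rewrite /in_chart atlas_coordK.
case: s r => [a|A] [b|B] /=.
- have [_ _] := Sl 0 0 a b; have [-> _] := lifts_in_chart a 0 Pi.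
  have [-> _] := lifts_in_chart b 0 Pi => ->.
  by rewrite !(field_in_chartE admM) // gG fG.
- have [_ + _] := Sl B B a a; have [-> ->] := lifts_in_chart a B Pi.
  by move=> E; rewrite -[RHS]E; apply: bilinC; exact: (symS i P Pi).
- by have [_ + _] := Sl A A b b; have [-> ->] := lifts_in_chart b A Pi.
- have [+ _ _] := Sl A B 0 0; have [_ ->] := lifts_in_chart 0 A Pi.
  by have [_ ->] := lifts_in_chart 0 B Pi => ->; rewrite !(tensor_in_chartE admM) // gG.
Qed.

End Sasaki.
End Lifts.

(** * Integrability and the equivalence with flatness *)

Section Straightening.
Variables (R : realType) (n : nat) (V : set 'rV[R]_n) (oV : open V).

Local Notation base := (@base_coord R n n).
Local Notation fibre := (@fibre_coord R n n).

(** With P a parallel frame, P^-1 t P are the components of the tensor t in that frame. *)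
Definition fibre_conj (P : 'rV[R]_n -> 'M[R]_n) (z : 'rV[R]_(n + n * n)) :
    'rV[R]_(n + n * n) :=
  row_mx (base z) (mxvec (invmx (P (base z)) *m fibre z *m P (base z))).

Lemma fibre_conjK P z : P (base z) \in unitmx ->
  fibre_conj (fun x => invmx (P x)) (fibre_conj P z) = z.
Proof.
move=> uP; rewrite /fibre_conj base_coord_row_mx fibre_coord_row_mx invmxK.
rewrite !mulmxA mulmxV // mul1mx -mulmxA mulmxV // mulmx1.
exact: row_mx_coord.
Qed.

Lemma smooth_fibre_conj P : smooth V P -> (forall x, V x -> P x \in unitmx) ->
  smooth (@cylinder R n n V) (fibre_conj P).
Proof.
move=> sP uP; have oZ : open (@cylinder R n n V) by exact: open_cylinder.
have scyl F := @smooth_cylinder R n n n n V F oV.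
apply: (smooth_row_mx oZ); first exact: (@smooth_base_coord R n n).
apply: (smooth_mxvec oZ); apply: (smooth_mulmx oZ); last exact: scyl.
apply: (smooth_mulmx oZ); last exact: (@smooth_fibre_coord R n n).
exact/(scyl (fun x => invmx (P x)))/(smooth_invmx oV).
Qed.

Variables (G : 'rV[R]_n -> 'M[R]_n) (P : 'rV[R]_n -> 'M[R]_n).
Hypotheses (sP : smooth V P) (uP : forall x, V x -> P x \in unitmx).
Hypothesis dP : forall x, V x -> forall a, partial a P x = christoffel_mx G a x *m P x.

Lemma fibre_conj_image : fibre_conj P @` @cylinder R n n V = @cylinder R n n V.
Proof.
have uP' x : V x -> invmx (P x) \in unitmx by move=> Vx; rewrite unitmx_inv uP.
apply/seteqP; split=> z; rewrite /cylinder /=.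
  by move=> [y Vy <-]; rewrite /fibre_conj base_coord_row_mx.
move=> Vz; exists (fibre_conj (fun x => invmx (P x)) z).
  by rewrite /fibre_conj base_coord_row_mx.
have PE : (fun x => invmx (invmx (P x))) = P by apply/funext => x; rewrite invmxK.
by have := @fibre_conjK (fun x => invmx (P x)) z (uP' _ Vz); rewrite PE.
Qed.

(** The components of t in a parallel frame are constant along horizontal fields. *)
Lemma derive_fibre_conj z s : V (base z) ->
  'D_(frame G s z) (fibre_conj P) z =
  match s with
  | inl a => row_mx a 0
  | inr B => row_mx 0 (mxvec (invmx (P (base z)) *m B *m P (base z)))
  end.
Proof.
move=> Vz; set w := frame G s z.
have nu : \forall y \near base z, P y \in unitmx.
  by apply: filterS (open_near oV Vz) => y; exact: uP.
have dPx := smooth_mx_differentiable oV sP Vz.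
have dix := smooth_mx_differentiable oV (smooth_invmx oV uP sP) Vz.
have DPx : is_derive (base z) (base w) P (along (christoffel_mx G) (base w) (base z) *m P (base z)).
  split; first exact: diff_derivable.
  rewrite deriveE_partial // /along /lcomb mulmx_suml; apply: eq_bigr => a _.
  by rewrite dP // scalemxAl.
have DIx := derive_invmx nu (diff_derivable dix) DPx.
have lift (F : 'rV[R]_n -> 'M[R]_n) dF : differentiable F (base z) ->
    is_derive (base z) (base w) F dF -> is_derive z w (fun y => F (base y)) dF.
  move=> df [_ <-]; split; last exact: (derive_comp_linear base F).
  apply: diff_derivable; apply: differentiable_comp => //.
  by apply: linear_differentiable; exact: linear_mx_continuous.
have Db : is_derive z w base (base w) by exact: (is_derive_linear_mx base (is_derive_id z w)).
have Df : is_derive z w fibre (fibre w) by exact: (is_derive_linear_mx fibre (is_derive_id z w)).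
have [_ ->] := is_derive_row_mx Db (is_derive_linear_mx mxvec
  (is_derive_mulmx (is_derive_mulmx (lift _ _ dix DIx) Df) (lift _ _ dPx DPx))).
move: (uP Vz); move: (P (base z)) => p up.
rewrite /w; case: s @w {DPx DIx lift Db Df} => [a|B] w /=; rewrite base_coord_row_mx fibre_coord_row_mx.
  set K := along _ _ _; set t := fibre z.
  have -> : invmx p *m (K *m p) *m invmx p = invmx p *m K by rewrite mulmxA mulmxK.
  rewrite /commutator mulNmx mulmxBr addrA !mulmxA addNr sub0r mulNmx addNr.
  by rewrite linear0.
have -> : along (christoffel_mx G) 0 (base z) = 0.
  by rewrite /along /lcomb big1 // => k _; rewrite mxE scale0r.
by rewrite !(mul0mx, mulmx0) oppr0 mul0mx add0r addr0.
Qed.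

Lemma derive_fibre_conj_sign z s : V (base z) ->
  'D_(frame G s z) (fibre_conj P) z *m block_mx (- 1%:M) 0 0 1%:M =
  frame_sign s *: 'D_(frame G s z) (fibre_conj P) z.
Proof.
move=> Vz; rewrite derive_fibre_conj //.
case: s => [a|B] /=; rewrite mul_row_block !(mul0mx, mulmx0, mulmxN, mulmx1, addr0, add0r).
  by rewrite scaleN1r opp_row_mx oppr0.
by rewrite scale1r.
Qed.

End Straightening.

Section Structures.
Variables (R : realType) (n : nat) (n_gt0 : (0 < n)%N).
Variables (M : charted R n) (mM : manifold M).
Variables (g : components M 'M[R]_n) (g_metric : riemannian_metric g).
Variables (f : M -> R) (Sg J : components (T11 M) 'M[R]_(n + n * n)).
Hypothesis Sg_sasaki : rescaled_sasaki g f Sg.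
Hypothesis J_structure : horizontal_vertical_structure g J.
Implicit Types (i j : idx M) (P : T11_point M).

Let admM i : admissible (atlas i).
Proof. by have [+ _ _] := mM; apply. Qed.

Let admT i : @admissible R (n + n * n) (T11 M) (T11_chart i).
Proof. by have [+ _ _] := T11_manifold mM; apply. Qed.

Local Notation O i := (coord (@atlas R n M i) @` dom (@atlas R n M i)).
Local Notation G i := (in_chart g i).
Local Notation Z i := (@cylinder R n n (O i)).
Local Notation tc i := (coord (@T11_chart R n M i)).

Lemma flat_curvature_mx : flat g <->
  forall i x, O i x -> forall a b, curvature_mx (G i) a b x = 0.
Proof.
have E i x a b (Ox : O i x) := @curvature_mxE R n (O i) (G i) (@open_chart R n M mM i)
  (@smooth_metric _ _ _ _ g_metric i) (@metric_unit _ _ _ mM _ g_metric i) a b x Ox.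
split=> flatg i.
  move=> x [p pi <-] a b; rewrite E; last by exists p.
  by apply/matrixP => c l; rewrite !mxE; exact: flatg.
move=> p pi a b c l; have Ox : O i (coord (atlas i) p) by exists p.
by have := flatg i _ Ox a b; rewrite E // => /matrixP/(_ c l); rewrite !mxE.
Qed.

Lemma J_symmetric i P v w : dom (atlas i) (foot P) ->
  bilin (Sg i P) (v *m J i P) w = bilin (Sg i P) v (w *m J i P).
Proof.
move=> Pi; rewrite -(in_chart_T11 mM J Pi) -(in_chart_T11 mM Sg Pi).
exact: (model_phi_sym (J_frame mM J_structure (i := i))
  (fun s r z => Sg_frame mM Sg_sasaki s r (z := z)) v w (T11_cylinder Pi)).
Qed.

Lemma Sg_norden_metric : norden_metric J Sg.
Proof.
split; first by have [] := Sg_sasaki.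
by move=> W X Y _ _ _ i P Pi _; exact: J_symmetric.
Qed.

Lemma almost_product_J : almost_product J.
Proof.
have [_ _ [c cov]] := T11_manifold mM.
have [k] := cov point; move: (c k : idx M) (point : T11_point M) => i P {c cov k} /= Pi.
have JF s : frame (G i) s (tc i P) *m J i P = frame_sign s *: frame (G i) s (tc i P).
  rewrite -(in_chart_T11 mM J Pi); have zP : Z i (tc i P) by exact: T11_cylinder.
  exact: (@J_frame _ _ _ mM _ _ J_structure i s _ zP).
have frame0 s : frame (G i) s (tc i P) = - frame (G i) s (tc i P) -> frame (G i) s (tc i P) = 0.
  by move=> /eqP; rewrite -addr_eq0 -mulr2n -scaler_nat scaler_eq0 pnatr_eq0 /= => /eqP.
split; [by have [] := J_structure|exact: (J_involutive mM J_structure)| |].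
  move=> /(_ i P Pi) J1; have := JF (inl (const_mx 1)); rewrite J1 mulmx1 scaleN1r.
  move=> /frame0/(congr1 (@base_coord R n n)); rewrite base_coord_row_mx linear0.
  by move=> /matrixP/(_ 0 (Ordinal n_gt0))/eqP; rewrite !mxE oner_eq0.
move=> /(_ i P Pi) J1; have := JF (inr (const_mx 1)); rewrite J1 mulmxN mulmx1 scale1r.
move=> /esym/frame0/(congr1 (@fibre_coord R n n)); rewrite fibre_coord_row_mx linear0.
by move=> /matrixP/(_ (Ordinal n_gt0) (Ordinal n_gt0))/eqP; rewrite !mxE oner_eq0.
Qed.

(** The value of the phi-operator depends on the values of the three fields only, which
    are combinations of the frame. *)
Lemma flat_tachibana : flat g -> tachibana_vanishes J Sg.
Proof.
move=> /flat_curvature_mx flatg W X Y U oW [sX _] [sY _] [sU _] i P Pi PW.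
have oWi := oW i; change (idx M) in i.
have zW : (tc i @` (dom (@T11_chart R n M i) `&` W)) (tc i P) by exists P.
have [sG iG] := (@smooth_metric _ _ _ _ g_metric i, @metric_unit _ _ _ mM _ g_metric i).
have flat_op := @curvature_op0 _ _ _ _ (@open_chart R n M mM i) sG iG (fun a b x Ox => flatg i x Ox a b).
have zO : Z i (tc i P) by exact: T11_cylinder.
apply: (tachibana_model (@open_chart R n M mM i) sG (@metric_sym _ _ _ mM _ g_metric i) iG
  (@smooth_J _ _ _ mM _ _ J_structure i) (@smooth_Sg _ _ _ mM _ _ _ Sg_sasaki i)
  (J_frame mM J_structure (i := i)) (fun s r z => Sg_frame mM Sg_sasaki s r (z := z)) zO).
- exact: (smooth_mx_differentiable oWi) (sX i) zW.
- exact: (smooth_mx_differentiable oWi) (sY i) zW.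
- exact: (smooth_mx_differentiable oWi) (sU i) zW.
- by move=> a b; exact: flat_op.
Qed.

(** The fields of the frame over a chart are smooth vector fields on the domain of the
    induced chart, so that the condition applies to them. *)
Lemma tachibana_flat : tachibana_vanishes J Sg -> flat g.
Proof.
move=> T0; apply/flat_curvature_mx => i x Ox.
have [sG iG] := (@smooth_metric _ _ _ _ g_metric i, @metric_unit _ _ _ mM _ g_metric i).
have oO := @open_chart R n M mM i; have oZ : open (Z i) by exact: open_cylinder.
have yG := @metric_sym _ _ _ mM _ g_metric i.
have sJ := @smooth_J _ _ _ mM _ _ J_structure i.
have sS := @smooth_Sg _ _ _ mM _ _ _ Sg_sasaki i.
have fJ s z := J_frame mM J_structure (i := i) s (z := z).
have fS s r z := Sg_frame mM Sg_sasaki s r (i := i) (z := z).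
apply: (tachibana_model_flat oO sG yG iG sS fJ fS Ox) => [z v|a b B z bz].
  exact: (@Sg_pos _ _ _ mM _ _ _ Sg_sasaki i z v).
have Oz : Z i z by rewrite /cylinder /= bz.
have [P Pi Pz] := frame_T11 mM Oz.
pose F s : components (T11 M) _ := @field_in_chart R _ (T11 M) i (frame (G i) s).
have dcE := T11_coord_dom mM i.
have vF s : vector_field (dom (T11_chart i) : set (T11 M)) (F s).
  apply: (@vector_field_in_chart _ _ (T11 M) admT i) => //.
  by have := @smooth_frame _ _ _ _ oO sG iG s; rewrite -dcE.
have oD : open_in (dom (T11_chart i) : set (T11 M)) by exact: (@open_in_dom _ _ (T11 M) admT i).
have := T0 _ _ _ _ oD (vF (inl a)) (vF (inl b)) (vF (inr B)) i P Pi Pi.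
have Pz' : coord (@atlas R _ (T11 M) i) P = z by exact: Pz.
rewrite Pz'; have dphi : differentiable (in_chart J i) z by exact: (smooth_mx_differentiable oZ).
have dh : differentiable (in_chart Sg i) z by exact: (smooth_mx_differentiable oZ).
have sym v w : bilin (in_chart Sg i z) (v *m in_chart J i z) w =
    bilin (in_chart Sg i z) v (w *m in_chart J i z).
  by rewrite -Pz !in_chart_T11 //; exact: J_symmetric.
have dF s : differentiable (in_chart (F s) i) z.
  have [sF _] := vF s; have := sF i; rewrite setIid => sFi.
  have zd : (tc i @` dom (T11_chart i)) z by exists P.
  have od : open (tc i @` dom (T11_chart i)) by rewrite dcE.
  exact: (smooth_mx_differentiable od) sFi zd.
have FE s : in_chart (F s) i z = frame (G i) s z.
  rewrite -[in LHS]Pz in_chart_T11 //.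
  by apply: etrans (@field_in_chartE _ _ (T11 M) admT i _ P Pi) _; rewrite Pz'.
have dfr s : differentiable (frame (G i) s) z by exact: differentiable_frame oO sG iG s z Oz.
have eT := tachibana_pointwise dphi dh sym (dF (inl a)) (dF (inl b)) (dF (inr B))
  (dfr (inl a)) (dfr (inl b)) (dfr (inr B)) (FE (inl a)) (FE (inl b)) (FE (inr B)).
by move=> T; exact: etrans (esym eT) T.
Qed.

(** In the coordinates x, P^-1 t P the horizontal and vertical distributions are spanned
    by coordinate fields, hence J has the constant matrix diag(-1, 1). *)
Lemma flat_integrable : flat g -> integrable_structure J.
Proof.
move=> /flat_curvature_mx flatg P.
have [_ _ [c cov]] := T11_manifold mM.
have [k] := cov P; move: (c k : idx M) => i {c cov k} /= Pi.
have [sG iG] := (@smooth_metric _ _ _ _ g_metric i, @metric_unit _ _ _ mM _ g_metric i).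
have oO := @open_chart R n M mM i; have Ox : O i (coord (atlas i) (foot P)) by exists (foot P).
have flatG y : O i y -> forall k l,
    partial k (christoffel_mx (G i) l) y - partial l (christoffel_mx (G i) k) y =
    christoffel_mx (G i) k y *m christoffel_mx (G i) l y
    - christoffel_mx (G i) l y *m christoffel_mx (G i) k y.
  by move=> Oy k l; apply: subr0_eq; exact: flatg.
have [V [Q [oV Vx VO sQ uQ]]] :=
  smooth_parallel_frame oO Ox (fun a => smooth_christoffel oO sG iG a) flatG.
have uV x : V x -> Q x \in unitmx by move=> /uQ[].
have dV x : V x -> forall a, partial a Q x = christoffel_mx (G i) a x *m Q x by move=> /uQ[].
have uV' x : V x -> invmx (Q x) \in unitmx by move=> Vx'; rewrite unitmx_inv uV.
pose ZV := @cylinder R n n V; have oZV : open ZV by exact: open_cylinder.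
have im : fibre_conj Q @` ZV = ZV by exact: fibre_conj_image.
have ZVsub : ZV `<=` coord (@atlas R _ (T11 M) i) @` dom (@atlas R _ (T11 M) i).
  by rewrite [_ @` _](T11_coord_dom mM i) => z; exact: VO.
have spsi : smooth ZV (fibre_conj Q) by exact: smooth_fibre_conj.
have oim : open (fibre_conj Q @` ZV) by rewrite im.
have spsi' : smooth (fibre_conj Q @` ZV) (fibre_conj (fun x => invmx (Q x))).
  by rewrite im; apply: (smooth_fibre_conj oV) => //; exact: (smooth_invmx oV).
have psiK z : ZV z -> fibre_conj (fun x => invmx (Q x)) (fibre_conj Q z) = z.
  by move=> Vz; apply: fibre_conjK; exact: uV.
pose c := @diffeo_chart R _ (T11 M) i ZV (fibre_conj Q).
exists c, (block_mx (- 1%:M) 0 0 1%:M); split.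
- exact: (@diffeo_chart_admissible _ _ (T11 M) admT i ZV _ _ oZV ZVsub spsi oim spsi' psiK).
- by split=> //; rewrite /ZV /cylinder /= base_coord_row_mx.
move=> j q cq qj; have [qi Vq] := cq.
have Jc : J i q *m chart_jac (T11_chart i) c q =
    chart_jac (T11_chart i) c q *m block_mx (- 1%:M) 0 0 1%:M.
  have jc v : v *m chart_jac (T11_chart i) c q = 'D_v (fibre_conj Q) (tc i q).
    exact: (@diffeo_chart_jac _ _ (T11 M) admT i ZV _ _ oZV ZVsub spsi oim spsi' psiK q v cq).
  have zP : Z i (tc i q) by exact: T11_cylinder.
  have bV : V (base_coord (tc i q)) by exact: Vq.
  (* J is -1 or 1 on a frame field, and its image in the new coordinates is a
     coordinate vector field of the same kind *)
  have JF s : frame (G i) s (tc i q) *m J i q *m chart_jac (T11_chart i) c q =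
      frame (G i) s (tc i q) *m chart_jac (T11_chart i) c q *m block_mx (- 1%:M) 0 0 1%:M.
    rewrite -(in_chart_T11 mM J qi) (@J_frame _ _ _ mM _ _ J_structure i s _ zP).
    apply: etrans (esym (scalemxAl _ _ _)) _; rewrite jc.
    exact: esym (derive_fibre_conj_sign oV sQ uV dV s bV).
  apply: eq_row_mulmx => v; rewrite !mulmxA.
  have [a [B ->]] := frame_span (G i) v (tc i q).
  by rewrite !mulmxDl; congr (_ + _); [exact: (JF (inl a))|exact: (JF (inr B))].
have cJ := @diffeo_chart_jacM _ _ (T11 M) admT i ZV _ _ oZV ZVsub spsi oim spsi' psiK j q qj cq.
have [[_ /(_ q Logic.I) tJ] _] := J_structure.
apply: etrans (congr1 (mulmx _) cJ) _; apply: etrans (mulmxA _ _ _) _.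
apply: etrans (congr1 (mulmx^~ _) (tJ j i qj qi)) _; apply: etrans (esym (mulmxA _ _ _)) _.
apply: etrans (congr1 (mulmx _) Jc) _; apply: etrans (mulmxA _ _ _) _.
exact: (@congr1 _ _ (mulmx^~ (block_mx (- 1%:M) 0 0 1%:M)) _ _ (esym cJ)).
Qed.

End Structures.

Theorem theorem3 (R : realType) (n : nat) (n_gt0 : (0 < n)%N)
    (M : charted R n) (M_manifold : manifold M)
    (g : components M 'M[R]_n) (g_metric : riemannian_metric g)
    (f : M -> R) (f_smooth : smooth_function f) (f_gt0 : forall p : M, 0 < f p)
    (Sg : components (T11 M) 'M[R]_(n + n * n))
    (Sg_sasaki : rescaled_sasaki g f Sg)
    (J : components (T11 M) 'M[R]_(n + n * n))
    (J_structure : horizontal_vertical_structure g J) :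
  (para_kahler_norden_any_rank J Sg <-> flat g) /\
  (eigenbundles_same_rank J -> (para_kahler_norden J Sg <-> flat g)).
Proof.
have mT := T11_manifold M_manifold.
have even_dim : ~~ odd (n + n * n) by rewrite oddD oddM andbb addbb.
have J_product := almost_product_J n_gt0 M_manifold J_structure.
have Sg_norden := Sg_norden_metric M_manifold Sg_sasaki J_structure.
have flat_integr := flat_integrable M_manifold g_metric J_structure.
have flat_tach := flat_tachibana M_manifold g_metric Sg_sasaki J_structure.
have tach_flat := tachibana_flat M_manifold g_metric Sg_sasaki J_structure.
split=> [|same_rank]; split=> [[]|flat_g].
- by move=> _ _ _ _ /tach_flat.
- by split=> //; [exact: flat_integr|exact: flat_tach].
- by move=> _ _ /tach_flat.
- by split; [split|exact: flat_integr|exact: flat_tach].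
Qed.
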